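(* Let $1 < p < q < \infty$ and let $(\Omega,\mu)$ be a finite measure space. Let $T: L^p(\Omega,\mu) \to L^p(\Omega,\mu)$ be a positive and power-bounded linear operator such that $T L^p(\Omega,\mu) \subseteq L^q(\Omega,\mu)$. Then $r_{\mathrm{ess}}(T) < 1$.
   Context: All Banach spaces and $L^p$-spaces are over the complex scalar field. A linear operator $T$ on $L^p(\Omega,\mu)$ is positive if $Tf \ge 0$ almost everywhere whenever $f \in L^p(\Omega,\mu)$ satisfies $f \ge 0$ almost everywhere (such operators are automatically bounded). It is power-bounded if $\sup_{n \in \mathbb{N}_0} \|T^n\| < \infty$ (operator norm). The essential spectral radius $r_{\mathrm{ess}}(T)$ of a bounded linear operator $T$ on a complex Banach space is the smallest number $r \in [0,\infty)$ such that every complex number of modulus $> r$ is either in the resolvent set of $T$ or is a pole of the resolvent of $T$ and an eigenvalue of $T$ of finite algebraic multiplicity. *)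

(* Defs.v *)
From HB Require Import structures.
From mathcomp Require Import all_boot all_order all_algebra ring_quotient.
From mathcomp Require Import complex.
From mathcomp Require Import all_classical all_reals all_analysis.
From mathcomp Require Import measurable_realfun.

Set Implicit Arguments.
Unset Strict Implicit.
Unset Printing Implicit Defensive.

Import Order.TTheory GRing.Theory Num.Theory numFieldNormedType.Exports.
Import ComplexField.Normc.

Local Open Scope classical_set_scope.
Local Open Scope ring_scope.
Local Open Scope complex_scope.
Local Open Scope quotient_scope.

Section complex_Lfun.
Context d (T : measurableType d) (R : realType).
Variable mu : {measure set T -> \bar R}.
Implicit Types (f g : T -> R[i]) (p : R).

(* R[i] carries no canonical sigma-algebra: f is measurable when its real and
   imaginary parts are. *)
Definition cmeasurable f :=
  measurable_fun setT (fun x => complex.Re (f x)) /\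
  measurable_fun setT (fun x => complex.Im (f x)).

Definition cLnorm p f : \bar R := Lnorm mu p%:E (fun x => (normc (f x))%:E).

(* Complex-valued functions in script-L^p, before identification modulo null
   sets. *)
Definition cLfun p : {pred T -> R[i]} :=
  mem [set f | cmeasurable f /\ (cLnorm p f < +oo)%E].

Lemma cLfunP p f : reflect (cmeasurable f /\ (cLnorm p f < +oo)%E) (f \in cLfun p).
Proof. by apply: (iffP idP) => [/set_mem|/mem_set]. Qed.

Lemma measurable_normc f : cmeasurable f ->
  measurable_fun setT (fun x => normc (f x)).
Proof.
move=> [mr mi].
rewrite (_ : (fun x => _) = (fun x => Num.sqrt
  ((complex.Re (f x)) ^+ 2 + (complex.Im (f x)) ^+ 2))); last first.
  by apply/funext => x; case: (f x).
apply: (@measurableT_comp _ _ _ _ _ _ (@Num.sqrt R)).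
  by apply: continuous_measurable_fun; exact: sqrt_continuous.
by apply: measurable_funD; exact: measurable_funX.
Qed.

Lemma cmeasurable0 : cmeasurable 0.
Proof. by split; exact: measurable_cst. Qed.

Lemma cmeasurableB f g : cmeasurable f -> cmeasurable g -> cmeasurable (f - g).
Proof.
move=> [fr fi] [gr gi]; split.
- rewrite (_ : (fun x => _) = (fun x => complex.Re (f x)) \-
    (fun x => complex.Re (g x))); first exact: measurable_funB.
  by apply/funext => x; rewrite /= !fctE /=; case: (f x) (g x) => a b [c e].
- rewrite (_ : (fun x => _) = (fun x => complex.Im (f x)) \-
    (fun x => complex.Im (g x))); first exact: measurable_funB.
  by apply/funext => x; rewrite /= !fctE /=; case: (f x) (g x) => a b [c e].
Qed.

Lemma cmeasurableZ (a : R[i]) f : cmeasurable f ->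
  cmeasurable (fun x => a * f x).
Proof.
move: a => [a b] [fr fi]; split.
- rewrite (_ : (fun x => _) = (fun x => a * complex.Re (f x)) \-
    (fun x => b * complex.Im (f x))).
    by apply: measurable_funB; apply: measurable_funM => //; exact: measurable_cst.
  by apply/funext => x /=; case: (f x).
- rewrite (_ : (fun x => _) = (fun x => a * complex.Im (f x)) \+
    (fun x => b * complex.Re (f x))).
    by apply: measurable_funD; apply: measurable_funM => //; exact: measurable_cst.
  by apply/funext => x /=; case: (f x).
Qed.

Lemma normc_ge0 (z : R[i]) : 0 <= normc z.
Proof. by case: z => a b; exact: sqrtr_ge0. Qed.

Lemma cLnorm_ge0 p f : (0 <= cLnorm p f)%E.
Proof. exact: Lnorm_ge0. Qed.

Lemma ae_eq_cLnorm p f g : cmeasurable f -> cmeasurable g ->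
  {ae mu, forall x, f x = g x} -> cLnorm p f = cLnorm p g.
Proof.
move=> mf mg fg; rewrite /cLnorm unlock; congr (_ `^ _)%E.
have meas h : cmeasurable h ->
    measurable_fun setT (fun x => `|(normc (h x))%:E| `^ p)%E.
  move=> mh; apply: (measurableT_comp (measurable_poweR p)) => //.
  by apply: measurableT_comp => //; apply/measurable_EFinP; exact: measurable_normc.
apply: ge0_ae_eq_integral => //; try exact: meas.
- by move=> x _; exact: poweR_ge0.
- by move=> x _; exact: poweR_ge0.
- by apply: filterS fg => x fgx _; rewrite fgx.
Qed.

Section one_le_p.
Variable p : R.
Hypothesis p1 : 1 <= p.

Let p0 : 0 < p. Proof. exact: lt_le_trans p1. Qed.

Lemma cLnormB f g : cmeasurable f -> cmeasurable g ->
  (cLnorm p (f - g)%R <= cLnorm p f + cLnorm p g)%E.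
Proof.
move=> mf mg.
have mnf := measurable_normc mf; have mng := measurable_normc mg.
have mnfg := measurable_normc (cmeasurableB mf mg).
apply: le_trans (eminkowski mu (p := p%:E) mnf mng _); last by rewrite lee_fin.
rewrite /cLnorm unlock; apply: gt0_ler_poweR.
- by rewrite invr_ge0 ltW.
- by rewrite in_itv/= leey andbT integral_ge0// => x _; exact: poweR_ge0.
- by rewrite in_itv/= leey andbT integral_ge0// => x _; exact: poweR_ge0.
have meas (h : T -> R) : measurable_fun setT h ->
    measurable_fun setT (fun x => `|(h x)%:E| `^ p)%E.
  move=> mh; apply: (measurableT_comp (measurable_poweR p)) => //.
  by apply: measurableT_comp => //; exact/measurable_EFinP.
apply: ge0_le_integral => //.
- by move=> x _; exact: poweR_ge0.
- exact: meas.
- exact: (meas (fun x => normc (f x) + normc (g x)) (measurable_funD mnf mng)).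
move=> x _; rewrite /= lee_fin.
apply: ge0_ler_powR; rewrite ?nnegrE//; first exact: ltW.
rewrite !ger0_norm ?addr_ge0 ?normc_ge0//.
by rewrite -(normcN (g x)); exact: le_normcD.
Qed.

Lemma cLnormZ (a : R[i]) f : cmeasurable f ->
  cLnorm p (fun x => a * f x) = ((normc a)%:E * cLnorm p f)%E.
Proof.
move=> mf; rewrite /cLnorm unlock.
have mn := measurable_normc mf.
under eq_integral => x _.
  rewrite normcM abse_EFin normrM poweR_EFin powRM// EFinM.
  rewrite -(poweR_EFin _ p) -abse_EFin; over.
rewrite ge0_integralZl//; first last.
- by rewrite lee_fin powR_ge0.
- apply/measurable_EFinP.
  by apply: (measurableT_comp (measurable_powR _)) => //; exact: measurableT_comp.
rewrite poweRM ?lee_fin ?powR_ge0// ?integral_ge0//.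
by rewrite poweR_EFin -powRrM mulfV ?gt_eqF// powRr1// ger0_norm ?normc_ge0.
Qed.

Lemma cLnorm_eq0 f : cmeasurable f -> cLnorm p f = 0%E ->
  {ae mu, forall x, f x = 0}.
Proof.
move=> mf f0.
have mnf : measurable_fun setT (fun x => (normc (f x))%:E).
  by apply/measurable_EFinP; exact: measurable_normc.
have := Lnorm_eq0_eq0 mnf _ f0; rewrite lte_fin => /(_ p0).
by apply: filterS => x /(_ I) [] /eq0_normc.
Qed.


Lemma cLfunB f g : f \in cLfun p -> g \in cLfun p -> f - g \in cLfun p.
Proof.
move=> /cLfunP[mf lf] /cLfunP[mg lg]; apply/cLfunP.
split; first exact: cmeasurableB.
by apply: le_lt_trans (cLnormB mf mg) _; exact: lte_add_pinfty.
Qed.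

Lemma cLfun0 : 0 \in cLfun p.
Proof.
apply/cLfunP; split; first exact: cmeasurable0.
rewrite /cLnorm (@eq_Lnorm _ _ _ _ _ _ (cst 0%E)); last first.
  by move=> x; rewrite /= expr0n/= addr0 sqrtr0.
by rewrite Lnorm0// eqe gt_eqF.
Qed.

Lemma cLfunZ (a : R[i]) f : f \in cLfun p -> (fun x => a * f x) \in cLfun p.
Proof.
move=> /cLfunP[mf lf]; apply/cLfunP; split; first exact: cmeasurableZ.
by rewrite cLnormZ// lte_mul_pinfty// lee_fin normc_ge0.
Qed.

End one_le_p.
End complex_Lfun.

Section cLfun_type.
Context d (T : measurableType d) (R : realType).
Variables (mu : {measure set T -> \bar R}) (p : R) (p1 : 1 <= p).

(* Carries the proof of 1 <= p, which closure under subtraction needs. *)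
Definition cLfun_pred : {pred T -> R[i]} := let _ := p1 in cLfun mu p.

Lemma cLfun_zmod_closed : zmod_closed cLfun_pred.
Proof. by split; [exact: cLfun0|move=> f g; exact: cLfunB]. Qed.

HB.instance Definition _ := GRing.isZmodClosed.Build _ cLfun_pred
  cLfun_zmod_closed.

Record cLfunType := CLfun {
  cLfun_fun :> T -> R[i];
  cLfun_in : cLfun_fun \in cLfun_pred }.

HB.instance Definition _ := [isSub for cLfun_fun].
HB.instance Definition _ := [Choice of cLfunType by <:].
HB.instance Definition _ := [SubChoice_isSubZmodule of cLfunType by <:].

Lemma cLfunTP (f : cLfunType) : (f : T -> R[i]) \in cLfun mu p.
Proof. exact: cLfun_in. Qed.

Definition cLfun_null : {pred cLfunType} :=
  mem [set f : cLfunType | {ae mu, forall x, f x = 0}].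

Lemma cLfun_nullP (f : cLfunType) :
  reflect {ae mu, forall x, f x = 0} (f \in cLfun_null).
Proof. by apply: (iffP idP) => [/set_mem|/mem_set]. Qed.

Lemma cLfun_null_zmod_closed : zmod_closed cLfun_null.
Proof.
split; first by apply/cLfun_nullP; exact: nearW.
move=> f g /cLfun_nullP f0 /cLfun_nullP g0; apply/cLfun_nullP.
by apply: filterS2 f0 g0 => x fx gx; rewrite /= !fctE fx gx subrr.
Qed.

HB.instance Definition _ := GRing.isZmodClosed.Build _ cLfun_null
  cLfun_null_zmod_closed.

(* Complex L^p(T, mu). *)
Definition cLspace : Type := {ideal_quot cLfun_null}.
HB.instance Definition _ := GRing.Zmodule.on cLspace.
HB.instance Definition _ := EqQuotient.on cLspace.

(* A representative; the properties stated through it below (membership in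
   another cLfun, nonnegativity, equality) are invariant under a.e. equality. *)
Definition cLspace_fun (F : cLspace) : T -> R[i] := repr F.
Coercion cLspace_fun : cLspace >-> Funclass.

Definition cLclass (f : cLfunType) : cLspace :=
  \pi f.

Lemma cLspaceP (F : cLspace) : (F : T -> R[i]) \in cLfun mu p.
Proof. exact: cLfunTP. Qed.

Lemma cLclass_eqP (f g : cLfunType) :
  cLclass f = cLclass g <-> {ae mu, forall x, f x = g x}.
Proof.
have -> : (cLclass f = cLclass g) <-> (f - g \in cLfun_null).
  rewrite Quotient.idealrBE; split => [h|/eqP//]; exact/eqP.
split => [/cLfun_nullP|fg].
  by apply: filterS => x; rewrite /= !fctE => /eqP; rewrite subr_eq0 => /eqP.
apply/cLfun_nullP; apply: filterS fg => x.
by rewrite /= !fctE => ->; rewrite subrr.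
Qed.

Lemma cLclassK (F : cLspace) : cLclass (repr F) = F.
Proof. exact: reprK. Qed.

Lemma cLclass_funE (f : cLfunType) : {ae mu, forall x, cLclass f x = f x}.
Proof. by apply/cLclass_eqP; exact: cLclassK. Qed.

Lemma cLspace_eqP (F G : cLspace) : F = G <-> {ae mu, forall x, F x = G x}.
Proof. by rewrite -{1}(cLclassK F) -{1}(cLclassK G); exact: cLclass_eqP. Qed.

Lemma cLclassD (f g : cLfunType) : cLclass (f + g) = cLclass f + cLclass g.
Proof. exact: Quotient.pi_add. Qed.

Lemma cLspaceDE (F G : cLspace) : {ae mu, forall x, (F + G : cLspace) x = F x + G x}.
Proof.
apply: filterS (cLclass_funE (repr F + repr G)) => x.
by rewrite cLclassD !cLclassK.
Qed.

Definition cLfun_scale (a : R[i]) (f : cLfunType) : cLfunType :=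
  CLfun (cLfunZ p1 a (cLfunTP f)).

Definition cLspace_scale (a : R[i]) (F : cLspace) : cLspace :=
  cLclass (cLfun_scale a (repr F)).

Lemma cLspace_scaleE a (F : cLspace) :
  {ae mu, forall x, cLspace_scale a F x = a * F x}.
Proof. exact: cLclass_funE. Qed.

Lemma cLspace_scaleA a b (F : cLspace) :
  cLspace_scale a (cLspace_scale b F) = cLspace_scale (a * b) F.
Proof.
apply/cLspace_eqP; apply: filterS3 (cLspace_scaleE a (cLspace_scale b F))
  (cLspace_scaleE b F) (cLspace_scaleE (a * b) F) => x -> -> ->.
by rewrite mulrA.
Qed.

Lemma cLspace_scale1 : left_id 1 cLspace_scale.
Proof.
move=> F; apply/cLspace_eqP; apply: filterS (cLspace_scaleE 1 F) => x ->.
by rewrite mul1r.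
Qed.

Lemma cLspace_scaleDr : right_distributive cLspace_scale +%R.
Proof.
move=> a F G; apply/cLspace_eqP.
apply: filterS3 (cLspace_scaleE a (F + G)) (cLspaceDE F G)
  (filterI (cLspaceDE (cLspace_scale a F) (cLspace_scale a G))
    (filterI (cLspace_scaleE a F) (cLspace_scaleE a G))).
by move=> x -> -> [-> [-> ->]]; rewrite mulrDr.
Qed.

Lemma cLspace_scaleDl (F : cLspace) :
  {morph cLspace_scale^~ F : a b / a + b}.
Proof.
move=> a b; apply/cLspace_eqP.
apply: filterS3 (cLspace_scaleE (a + b) F)
  (cLspaceDE (cLspace_scale a F) (cLspace_scale b F))
  (filterI (cLspace_scaleE a F) (cLspace_scaleE b F)).
by move=> x -> -> [-> ->]; rewrite mulrDl.
Qed.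

HB.instance Definition _ := GRing.Zmodule_isLmodule.Build R[i] cLspace
  cLspace_scaleA cLspace_scale1 cLspace_scaleDr cLspace_scaleDl.

Lemma cLspaceZE a (F : cLspace) : {ae mu, forall x, (a *: F : cLspace) x = a * F x}.
Proof. exact: cLspace_scaleE. Qed.

Definition cLspace_norm (F : cLspace) : R[i] := (fine (cLnorm mu p F))%:C.

Lemma cLspace_fineK (F : cLspace) :
  ((fine (cLnorm mu p F))%:E = cLnorm mu p F)%E.
Proof. by case/cLfunP: (cLspaceP F) => _ ?; rewrite fineK// ge0_fin_numE ?cLnorm_ge0. Qed.

Lemma cLspace_meas (F : cLspace) : cmeasurable F.
Proof. by case/cLfunP: (cLspaceP F). Qed.

Lemma cLspace_normD (F G : cLspace) :
  cLspace_norm (F + G) <= cLspace_norm F + cLspace_norm G.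
Proof.
rewrite /cLspace_norm -rmorphD lecR -lee_fin EFinD !cLspace_fineK.
have mF := cLspace_meas F; have mG := cLspace_meas G.
have mNG : cmeasurable (fun x => -1 * G x) by exact: cmeasurableZ.
have -> : cLnorm mu p (F + G : cLspace) = cLnorm mu p ((F : T -> R[i]) - (fun x => -1 * G x)).
  apply: ae_eq_cLnorm; [exact: cLspace_meas|exact: cmeasurableB|].
  by apply: filterS (cLspaceDE F G) => x ->; rewrite !fctE mulN1r opprK.
apply: (le_trans (cLnormB mu p1 mF mNG)).
by rewrite cLnormZ// normcN normc1 mul1e.
Qed.

Lemma cLspace_normZ (a : R[i]) (F : cLspace) :
  cLspace_norm (a *: F) = `|a| * cLspace_norm F.
Proof.
have mF := cLspace_meas F.
rewrite /cLspace_norm (_ : `|a| = (normc a)%:C)// -rmorphM; congr (_%:C).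
apply: EFin_inj; rewrite EFinM !cLspace_fineK -cLnormZ//.
apply: ae_eq_cLnorm; [exact: cLspace_meas|exact: cmeasurableZ|].
exact: cLspaceZE.
Qed.

Lemma cLspace_norm0_eq0 (F : cLspace) : cLspace_norm F = 0 -> F = 0.
Proof.
move=> /complexI F0; apply/cLspace_eqP.
have FN0 : cLnorm mu p F = 0%E by rewrite -cLspace_fineK F0.
have Z0 : {ae mu, forall x, (0 : cLspace) x = 0}.
  apply: filterS (cLclass_funE 0) => x.
  suff -> : cLclass 0 = 0 by [].
  by apply: (addrI (cLclass 0)); rewrite addr0 -cLclassD addr0.
by apply: filterS2 Z0 (cLnorm_eq0 p1 (cLspace_meas F) FN0) => x -> ->.
Qed.

HB.instance Definition _ := @Lmodule_isNormed.Build R[i] cLspace cLspace_norm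
  cLspace_normD cLspace_normZ cLspace_norm0_eq0.

Lemma cLspace_normE (F : cLspace) : `|F| = (fine (cLnorm mu p F))%:C.
Proof. by []. Qed.

(* 0 <= z in R[i] means that z is real and nonnegative. *)
Definition positive_op (S : cLspace -> cLspace) :=
  forall F : cLspace, {ae mu, forall x, 0 <= F x} ->
    {ae mu, forall x, 0 <= S F x}.

End cLfun_type.

Section operators.
Context (R : realType) (V : normedModType R[i]).
Implicit Types (T S : {linear V -> V}) (z : R[i]).

(* Norms of V take values in R[i]; Re reads them back in R. *)
Definition opnorm (S : V -> V) : \bar R :=
  ereal_sup [set (complex.Re `|S x|)%:E | x in [set x : V | `|x| <= 1]].

Definition bounded_op (S : V -> V) := (opnorm S < +oo)%E.

Definition power_bounded (T : V -> V) :=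
  (ereal_sup (range (fun n => opnorm (iter n T))) < +oo)%E.

(* S is the resolvent (z - T)^-1 of T at z. *)
Definition is_resolvent T z S :=
  [/\ bounded_op S, forall x, S (z *: x - T x) = x
    & forall x, z *: S x - T (S x) = x].

Definition resolvent_set T := [set z | exists S, is_resolvent T z S].

(* On a punctured disc around z the resolvent is given by a Laurent series
   \sum_(n >= 0) (w - z)^(n - k) B_n, convergent in operator norm, with k >= 1
   and B_0 != 0, i.e. z is a pole of order k. *)
Definition resolvent_pole T z :=
  exists (k : nat) (B : nat -> {linear V -> V}) (e : R),
    [/\ (0 < k)%N, forall n, bounded_op (B n), exists x, B 0%N x != 0, 0 < e &
      forall w : R[i], 0 < `|w - z| < e%:C -> exists2 S, is_resolvent T w S &
        opnorm (fun x => S x -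
          \sum_(n < N) ((w - z) ^ (n%:Z - k%:Z)) *: B n x) @[N --> \oo] --> 0%E].

Definition is_eigenvalue T z := exists2 x, x != 0 & T x = z *: x.

Definition generalized_eigenspace T z : set V :=
  [set x | exists n, iter n (fun y => z *: y - T y) x = 0].

Definition finite_dimensional (A : set V) :=
  exists n (e : 'I_n -> V), forall x, A x ->
    exists c : 'I_n -> R[i], x = \sum_(i < n) c i *: e i.

Definition finite_multiplicity T z :=
  finite_dimensional (generalized_eigenspace T z).

Definition ess_bounds T : set R := [set r | 0 <= r /\
  forall z, r%:C < `|z| -> resolvent_set T z \/
    [/\ resolvent_pole T z, is_eigenvalue T z & finite_multiplicity T z]].

(* For T bounded on a complete V, ess_bounds T contains the norm of T; whenever
   it is nonempty it
   has a least element, see ess_spectral_radiusP. The extended infimum gives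
   +oo, rather than a junk real, should it be empty. *)
Definition ess_spectral_radius T : \bar R :=
  ereal_inf [set r%:E | r in ess_bounds T].

Lemma ess_spectral_radiusP T : ess_bounds T !=set0 ->
  exists2 r, ess_bounds T r & ess_spectral_radius T = r%:E.
Proof.
move=> [r0 br0].
exists (inf (ess_bounds T)); last by apply: ereal_inf_EFin; [exists 0 => r []|exists r0].
split; first by apply: lb_le_inf; [exists r0|move=> r []].
move=> z zr.
have nz : inf (ess_bounds T) < normc z by rewrite -ltcR.
have [r [r_ge0 rP] rz] := inf_lt (ex_intro _ r0 br0) nz.
by apply: rP; rewrite ltcR.
Qed.

End operators.

(* Main.v *)
From HB Require Import structures.
Require Import Defs.
From mathcomp Require Import all_boot all_order all_algebra complex.
From mathcomp Require Import all_classical all_reals all_analysis.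
From mathcomp Require Import measurable_realfun.
From mathcomp Require Import ring lra.

(** Fix [lam] with [|lam| = 1] and, for [eta > 0], consider the operator
    [P = eta lam ((1 + eta) lam - T)^-1], which power-boundedness bounds
    independently of [eta].

    Suppose that for some [eta] it is within [1/2] of a finite rank operator.
    Then [lam - T] is invertible up to a finite rank operator, and since a
    power-bounded operator has no Jordan block at [lam], a neighbourhood of [lam]
    consists of regular points and, possibly, a simple pole of finite
    multiplicity at [lam] ([peripheral_splitting],
    [splitting_neighbourhood]). If this happens for every unimodular [lam], then
    compactness of the circle gives [r_ess(T) < 1].

    Otherwise, for some [lam], every [D] and every [eta], there are vectors
    [x j] bounded independently of [eta] whose images [y j = P (x j)], for
    [j < D], are uniformly linearly independent ([greedy_family]). So it is
    enough to bound [D] ([ess_spectral_radius_lt1]). As [eta] tends to [0] the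
    [y j] become approximate eigenvectors, and three facts restrict them.

    - The function [g = eta (1 + eta - T)^-1 (sum of the |x j|)] is bounded in norm
      and almost fixed by [T], and it dominates every [|y j|]
      ([superharmonic], [dominated_by_superharmonic]).

    - Since [T] maps [L^p] to [L^q], there is [c > 0] such that the restriction of
      [T F] to a set of measure less than [c] has at most half the norm of [F]
      ([positive_uniformly_integrable]).

    - For a real combination [f] of the [y j] the excess [(|f| - t g)^+] is almost
      dominated by its image under [T] ([excess_subharmonic]). With the previous
      fact, either [|f| > t g] on a set of measure at least [c], or the
      excess is negligible in norm ([small_excess]).

    In the limit the quotients [y j / g] thus behave like bounded functions on a
    finite measure space such that, for every real combination [f] of them, the
    set [|f| > t] has measure at least [c] or [0]. Then [c sup |f|^2 <= |f|_2^2],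
    and Grothendieck's argument shows that a space of bounded functions on which
    the sup norm is controlled by the [L^2] norm is finite-dimensional:
    [D c <= 32 mu(Omega)] ([dimension_bound]). No limit functions are formed; an
    ultrafilter provides the limits of the integrals and the largeness of the
    level sets, and a cut-off of [g] near its zeros is removed afterwards, whence
    an iterated limit. *)

Set Implicit Arguments.
Unset Strict Implicit.
Unset Printing Implicit Defensive.

Import Order.TTheory GRing.Theory Num.Theory numFieldNormedType.Exports.
Import ComplexField.Normc.

Local Open Scope classical_set_scope.
Local Open Scope ring_scope.
Local Open Scope complex_scope.

(** * Linear identities in a module *)

Section lmod_reflection.
Context (K : comRingType) (V : lmodType K).

Inductive lexpr :=
  | LAtom of nat | LZero | LAdd of lexpr & lexpr | LOpp of lexpr
  | LScale of K & lexpr.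

Fixpoint leval (vs : seq V) (e : lexpr) : V :=
  match e with
  | LAtom i => nth 0 vs i
  | LZero => 0
  | LAdd e1 e2 => leval vs e1 + leval vs e2
  | LOpp e1 => - leval vs e1
  | LScale a e1 => a *: leval vs e1
  end.

Fixpoint lcoef (i : nat) (e : lexpr) : K :=
  match e with
  | LAtom j => if i == j then 1 else 0
  | LZero => 0
  | LAdd e1 e2 => lcoef i e1 + lcoef i e2
  | LOpp e1 => - lcoef i e1
  | LScale a e1 => a * lcoef i e1
  end.

Lemma levalE vs e : leval vs e = \sum_(i < size vs) lcoef i e *: nth 0 vs i.
Proof.
elim: e => [j||e1 IH1 e2 IH2|e1 IH1|a e1 IH1] /=.
- have [js|js] := ltnP j (size vs).
    rewrite (bigD1 (Ordinal js))//= eqxx scale1r big1 ?addr0// => i /eqP ij.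
    by rewrite ifF ?scale0r//; apply/eqP => ij'; apply: ij; apply/val_inj.
  rewrite nth_default// big1// => i _; rewrite ifF ?scale0r//.
  by apply/negbTE; rewrite neq_ltn (leq_trans (ltn_ord i) js).
- by rewrite big1// => i _; rewrite scale0r.
- by rewrite IH1 IH2 -big_split; apply: eq_bigr => i _; rewrite scalerDl.
- by rewrite IH1 -sumrN; apply: eq_bigr => i _; rewrite scaleNr.
- by rewrite IH1 scaler_sumr; apply: eq_bigr => i _; rewrite scalerA.
Qed.

Fixpoint lcoefs_eq (n : nat) (e1 e2 : lexpr) : Prop :=
  if n is n'.+1 then lcoef n' e1 = lcoef n' e2 /\ lcoefs_eq n' e1 e2 else True.

(** A linear identity holds as soon as the coefficients of every atom agree;
    those are identities in [K], within reach of [ring]. *)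
Lemma leval_eq vs e1 e2 : lcoefs_eq (size vs) e1 e2 -> leval vs e1 = leval vs e2.
Proof.
move=> h; rewrite !levalE; apply: eq_bigr => i _; congr (_ *: _).
case: i => i /=; elim: (size vs) h => //= n IH [h1 /IH h2].
by rewrite ltnS leq_eqVlt => /orP[/eqP ->|].
Qed.
End lmod_reflection.

Ltac lmod_index x vs :=
  lazymatch vs with
  | cons x _ => constr:(0%N)
  | cons _ ?t => let n := lmod_index x t in constr:(n.+1)
  end.
Ltac lmod_add x vs :=
  let rec mem l :=
    lazymatch l with
    | nil => constr:(false) | cons x _ => constr:(true) | cons _ ?t => mem t end in
  lazymatch mem vs with
  | true => vs
  | false => constr:(cons x vs)
  end.
Ltac lmod_atoms e vs :=
  lazymatch e with
  | (?a + ?b)%R => let vs := lmod_atoms a vs in lmod_atoms b vs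
  | (- ?a)%R => lmod_atoms a vs
  | (_ *: ?a)%R => lmod_atoms a vs
  | (0)%R => vs
  | _ => lmod_add e vs
  end.
Ltac lmod_reify K e vs :=
  lazymatch e with
  | (?a + ?b)%R => let a := lmod_reify K a vs in let b := lmod_reify K b vs in
      constr:(@LAdd K a b)
  | (- ?a)%R => let a := lmod_reify K a vs in constr:(@LOpp K a)
  | (?k *: ?a)%R => let a := lmod_reify K a vs in constr:(@LScale K k a)
  | (0)%R => constr:(@LZero K)
  | _ => let i := lmod_index e vs in constr:(@LAtom K i)
  end.
Ltac lmod K :=
  lazymatch goal with
  | |- @eq ?V ?l ?r =>
    let vs := lmod_atoms l (@nil V) in
    let vs := lmod_atoms r vs in
    let e1 := lmod_reify K l vs in
    let e2 := lmod_reify K r vs in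
    change (leval vs e1 = leval vs e2);
    apply: leval_eq; rewrite /=; repeat (split; first by ring); exact I
  end.

(** * Moduli of complex numbers and geometric sequences *)

Section complex_numbers.
Context (R : realType).

Lemma normcR (r : R) : normc (r%:C) = `|r|.
Proof. by rewrite /= expr0n addr0 sqrtr_sqr. Qed.

Lemma normcR_ge0 (r : R) : 0 <= r -> normc (r%:C) = r.
Proof. by move=> r0; rewrite normcR ger0_norm. Qed.

Lemma ge0cP (z : R[i]) : 0 <= z <-> z = (normc z)%:C.
Proof.
split => [|->]; last by rewrite lecR Defs.normc_ge0.
by move=> z0; rewrite -[LHS](ger0_norm z0).
Qed.

Lemma normc_ReIm (z : R[i]) : z = (complex.Re z)%:C + 'i * (complex.Im z)%:C.
Proof. by case: z => a b; simpc. Qed.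

Lemma ReB (z w : R[i]) : complex.Re (z - w) = complex.Re z - complex.Re w.
Proof. by case: z w => a b [c c']. Qed.

Lemma ImB (z w : R[i]) : complex.Im (z - w) = complex.Im z - complex.Im w.
Proof. by case: z w => a b [c c']. Qed.

Lemma ReD (z w : R[i]) : complex.Re (z + w) = complex.Re z + complex.Re w.
Proof. by case: z w => a b [c c']. Qed.

Lemma ImD (z w : R[i]) : complex.Im (z + w) = complex.Im z + complex.Im w.
Proof. by case: z w => a b [c c']. Qed.

Lemma Re_sum n (f : 'I_n -> R[i]) : complex.Re (\sum_i f i) = \sum_i complex.Re (f i).
Proof. by elim/big_ind2 : _ => [//|z a w b <- <-|//]; rewrite ReD. Qed.

Lemma Im_sum n (f : 'I_n -> R[i]) : complex.Im (\sum_i f i) = \sum_i complex.Im (f i).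
Proof. by elim/big_ind2 : _ => [//|z a w b <- <-|//]; rewrite ImD. Qed.

Lemma Re_le_normc (z : R[i]) : `|complex.Re z| <= normc z.
Proof. by have := normc_ge_Re z; rewrite lecR. Qed.

Lemma Im_le_normc (z : R[i]) : `|complex.Im z| <= normc z.
Proof.
case: z => a b /=; rewrite -(sqrtr_sqr b) ler_sqrt ?lerDr ?sqr_ge0//.
by rewrite addr_ge0 ?sqr_ge0.
Qed.

Lemma normc_sum n (f : 'I_n -> R[i]) : normc (\sum_i f i) <= \sum_i normc (f i).
Proof.
elim/big_ind2 : _ => [|z a w b za wb|//]; first by rewrite normc0.
exact: le_trans (le_normcD _ _) (lerD za wb).
Qed.
End complex_numbers.

Section geometric.
Context (R : realType).
Implicit Types (x C th e : R).

Lemma geometric_small th C e : 0 <= th < 1 -> 0 < e -> exists n, C * th ^+ n <= e.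
Proof.
move=> /andP[th0 th1] e0.
have : (fun n => C * th ^+ n) @ \oo --> (C * 0 : R).
  by apply: cvgMr; apply: cvg_expr; rewrite ger0_norm.
rewrite mulr0 => /cvgrPdist_le/(_ _ e0)[n _ /(_ n (leqnn n))] /= h.
by exists n; apply: le_trans h; rewrite sub0r normrN ler_norm.
Qed.

Lemma geometric_le0 th C x : 0 <= th < 1 -> (forall n, x <= C * th ^+ n) -> x <= 0.
Proof.
move=> th01 h; apply/ler_addgt0Pl => e e0; rewrite addr0.
by have [n hn] := geometric_small C th01 e0; exact: le_trans (h n) hn.
Qed.

Lemma geometric_sum_le th n : 0 <= th < 1 -> \sum_(i < n) th ^+ i <= (1 - th)^-1.
Proof.
move=> /andP[th0 th1].
have d0 : 0 < 1 - th by rewrite subr_gt0.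
rewrite -(ler_pM2l d0) mulfV ?gt_eqF//.
have := subrX1 th n; rewrite -opprB => /(congr1 (fun x => - x)).
rewrite opprK -mulNr opprB => <-.
by rewrite gerBl exprn_ge0.
Qed.
End geometric.

(** * Bounded operators and Neumann series *)

Section real_norm.
Context (R : realType) (V : normedModType R[i]).
Implicit Types (x y : V) (a : R[i]).

(** The norm of [V] takes values in [R[i]]; this is its real version. *)
Definition rnorm x : R := complex.Re `|x|.
Local Notation N := rnorm.

Lemma rnormE x : `|x| = (N x)%:C.
Proof.
have := normr_ge0 x; rewrite /rnorm; case: `|x| => a b.
by rewrite lecE /= => /andP[/eqP -> _].
Qed.

Lemma rnorm_ge0 x : 0 <= N x.
Proof. by have := normr_ge0 x; rewrite rnormE lecR. Qed.

Lemma rnormD x y : N (x + y) <= N x + N y.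
Proof. by have := ler_normD x y; rewrite !rnormE -rmorphD lecR. Qed.

Lemma rnormZ a x : N (a *: x) = normc a * N x.
Proof.
apply: (@complexI R); rewrite [RHS](rmorphM _ (normc a) (N x)) /= -!rnormE normrZ.
by congr (_ * _).
Qed.

Lemma rnormN x : N (- x) = N x.
Proof. by apply: (@complexI R); rewrite -!rnormE normrN. Qed.

Lemma rnorm0 : N 0 = 0.
Proof. by apply: (@complexI R); rewrite -!rnormE normr0. Qed.

Lemma rnormB x y : N (x - y) <= N x + N y.
Proof. by apply: le_trans (rnormD _ _) _; rewrite rnormN. Qed.

Lemma rnorm0_eq0 x : N x = 0 -> x = 0.
Proof. by move=> x0; apply: normr0_eq0; rewrite rnormE x0. Qed.

Lemma rnorm_le0 x : N x <= 0 -> x = 0.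
Proof. by move=> x0; apply: rnorm0_eq0; apply/eqP; rewrite eq_le x0 rnorm_ge0. Qed.

Lemma rnorm_sum n (u : 'I_n -> V) : N (\sum_i u i) <= \sum_i N (u i).
Proof.
elim/big_ind2 : _ => [|x a y b xa yb|//]; first by rewrite rnorm0.
exact: le_trans (rnormD _ _) (lerD xa yb).
Qed.

End real_norm.

Section bounded_operators.
Context (R : realType) (V : normedModType R[i]).
Implicit Types (x y : V) (a : R[i]) (f g S : V -> V).
Local Notation N := (@rnorm R V).

(** A bounded linear operator, as a predicate on plain functions: operators
    obtained by choice then need no bundling. *)
Definition blin f := (forall a x y, f (a *: x + y) = a *: f x + f y) /\
  exists2 C, 0 <= C & forall x, N (f x) <= C * N x.

Lemma blinD f x y : blin f -> f (x + y) = f x + f y.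
Proof. by move=> [fl _]; rewrite -[x]scale1r fl !scale1r. Qed.

Lemma blin0 f : blin f -> f 0 = 0.
Proof. by move=> fb; apply: (addrI (f 0)); rewrite -blinD// !addr0. Qed.

Lemma blinZ f a x : blin f -> f (a *: x) = a *: f x.
Proof. by move=> fb; rewrite -[a *: x]addr0 fb.1 (blin0 fb) addr0. Qed.

Lemma blinN f x : blin f -> f (- x) = - f x.
Proof. by move=> fb; rewrite -scaleN1r blinZ// scaleN1r. Qed.

Lemma blinB f x y : blin f -> f (x - y) = f x - f y.
Proof. by move=> fb; rewrite blinD// blinN. Qed.

Lemma blin_sum f n (u : 'I_n -> V) : blin f -> f (\sum_i u i) = \sum_i f (u i).
Proof.
move=> fb; elim/big_ind2 : _ => [|x a y b xa yb|//]; first exact: blin0.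
by rewrite blinD// xa yb.
Qed.

Lemma blin_id : blin idfun.
Proof. by split => //; exists 1 => // x; rewrite mul1r. Qed.

Lemma blin_comp f g : blin f -> blin g -> blin (f \o g).
Proof.
move=> [fl [C C0 fC]] [gl [D D0 gD]]; split=> [a x y|]; first by rewrite /= gl fl.
exists (C * D); first exact: mulr_ge0.
by move=> x; rewrite -mulrA; apply: le_trans (fC _) _; apply: ler_wpM2l.
Qed.

Lemma blin_add f g : blin f -> blin g -> blin (fun x => f x + g x).
Proof.
move=> [fl [C C0 fC]] [gl [D D0 gD]]; split=> [a x y|].
  by rewrite fl gl scalerDr addrACA.
exists (C + D); first exact: addr_ge0.
by move=> x; rewrite mulrDl; apply: le_trans (rnormD _ _) (lerD _ _).
Qed.

Lemma blin_scale a f : blin f -> blin (fun x => a *: f x).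
Proof.
move=> [fl [C C0 fC]]; split=> [b x y|].
  by rewrite fl scalerDr !scalerA mulrC.
exists (normc a * C); first by rewrite mulr_ge0// Defs.normc_ge0.
by move=> x; rewrite rnormZ -mulrA ler_wpM2l// Defs.normc_ge0.
Qed.

Lemma blin_sub f g : blin f -> blin g -> blin (fun x => f x - g x).
Proof.
move=> fb gb; rewrite (_ : (fun x => _) = (fun x => f x + (-1) *: g x)).
  by apply: blin_add => //; exact: blin_scale.
by apply/funext => x; rewrite scaleN1r.
Qed.

Lemma blin_iter n f : blin f -> blin (iter n f).
Proof.
move=> fb; elim: n => [|n IH]; first exact: blin_id.
exact: (blin_comp fb IH).
Qed.

Lemma opnorm_le f C : 0 <= C -> (forall x, N (f x) <= C * N x) ->
  (opnorm f <= C%:E)%E.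
Proof.
move=> C0 fC; apply: ge_ereal_sup => _ [x /= x1 <-].
rewrite lee_fin; apply: le_trans (fC x) _.
rewrite -[leRHS]mulr1 ler_wpM2l//.
by move: x1; rewrite rnormE -[1 : R[i]]/(1%:C) lecR.
Qed.

Lemma blin_bounded f : blin f -> bounded_op f.
Proof.
move=> [_ [C C0 fC]]; rewrite /bounded_op.
by apply: le_lt_trans (opnorm_le C0 fC) _; rewrite ltry.
Qed.

Lemma opnorm_bound (f : V -> V) M : (forall a x, f (a *: x) = a *: f x) ->
  (opnorm f <= M%:E)%E -> forall x, N (f x) <= M * N x.
Proof.
move=> fZ fM x.
have [/eqP x0|x0] := boolP (N x == 0).
  have -> : x = 0 by exact: rnorm0_eq0.
  have -> : f 0 = 0 by have := fZ 0 0; rewrite !scale0r.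
  by rewrite rnorm0 mulr0.
have xp : 0 < N x by rewrite lt_def x0 rnorm_ge0.
have nV : normc ((N x)^-1)%:C = (N x)^-1.
  by rewrite normcR_ge0// invr_ge0 ltW.
have : ((N (f (((N x)^-1)%:C *: x)))%:E <= M%:E)%E.
  apply: le_trans fM; apply: ereal_sup_ubound; exists (((N x)^-1)%:C *: x) => //=.
  by rewrite rnormE rnormZ nV mulVf.
by rewrite lee_fin fZ rnormZ nV mulrC ler_pdivrMr.
Qed.

Definition to_linear f (fb : blin f) : {linear V -> V} :=
  HB.pack f (GRing.isLinear.Build R[i] V V *:%R f fb.1).

(** Completeness, in the form that the Neumann series uses and in which it is
    proved for [L^p]. *)
Definition abs_complete := forall u : nat -> V,
  (exists M, forall n, \sum_(i < n) N (u i) <= M) ->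
  exists l, forall e : R, 0 < e -> exists n0, forall n, (n0 <= n)%N ->
    N (l - \sum_(i < n) u i) <= e.

Lemma geometric_fixed0 S M th : 0 <= th < 1 ->
  (forall k x, N (iter k S x) <= M * th ^+ k * N x) ->
  forall x, S x = x -> x = 0.
Proof.
move=> th01 SM x Sx.
have it k : iter k S x = x by elim: k => //= k ->.
apply: rnorm_le0; apply: (geometric_le0 (th := th) (C := M * N x)) => // n.
by rewrite mulrAC -{1}(it n).
Qed.

Lemma neumann_expansion S J x n : blin S -> (forall y, J y - S (J y) = y) ->
  J x = \sum_(i < n) iter i S x + iter n S (J x).
Proof.
move=> Sb SJ; elim: n => [|n IH]; first by rewrite big_ord0 add0r.
rewrite big_ord_recr /= -addrA {1}IH; congr (_ + _).
rewrite -[S _]/(iter n.+1 S _) !iterSr -(blinD _ _ (blin_iter n Sb)).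
by congr (iter n S _); apply/eqP; rewrite -subr_eq SJ.
Qed.

(** The Neumann series of [S]; the constant [M] allows for operators whose
    powers decay geometrically although their norm may exceed [1]. *)
Lemma neumann S M th : abs_complete -> blin S -> 0 <= M -> 0 <= th < 1 ->
  (forall k x, N (iter k S x) <= M * th ^+ k * N x) ->
  exists2 J : V -> V, blin J & [/\ forall x, J x - S (J x) = x,
    forall x, J (x - S x) = x & forall x, N (J x) <= M / (1 - th) * N x].
Proof.
move=> Vc Sb M0 th01 SM; have /andP[th0 th1] := th01.
have fix0 := geometric_fixed0 th01 SM.
have ex x : exists l, l - S l = x.
  have [] := Vc (fun i => iter i S x).
    exists (M * N x / (1 - th)) => n.
    apply: (@le_trans _ _ (\sum_(i < n) M * N x * th ^+ i)).
      by apply: ler_sum => i _; rewrite mulrAC.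
    rewrite -mulr_sumr ler_wpM2l ?mulr_ge0 ?rnorm_ge0//.
    exact: geometric_sum_le.
  move=> l hl; exists l; apply/eqP; rewrite -subr_eq0; apply/eqP.
  apply: rnorm_le0; apply/ler_addgt0Pl => e e0; rewrite addr0.
  have [C C0 SC] := Sb.2.
  have e10 : 0 < e / (2 * (1 + C)) by rewrite divr_gt0// mulr_gt0// ltr_wpDr.
  have [n0 hn0] := hl _ e10.
  have [n1 hn1] := geometric_small (M * N x) th01 (divr_gt0 e0 (ltr0Sn _ 1)).
  pose n := maxn n0 n1.
  have {}hn0 := hn0 n (leq_maxl _ _).
  have {}hn1 : M * N x * th ^+ n <= e / 2.
    apply: le_trans hn1; apply: ler_wpM2l; first by rewrite mulr_ge0 ?rnorm_ge0.
    by apply: ler_wiXn2l => //; [exact: ltW|exact: leq_maxr].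
  set s := \sum_(i < n) iter i S x in hn0.
  have sS : s - S s = x - iter n S x.
    rewrite /s blin_sum// -sumrB.
    elim: (n) => [|k IH]; first by rewrite big_ord0 /= subrr.
    by rewrite big_ord_recr /= IH addrA subrK.
  have -> : l - S l - x = (l - s) - S (l - s) - iter n S x.
    rewrite (blinB _ _ Sb) {1}(_ : x = s - S s + iter n S x); last first.
      by rewrite sS subrK.
    lmod R[i].
  apply: le_trans (rnormB _ _) _; rewrite [leRHS](splitr e); apply: lerD.
    apply: le_trans (rnormB _ _) _.
    apply: (@le_trans _ _ ((1 + C) * N (l - s))).
      by rewrite mulrDl mul1r lerD2l.
    apply: (@le_trans _ _ ((1 + C) * (e / (2 * (1 + C))))).
      by rewrite ler_wpM2l// addr_ge0.
    have C1 : 1 + C != 0 by rewrite gt_eqF// ltr_wpDr.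
    by rewrite (_ : (1 + C) * _ = e / 2)//; field.
  by apply: le_trans (SM _ _) _; rewrite mulrAC.
have [J HJ] := choice ex.
have inj x y : x - S x = y - S y -> x = y.
  move=> xy; apply/eqP; rewrite -subr_eq0; apply/eqP; apply: fix0.
  rewrite (blinB _ _ Sb); apply/eqP; rewrite -subr_eq0; apply/eqP.
  transitivity (- ((x - S x) - (y - S y))); first by lmod R[i].
  by rewrite xy subrr oppr0.
have Jbd x : N (J x) <= M / (1 - th) * N x.
  rewrite -subr_le0; apply: (geometric_le0 (th := th) (C := M * N (J x))) => // n.
  rewrite lerBlDl mulrAC {1}(neumann_expansion x n Sb HJ).
  apply: le_trans (rnormD _ _) _; apply: lerD; last by rewrite [leRHS]mulrAC; exact: SM.
  apply: le_trans (rnorm_sum _) _.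
  apply: (@le_trans _ _ (\sum_(i < n) M * N x * th ^+ i)).
    by apply: ler_sum => i _; rewrite mulrAC.
  by rewrite -mulr_sumr ler_wpM2l ?mulr_ge0 ?rnorm_ge0// geometric_sum_le.
exists J; split=> //.
- move=> a x y; apply: inj; rewrite HJ Sb.1.
  by rewrite opprD addrACA -scalerBr !HJ.
- exists (M / (1 - th)) => //.
  by rewrite divr_ge0// subr_ge0 ltW.
- by move=> x; apply: inj; rewrite HJ.
Qed.

(** Outside the unit disc the resolvent of a power-bounded operator is the
    Neumann series of [T / w]. The last clause keeps the series, because its
    terms are what shows the resolvent of a positive operator to be positive
    at [w > 1]. *)
Lemma outer_resolvent (T : V -> V) M (w : R[i]) :
  abs_complete -> blin T -> 0 <= M -> (forall k x, N (iter k T x) <= M * N x) ->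
  1 < normc w ->
  exists2 J : V -> V, blin J &
   [/\ forall x, J (w *: x - T x) = x, forall x, w *: J x - T (J x) = x,
       forall x, N (J x) <= M / (normc w - 1) * N x &
       forall x e, 0 < e ->
         exists n, N (J x - \sum_(i < n) (w^-1 ^+ i.+1) *: iter i T x) <= e].
Proof.
move=> Vc Tb M0 TM w1; have w0 : w != 0.
  by apply/eqP => we; move: w1; rewrite we normc0 ltNge ler01.
have nw0 : 0 < normc w by exact: lt_trans w1.
pose S x := w^-1 *: T x.
have Sb : blin S by exact: blin_scale.
have iterSE k x : iter k S x = w^-1 ^+ k *: iter k T x.
  elim: k => [|k IH]; first by rewrite expr0 scale1r.
  by rewrite iterS IH /S (blinZ _ _ Tb) scalerA -exprS.
have nX k : normc (w^-1 ^+ k) = (normc w)^-1 ^+ k.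
  by elim: k => [|k IH]; rewrite ?expr0 ?normc1// !exprS normcM IH normcV.
have iterSle k x : N (iter k S x) <= M * (normc w)^-1 ^+ k * N x.
  rewrite iterSE rnormZ nX [M * _]mulrC -mulrA ler_wpM2l ?exprn_ge0 ?invr_ge0//.
  exact: ltW.
have th01 : 0 <= (normc w)^-1 < 1.
  by rewrite invr_ge0 ltW//= invf_lt1.
have [Q Qb [QS SQ Qle]] := neumann Vc Sb M0 th01 iterSle.
exists (fun x => Q (w^-1 *: x)); first exact: (blin_comp Qb (blin_scale _ blin_id)).
split=> [x|x|x|x e e0].
- by rewrite -[RHS]SQ; congr (Q _); rewrite scalerBr scalerA mulVf// scale1r.
- transitivity (w *: (Q (w^-1 *: x) - S (Q (w^-1 *: x)))).
    by rewrite scalerBr /S scalerA mulfV// scale1r.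
  by rewrite QS scalerA mulfV// scale1r.
- apply: le_trans (Qle _) _; rewrite rnormZ normcV mulrA ler_wpM2r ?rnorm_ge0//.
  have n0 : normc w != 0 by rewrite gt_eqF.
  have n1 : normc w - 1 != 0 by rewrite subr_eq0 gt_eqF.
  by rewrite le_eqVlt; apply/orP; left; apply/eqP; field; rewrite n0 n1.
- have [n hn] := geometric_small (M * N (Q (w^-1 *: x))) th01 e0.
  exists n; apply: le_trans hn.
  rewrite {1}(neumann_expansion _ n Sb QS) addrAC.
  rewrite [X in X - _ + _](_ : _ = \sum_(i < n) w^-1 ^+ i.+1 *: iter i T x).
    by rewrite subrr add0r mulrAC; exact: iterSle.
  apply: eq_bigr => i _; rewrite iterSE (blinZ _ _ (blin_iter i Tb)) scalerA.
  by rewrite -exprSr.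
Qed.

End bounded_operators.

(** * Finite rank operators *)

Section finite_rank.
Context (R : realType) (V : normedModType R[i]).
Implicit Types (x y : V) (a : R[i]) (f g : V -> R[i]) (F G : V -> V).
Local Notation N := (@rnorm R V).

Definition bfunctional f := (forall a x y, f (a *: x + y) = a * f x + f y) /\
  exists2 C, 0 <= C & forall x, normc (f x) <= C * N x.

Lemma bfunctionalD f x y : bfunctional f -> f (x + y) = f x + f y.
Proof. by move=> [fl _]; rewrite -[x]scale1r fl !mul1r scale1r. Qed.

Lemma bfunctional0 f : bfunctional f -> f 0 = 0.
Proof. by move=> fb; apply: (addrI (f 0)); rewrite -bfunctionalD// !addr0. Qed.

Lemma bfunctionalZ f a x : bfunctional f -> f (a *: x) = a * f x.
Proof. by move=> fb; rewrite -[a *: x]addr0 fb.1 (bfunctional0 fb) addr0. Qed.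

Lemma bfunctionalB f x y : bfunctional f -> f (x - y) = f x - f y.
Proof.
by move=> fb; rewrite bfunctionalD// -scaleN1r bfunctionalZ// mulN1r.
Qed.

Lemma bfunctional_sum f n (u : 'I_n -> V) : bfunctional f ->
  f (\sum_i u i) = \sum_i f (u i).
Proof.
move=> fb; elim/big_ind2 : _ => [|x a y b xa yb|//]; first exact: bfunctional0.
by rewrite bfunctionalD// xa yb.
Qed.

Lemma bfunctional_comp f F : bfunctional f -> blin F -> bfunctional (f \o F).
Proof.
move=> [fl [C C0 fC]] [Fl [D D0 FD]]; split=> [a x y|]; first by rewrite /= Fl fl.
exists (C * D); first exact: mulr_ge0.
by move=> x; rewrite -mulrA; apply: le_trans (fC _) _; apply: ler_wpM2l.
Qed.

Lemma bfunctional_lincomb n (f : 'I_n -> V -> R[i]) (c : 'I_n -> R[i]) :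
  (forall i, bfunctional (f i)) -> bfunctional (fun x => \sum_i f i x * c i).
Proof.
move=> fb; split=> [a x y|].
  rewrite mulr_sumr -big_split; apply: eq_bigr => i _ /=.
  by rewrite (fb i).1 mulrDl mulrA.
have /choice[C HC] i : exists C, 0 <= C /\ forall x, normc (f i x) <= C * N x.
  by have [_ [C C0 fC]] := fb i; exists C.
exists (\sum_i C i * normc (c i)).
  by apply: sumr_ge0 => i _; rewrite mulr_ge0 ?Defs.normc_ge0//; exact: (HC i).1.
move=> x; rewrite mulr_suml.
apply: le_trans (normc_sum _) _; apply: ler_sum => i _.
by rewrite normcM mulrAC ler_wpM2r ?Defs.normc_ge0//; exact: (HC i).2.
Qed.

Definition finite_rank F := exists n (f : 'I_n -> V -> R[i]) (y : 'I_n -> V),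
  (forall i, bfunctional (f i)) /\ forall x, F x = \sum_i f i x *: y i.

Lemma finite_rank_blin F : finite_rank F -> blin F.
Proof.
move=> [n [f [y [fb FE]]]]; split=> [a x z|].
  rewrite !FE scaler_sumr -big_split; apply: eq_bigr => i _ /=.
  by rewrite (fb i).1 scalerDl scalerA.
have /choice[C HC] i : exists C, 0 <= C /\ forall x, normc (f i x) <= C * N x.
  by have [_ [C C0 fC]] := fb i; exists C.
exists (\sum_i C i * N (y i)).
  by apply: sumr_ge0 => i _; rewrite mulr_ge0 ?rnorm_ge0//; exact: (HC i).1.
move=> x; rewrite FE; apply: le_trans (rnorm_sum _) _.
rewrite mulr_suml; apply: ler_sum => i _.
by rewrite rnormZ mulrAC ler_wpM2r ?rnorm_ge0//; exact: (HC i).2.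
Qed.

Lemma finite_rank_add F G : finite_rank F -> finite_rank G ->
  finite_rank (fun x => F x + G x).
Proof.
move=> [n [f [y [fb FE]]]] [m [g [z [gb GE]]]].
exists (n + m)%N, (fun i : 'I_(n + m) => match fintype.split i with inl j => f j | inr j => g j end),
  (fun i : 'I_(n + m) => match fintype.split i with inl j => y j | inr j => z j end); split.
  by move=> i; case: fintype.split.
move=> x; rewrite big_split_ord /= FE GE; congr (_ + _); apply: eq_bigr => i _.
  by rewrite (unsplitK (inl i)).
by rewrite (unsplitK (inr i)).
Qed.

Lemma finite_rank_compl F G : blin G -> finite_rank F -> finite_rank (G \o F).
Proof.
move=> Gb [n [f [y [fb FE]]]]; exists n, f, (G \o y); split => // x.
by rewrite /= FE blin_sum//; apply: eq_bigr => i _; rewrite blinZ.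
Qed.

Lemma finite_rank_compr F G : blin G -> finite_rank F -> finite_rank (F \o G).
Proof.
move=> Gb [n [f [y [fb FE]]]]; exists n, (fun i => f i \o G), y; split => [i|x].
  exact: bfunctional_comp.
by rewrite /= FE.
Qed.

Lemma finite_rank_sub F G : finite_rank F -> finite_rank G ->
  finite_rank (fun x => F x - G x).
Proof.
move=> Ff Gf; apply: finite_rank_add => //.
rewrite (_ : (fun x => _) = (fun x => (-1) *: x) \o G); last first.
  by apply/funext => x /=; rewrite scaleN1r.
by apply: finite_rank_compl => //; exact/blin_scale/blin_id.
Qed.

(** The equation [x - F x = v] determines [x] through the finitely many
    scalars [f i x], which solve a square linear system. *)
Lemma finite_rank_fredholm F : finite_rank F -> (forall x, F x = x -> x = 0) ->
  exists2 G : V -> V, blin G &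
    (forall x, G (x - F x) = x) /\ (forall x, G x - F (G x) = x).
Proof.
move=> Ff Finj; have Fb := finite_rank_blin Ff.
have [n [f [y [fb FE]]]] := Ff.
pose Phi : 'M[R[i]]_n := \matrix_(j, i) f i (y j).
pose r x : 'rV[R[i]]_n := \row_i f i x.
have fsum (c : 'rV[R[i]]_n) i : f i (\sum_j c 0 j *: y j) = (c *m Phi) 0 i.
  rewrite bfunctional_sum// mxE; apply: eq_bigr => j _.
  by rewrite bfunctionalZ// mxE.
have Punit : 1%:M - Phi \in unitmx.
  rewrite -row_free_unit; apply: inj_row_free => c.
  rewrite mulmxBr mulmx1 => /eqP; rewrite subr_eq0 => /eqP cP.
  have : \sum_j c 0 j *: y j = 0.
    by apply: Finj; rewrite FE; apply: eq_bigr => i _; rewrite fsum -cP.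
  by move=> c0; apply/rowP => i; rewrite cP -fsum c0 bfunctional0// mxE.
pose B := invmx (1%:M - Phi).
pose G v := v + \sum_j (r v *m B) 0 j *: y j.
have Gb : blin G.
  apply: (blin_add (@blin_id _ V)); apply: finite_rank_blin.
  exists n, (fun j v => (r v *m B) 0 j), y; split=> // j.
  rewrite (_ : (fun v => _) = (fun v => \sum_i f i v * B i j)).
    exact: bfunctional_lincomb.
  by apply/funext => v; rewrite mxE; apply: eq_bigr => i _; rewrite mxE.
have FG v : G v - F (G v) = v.
  rewrite /G; set c := r v *m B.
  have cE : c = r v + c *m Phi.
    apply/eqP; rewrite -subr_eq -[X in X - _](mulmx1 c) -mulmxBr.
    by rewrite /c -mulmxA mulVmx// mulmx1.
  rewrite (blinD _ _ Fb) !FE.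
  rewrite -big_split /= [X in _ - X](_ : _ = \sum_j c 0 j *: y j) ?addrK//.
  apply: eq_bigr => i _; rewrite -scalerDl fsum; congr (_ *: _).
  by rewrite [in RHS]cE [RHS]mxE; congr (_ + _); rewrite mxE.
exists G => //; split=> // x; apply/eqP; rewrite -subr_eq0; apply/eqP/Finj.
rewrite (blinB _ _ Fb); apply/eqP; rewrite -subr_eq0; apply/eqP.
transitivity (- ((G (x - F x) - F (G (x - F x))) - (x - F x))).
  by lmod R[i].
by rewrite FG subrr oppr0.
Qed.

(** Coordinates on the kernel are supplied by the functionals [f i], so a
    family of kernel vectors whose coordinate matrix has maximal rank spans. *)
Lemma kernel_projection n (f : 'I_n -> V -> R[i]) (y : 'I_n -> V) (A : V -> V) :
  blin A -> (forall i, bfunctional (f i)) ->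
  (forall x, A x = 0 -> x = \sum_i f i x *: y i) ->
  exists2 L, finite_rank L & (forall x, A (L x) = 0) /\ (forall x, A x = 0 -> L x = x).
Proof.
move=> Ab fb kerE.
pose r x : 'rV[R[i]]_n := \row_i f i x.
pose rankP k := `[< exists m (X : 'I_m -> V), (forall i, A (X i) = 0) /\
  \rank (\matrix_(i < m) r (X i)) = k >].
have ex0 : exists k, rankP k.
  exists 0%N; apply/asboolP; exists 0%N, (fun=> 0); split; first by case.
  by apply/eqP; rewrite -leqn0 rank_leq_row.
have bnd k : rankP k -> (k <= n)%N.
  by move=> /asboolP[m [X [_ <-]]]; exact: rank_leq_col.
have [k /asboolP[m [X [AX rX]]] kmax] := ex_maxnP ex0 bnd.
set B := (\matrix_(i < m) r (X i)) in rX.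
have rB x : A x = 0 -> (r x <= B)%MS.
  move=> Ax; pose X' (i : 'I_(m + 1)) := match fintype.split i with inl j => X j | inr _ => x end.
  have X'E : \matrix_(i < m + 1) r (X' i) = col_mx B (r x).
    apply/matrixP => i j; rewrite !mxE /X'; case: fintype.split => k'; rewrite !mxE//.
  have : (\rank (col_mx B (r x)) <= k)%N.
    apply: kmax; apply/asboolP; exists (m + 1)%N, X'; rewrite X'E; split => // i.
    by rewrite /X'; case: fintype.split.
  have sB : (B <= col_mx B (r x))%MS by have := submx_refl (col_mx B (r x)); rewrite col_mx_sub => /andP[].
  have := mxrank_leqif_sup sB => /leqifP; case: ifP => [+ _ _|_ lt le].
    by rewrite col_mx_sub => /andP[].
  by move: (leq_trans lt le); rewrite rX ltnn.
pose L x := \sum_i (r x *m pinvmx B) 0 i *: X i.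
have AL x : A (L x) = 0.
  by rewrite /L blin_sum// big1// => i _; rewrite blinZ// AX scaler0.
exists L.
  exists m, (fun i x => (r x *m pinvmx B) 0 i), X; split=> // i.
  rewrite (_ : (fun x => _) = (fun v => \sum_j f j v * pinvmx B j i)).
    exact: bfunctional_lincomb.
  by apply/funext => v; rewrite mxE; apply: eq_bigr => j _; rewrite mxE.
split=> // x Ax; apply/eqP; rewrite -subr_eq0; apply/eqP.
rewrite (kerE (L x - x)); last by rewrite blinB// AL Ax subr0.
rewrite big1// => j _; rewrite bfunctionalB//.
suff -> : f j (L x) = f j x by rewrite subrr scale0r.
have := mulmxKpV (rB _ Ax) => /rowP/(_ j); rewrite [RHS]mxE => <-.
rewrite /L bfunctional_sum// [RHS]mxE; apply: eq_bigr => i _.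
by rewrite bfunctionalZ//; congr (_ * _); rewrite !mxE.
Qed.

End finite_rank.

(** * Isolated points of the peripheral spectrum *)

Section peripheral.
Context (R : realType) (V : normedModType R[i]).
Implicit Types (x y : V).
Local Notation N := (@rnorm R V).

(** [P] is the spectral projection of [T] at [lam] and [S] the reduced
    resolvent; together they say that [lam] is a semisimple isolated point of
    the spectrum (or a regular point, when [P = 0]). *)
Definition spectral_splitting (T : V -> V) (lam : R[i]) (P S : V -> V) :=
  [/\ blin P, blin S,
      forall x, T (P x) = lam *: P x /\ P (T x) = lam *: P x,
      forall x, lam *: S x - T (S x) = x - P x /\ S (lam *: x - T x) = x - P x &
      forall x, [/\ P (P x) = P x, P (S x) = 0 & S (P x) = 0]].

(** A Jordan chain [T x = lam x - v], [T v = lam v] makes the powers of [T]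
    grow linearly. *)
Lemma power_bounded_ascent (T : V -> V) M (lam : R[i]) x :
  blin T -> (forall k x, N (iter k T x) <= M * N x) -> normc lam = 1 ->
  T (lam *: x - T x) = lam *: (lam *: x - T x) -> lam *: x - T x = 0.
Proof.
move=> Tb TM lam1; set v := lam *: x - T x => Tv.
have Tx : T x = lam *: x - v by rewrite /v opprB addrC subrK.
have it n : iter n.+1 T x = lam ^+ n.+1 *: x - (n.+1%:R * lam ^+ n) *: v.
  elim: n => [|n IH]; first by rewrite /= Tx expr1 expr0 mulr1 scale1r.
  rewrite iterS IH (blinB _ _ Tb) !(blinZ _ _ Tb) Tx Tv.
  rewrite (exprS lam n.+1) -[in RHS]natr1.
  by rewrite (exprS lam n); lmod R[i].
have lamX n : normc (lam ^+ n) = 1.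
  by elim: n => [|n IH]; rewrite ?expr0 ?normc1// exprS normcM lam1 IH mulr1.
have bnd n : n.+1%:R * N v <= (1 + M) * N x.
  have -> : n.+1%:R * N v = N ((n.+1%:R * lam ^+ n) *: v).
    rewrite rnormZ normcM lamX mulr1; congr (_ * _).
    rewrite -[n.+1%:R : R[i]](rmorph_nat (real_complex R)) /= expr0n addr0 sqrtr_sqr.
    by rewrite ger0_norm.
  rewrite (_ : _ *: v = lam ^+ n.+1 *: x - iter n.+1 T x); last first.
    by rewrite it; lmod R[i].
  apply: le_trans (rnormB _ _) _; rewrite rnormZ lamX mulrDl.
  by apply: lerD => //; exact: TM.
apply: rnorm_le0; rewrite leNgt; apply/negP => v0.
have := unstable.ltr_bound ((1 + M) * N x / N v); set n := Num.Def.archi_bound _.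
rewrite ltr_pdivrMr// ltNge => /negP; apply.
by apply: le_trans (bnd n); rewrite ler_wpM2r ?rnorm_ge0 ?ler_nat.
Qed.

(** Write [(w - lam) J = K + S].  As [lam - T = (1 - (w - lam) J) (w - T)], the
    operator [lam - T] is invertible up to finite rank; a finite rank
    correction [L] that is the identity on its kernel makes it invertible,
    because the kernel meets the range trivially. *)
Lemma peripheral_splitting (T J K S : V -> V) M (lam w : R[i]) :
  abs_complete V -> blin T -> (forall k x, N (iter k T x) <= M * N x) ->
  normc lam = 1 -> w != lam -> blin J ->
  (forall x, J (w *: x - T x) = x) -> (forall x, w *: J x - T (J x) = x) ->
  finite_rank K -> blin S -> (forall x, (w - lam) *: J x = K x + S x) ->
  (forall x, N (S x) <= 2^-1 * N x) ->
  (exists P S0, spectral_splitting T lam P S0) /\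
  finite_dimensional [set x | T x = lam *: x].
Proof.
move=> Vc Tb TM lam1 wlam Jb JT TJ Kf Sb JKS S2; have Kb := finite_rank_blin Kf.
have iterS k x : N (iter k S x) <= 1 * 2^-1 ^+ k * N x.
  rewrite mul1r; elim: k => [|k IH]; first by rewrite expr0 mul1r.
  by rewrite iterS exprS -mulrA; apply: le_trans (S2 _) _; rewrite ler_wpM2l.
have h01 : 0 <= (2^-1 : R) < 1 by apply/andP; split; lra.
have [G Gb [GS SG _]] := neumann Vc Sb ler01 h01 iterS.
have Ginj x : G x = 0 -> x = 0.
  by move=> Gx; rewrite -(GS x) Gx (blin0 Sb) subrr.
pose A x := lam *: x - T x.
have Ab : blin A by apply: (blin_sub (blin_scale lam (@blin_id _ V)) Tb).
have GA x : G (A x) = (w *: x - T x) - G (K (w *: x - T x)).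
  rewrite -[RHS]SG (blinB _ _ Sb); congr (G _).
  set z := w *: x - T x.
  have h : K z + S z = (w - lam) *: x by rewrite -JKS JT.
  rewrite (_ : A x = z - (w - lam) *: x); last by rewrite /A /z; lmod R[i].
  rewrite -h -{1}(GS (K z)) (blinB _ _ Sb); lmod R[i].
have [m [f [u [fb KE]]]] := Kf.
have kerE x : A x = 0 -> x = \sum_i f i x *: G (u i).
  move=> Ax; have Tx : T x = lam *: x.
    by apply/eqP; rewrite eq_sym -subr_eq0; apply/eqP.
  have := GA x; rewrite Ax (blin0 Gb) Tx -scalerBl => /eqP.
  rewrite eq_sym subr_eq0 (blinZ _ _ Kb) (blinZ _ _ Gb) => /eqP.
  have w0 : w - lam != 0 by rewrite subr_eq0.
  move=> /(congr1 (fun y => (w - lam)^-1 *: y)); rewrite !scalerA mulVf// !scale1r => {1}->.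
  by rewrite KE blin_sum//; apply: eq_bigr => i _; rewrite (blinZ _ _ Gb).
have [L Lf [AL LA]] := kernel_projection Ab fb kerE; have Lb := finite_rank_blin Lf.
have kerT x : A x = 0 -> T x = lam *: x.
  by move=> Ax; apply/eqP; rewrite eq_sym -subr_eq0; apply/eqP.
have asc x : A (A x) = 0 -> A x = 0.
  by move=> /kerT; exact: power_bounded_ascent.
pose H x := A x + L x.
have Hb : blin H by exact: blin_add.
have Hinj x : H x = 0 -> x = 0.
  move=> Hx; have Ax : A x = 0.
    apply: asc; rewrite (_ : A x = - L x); last by apply/eqP; rewrite -addr_eq0; apply/eqP.
    by rewrite (blinN _ Ab) AL oppr0.
  by rewrite -(LA _ Ax); move: Hx; rewrite /H Ax add0r.
pose F z := G (K z) - G (L (J z)).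
have Ff : finite_rank F.
  apply: finite_rank_sub; first exact: (finite_rank_compl Gb Kf).
  exact: (finite_rank_compl Gb (finite_rank_compr Jb Lf)).
have FH x : (w *: x - T x) - F (w *: x - T x) = G (H x).
  by rewrite /F /H (blinD _ _ Gb) GA JT; lmod R[i].
have [|Q Qb [QF FQ]] := finite_rank_fredholm Ff.
  move=> z Fz; have := FH (J z); rewrite TJ Fz subrr => /esym/Ginj/Hinj Jz.
  by rewrite -(TJ z) Jz scaler0 (blin0 Tb) subrr.
pose Hi v := J (Q (G v)).
have Hib : blin Hi by exact: (blin_comp Jb (blin_comp Qb Gb)).
have HiH x : Hi (H x) = x by rewrite /Hi -FH QF JT.
have HHi v : H (Hi v) = v.
  apply/eqP; rewrite -subr_eq0; apply/eqP/Ginj.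
  by rewrite (blinB _ _ Gb) -FH TJ FQ subrr.
pose P x := L (Hi x).
have Pb : blin P by exact: (blin_comp Lb Hib).
have AP x : A (P x) = 0 by exact: AL.
have Pker x : A x = 0 -> P x = x.
  move=> Ax; rewrite /P (_ : Hi x = x) ?LA//.
  by rewrite -[in LHS](LA _ Ax) -[L x]add0r -{1}Ax -/(H x) HiH.
have PA x : P (A x) = 0.
  have := HHi (A x); rewrite {1}/H -/(P (A x)) => h.
  have PE : P (A x) = A (x - Hi (A x)).
    by rewrite (blinB _ _ Ab) -{2}h; lmod R[i].
  by rewrite PE asc// -PE.
have PP x : P (P x) = P x by exact: Pker.
have AHi x : A (Hi (x - P x)) = x - P x.
  have h := HHi (x - P x); rewrite {1}/H in h.
  have L0 : L (Hi (x - P x)) = 0.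
    by rewrite -/(P (x - P x)) (blinB _ _ Pb) PP subrr.
  by rewrite -[RHS]h L0 addr0.
pose S0 x := Hi (x - P x) - P (Hi (x - P x)).
have IPb : blin (fun x => x - P x) by exact: (blin_sub (@blin_id _ V)).
have S0b : blin S0 by exact: (blin_comp IPb (blin_comp Hib IPb)).
split; last first.
  by exists m, (fun i => G (u i)) => x /= Tx; exists (fun i => f i x); apply: kerE; rewrite /A Tx subrr.
exists P, S0; split=> //.
- move=> x; split; first exact: kerT.
  have := PA x; rewrite (blinB _ _ Pb) (blinZ _ _ Pb) => /eqP.
  by rewrite subr_eq0 => /eqP.
- move=> x; split; first by rewrite -/(A (S0 x)) (blinB _ _ Ab) AP subr0 AHi.
  rewrite -/(A x) /S0 PA subr0.
  have h := AHi (A x); rewrite PA subr0 in h.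
  have := Pker (Hi (A x) - x); rewrite (blinB _ _ Ab) h subrr => /(_ erefl).
  by rewrite (blinB _ _ Pb) => /eqP; rewrite subr_eq => /eqP ->; lmod R[i].
- move=> x; split; first exact: PP.
    by rewrite /S0 (blinB _ _ Pb) PP subrr.
  by rewrite /S0 PP subrr (blin0 Hib) (blin0 Pb) subrr.
Qed.

Lemma opnorm_ge0 (f : V -> V) : (0 <= opnorm f)%E.
Proof.
apply: (@le_trans _ _ (N (f 0))%:E); first by rewrite lee_fin rnorm_ge0.
by apply: ereal_sup_ubound; exists 0 => //=; rewrite normr0.
Qed.

Lemma opnorm_cvg0 (u : nat -> V -> V) C : 0 <= C ->
  (forall n x, N (u n.+1 x) <= C * 2^-1 ^+ n * N x) ->
  opnorm (u n) @[n --> \oo] --> 0%E.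
Proof.
move=> C0 uC.
have sq : (C * 2^-1 ^+ n)%:E @[n --> \oo] --> 0%E.
  apply: cvg_EFin; first exact: nearW.
  rewrite -[0 as X in _ --> X](mulr0 C).
  apply: cvgMr; apply: cvg_expr; rewrite ger0_norm ?invr_ge0//; lra.
have h : opnorm (u n.+1) @[n --> \oo] --> 0%E.
  apply: (squeeze_cvge _ (cvg_cst 0%E) sq).
  apply: nearW => n; rewrite opnorm_ge0 /=; apply: opnorm_le => //.
  by rewrite mulr_ge0// exprn_ge0// invr_ge0.
by rewrite -(cvg_shiftS (fun n => opnorm (u n))).
Qed.

(** With [Q = (1 + (w - lam) S)^-1] the resolvent is
    [(w - lam)^-1 P + S Q], whose Laurent coefficients are [P] and the
    [(-1)^k S^(k + 1)]; when [P = 0] it extends to [w = lam]. *)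
Lemma splitting_neighbourhood (T : {linear V -> V}) (lam : R[i]) P S :
  abs_complete V -> blin T -> spectral_splitting T lam P S ->
  finite_dimensional [set x | T x = lam *: x] ->
  exists2 e : R, 0 < e & forall z, normc (z - lam) < e -> resolvent_set T z \/
    [/\ resolvent_pole T z, is_eigenvalue T z & finite_multiplicity T z].
Proof.
move=> Vc Tb [Pb Sb TP AS PS] fd; have [b b0 Sle] := Sb.2.
pose U w x := (- (w - lam)) *: S x.
have Ub w : blin (U w) by exact: blin_scale.
pose e := (2 * (b + 1))^-1.
have e0 : 0 < e by rewrite invr_gt0 mulr_gt0// ltr_wpDl.
have Ule w : normc (w - lam) < e -> forall x, N (U w x) <= 2^-1 * N x.
  move=> we x; rewrite rnormZ normcN.
  apply: (@le_trans _ _ (e * (b * N x))).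
    by rewrite ler_pM ?Defs.normc_ge0 ?rnorm_ge0// ltW.
  rewrite mulrA ler_wpM2r ?rnorm_ge0// /e invfM -mulrA ler_piMr ?invr_ge0//.
  by rewrite ler_pdivrMl ?ltr_wpDl// mulr1 lerDl.
have iterU w : normc (w - lam) < e -> forall k x, N (iter k (U w) x) <= 1 * 2^-1 ^+ k * N x.
  move=> we k x; rewrite mul1r; elim: k => [|k IH]; first by rewrite expr0 mul1r.
  by rewrite iterS exprS -mulrA; apply: le_trans (Ule _ we _) _; rewrite ler_wpM2l.
have h01 : 0 <= (2^-1 : R) < 1 by apply/andP; split; lra.
have res w : normc (w - lam) < e -> w != lam \/ (forall x, P x = 0) ->
    exists2 Q, [/\ blin Q, (forall y, Q y - U w (Q y) = y) & forall x, N (Q x) <= 2 * N x] &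
    exists2 S', is_resolvent T w S' & forall x, S' x = (w - lam)^-1 *: P x + S (Q x).
  move=> we wP.
  have [Q Qb [QU UQ Qle]] := neumann Vc (Ub w) ler01 h01 (iterU w we).
  have {}Qle x : N (Q x) <= 2 * N x.
    by apply: le_trans (Qle x) _; rewrite (_ : 1 / (1 - 2^-1) = 2 :> R)//; field.
  set dl := w - lam.
  have dP x : dl^-1 *: (dl *: P x) = P x.
    rewrite scalerA; case: wP => [wl|->]; last by rewrite scaler0.
    by rewrite mulVf ?scale1r// subr_eq0.
  have QE x : Q x = x - dl *: S (Q x).
    have /eqP := QU x; rewrite subr_eq => /eqP {1}->; rewrite /U -/dl; lmod R[i].
  have PQ x : P (Q x) = P x.
    have [_ PSx _] := PS (Q x).
    by rewrite {1}QE (blinB _ _ Pb) (blinZ _ _ Pb) PSx scaler0 subr0.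
  have SQ x : S (Q x) = Q (S x).
    rewrite -[LHS]UQ; congr (Q _).
    by rewrite -[in RHS](QU x) (blinB _ _ Sb) /U (blinZ _ _ Sb).
  have QP x : Q (P x) = P x.
    have [_ _ SPx] := PS x.
    by rewrite -{2}(UQ (P x)) /U SPx scaler0 subr0.
  exists Q => //.
  have Rb : blin (fun x => dl^-1 *: P x + S (Q x)).
    by apply: blin_add; [exact: blin_scale|exact: (blin_comp Sb Qb)].
  exists (to_linear Rb) => //; split => /=.
  - exact: blin_bounded.
  - move=> x; have [TPx PTx] := TP x; have [_ SAx] := AS x.
    rewrite (blinB _ _ Pb) (blinZ _ _ Pb) PTx -scalerBl dP SQ.
    rewrite (_ : w *: x - T x = dl *: x + (lam *: x - T x)); last first.
      by rewrite /dl; lmod R[i].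
    rewrite (blinD _ _ Sb) (blinZ _ _ Sb) SAx.
    rewrite (_ : dl *: S x + (x - P x) = (x - U w x) - P x); last first.
      by rewrite /U -/dl; lmod R[i].
    by rewrite (blinB _ _ Qb) UQ QP; lmod R[i].
  - move=> x; have [TPx PTx] := TP x; have [ASx _] := AS (Q x).
    rewrite (blinD _ _ Tb) (blinZ _ _ Tb) TPx.
    have := ASx; move=> /eqP; rewrite subr_eq => /eqP h.
    rewrite (_ : T _ = lam *: S (Q x) - (Q x - P (Q x))); last first.
      by rewrite h; lmod R[i].
    rewrite PQ.
    transitivity (dl^-1 *: (dl *: P x) + (dl *: S (Q x) + Q x - P x)).
      by rewrite /dl; lmod R[i].
    by rewrite dP {2}QE; lmod R[i].
exists e => // z ze.
have [P0|/existsNP[x0 Px0]] := pselect (forall x, P x = 0).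
  by left; have [Q _ [S' S'P _]] := res z ze (or_intror P0); exists S'.
have [->|zl] := eqVneq z lam; last first.
  by left; have [Q _ [S' S'P _]] := res z ze (or_introl zl); exists S'.
right; split.
- pose B' n x := if n is n'.+1 then (-1) ^+ n' *: iter n'.+1 S x else P x.
  have B'b n : blin (B' n).
    by case: n => //= n; apply: blin_scale; exact: (blin_iter n.+1 Sb).
  exists 1%N, (fun n => to_linear (B'b n)), e; split=> //.
  + by move=> n; apply: blin_bounded; exact: B'b.
  + by exists x0; apply/eqP => /= /Px0.
  move=> w /andP[]; rewrite normr_gt0 subr_eq0 => wl.
  rewrite (_ : `|w - lam| = (normc (w - lam))%:C)// ltcR => we.
  have [Q [Qb QU Qle] [S' S'P S'E]] := res w we (or_introl wl); exists S' => //.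
  have d0 : w - lam != 0 by rewrite subr_eq0.
  have iterUS n x : S (iter n (U w) x) = (- (w - lam)) ^+ n *: iter n.+1 S x.
    elim: n => [|n IH]; first by rewrite expr0 scale1r.
    by rewrite iterS {1}/U (blinZ _ _ Sb) IH (blinZ _ _ Sb) scalerA exprS.
  have key n x : S' x - \sum_(k < n.+1) (w - lam) ^ (k%:Z - 1%:Z) *: B' k x =
      S (iter n (U w) (Q x)).
    rewrite S'E {1}(neumann_expansion x n (Ub w) QU) (blinD _ _ Sb).
    rewrite big_ord_recl /= sub0r exprN1.
    rewrite [X in _ - (_ + X)](_ : _ = S (\sum_(i < n) iter i (U w) x)).
      by rewrite opprD addrACA subrr add0r addrAC subrr add0r.
    rewrite (blin_sum _ Sb); apply: eq_bigr => i _; rewrite iterUS scalerA /bump /= add1n; congr (_ *: _).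
    rewrite -addn1 PoszD addrK -exprnP.
    by rewrite -exprMn mulrN1.
  apply: (@opnorm_cvg0 _ (b * 2)); first by rewrite mulr_ge0.
  move=> n x; rewrite key; apply: le_trans (Sle _) _; rewrite -!mulrA ler_wpM2l//.
  apply: le_trans (iterU w we _ _) _.
  by rewrite mul1r mulrCA ler_wpM2l ?exprn_ge0 ?invr_ge0.
- exists (P x0); first exact/eqP.
  by have [] := TP x0.
- have ker n x : iter n (fun y => lam *: y - T y) x = 0 -> x = P x.
    elim: n x => [|n IH] x; first by move=> /= ->; rewrite (blin0 Pb).
    rewrite iterSr => /IH; rewrite (blinB _ _ Pb) (blinZ _ _ Pb) (TP x).2 subrr => Ax.
    have := (AS x).2; rewrite Ax (blin0 Sb) => /esym/eqP.
    by rewrite subr_eq0 => /eqP.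
  have [n [v vP]] := fd; exists n, v => x [k /ker xP]; apply: vP => /=.
  by rewrite xP (TP x).1.
Qed.

End peripheral.

(** * Finite rank approximation or independent images *)

Section independent_images.
Context (R : realType) (V : normedModType R[i]).
Implicit Types (x y : V).
Local Notation N := (@rnorm R V).

(** The consequence of the Hahn-Banach theorem that [greedy_family] needs. *)
Definition norming := forall y, exists2 f, bfunctional f &
  (forall x, normc (f x) <= N x) /\ f y = (N y)%:C.

(** Bounds the correction [E] of [greedy_family]: step [D] subtracts from [E]
    a rank one operator of norm at most [M * g * (2 * g)], with [g] the previous
    bound. That it depends on [M] and [D] only makes the family uniform in
    [eta] later on. *)
Fixpoint greedy_bound (M : R) (D : nat) : R :=
  if D is D'.+1 then greedy_bound M D' + M * greedy_bound M D' * (2 * greedy_bound M D')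
  else 1.

Lemma greedy_bound_ge1 M D : 0 <= M -> 1 <= greedy_bound M D.
Proof.
move=> M0; elim: D => //= D IH; apply: (le_trans IH); rewrite lerDl.
have g0 : 0 <= greedy_bound M D by exact: le_trans IH.
by rewrite !mulr_ge0.
Qed.

(** Forward substitution: [f i] recovers [a i] from the sum and the earlier
    coefficients, each step at most doubling the bound. *)
Lemma triangular_independence (f : nat -> V -> R[i]) (y : nat -> V) D :
  (forall i, (i < D)%N -> bfunctional (f i) /\ forall x, normc (f i x) <= N x) ->
  (forall i, (i < D)%N -> N (y i) <= 1 /\ f i (y i) = 1) ->
  (forall i j, (i < j < D)%N -> f i (y j) = 0) ->
  forall (a : nat -> R[i]) i, (i < D)%N ->
    normc (a i) <= 2 ^+ i * N (\sum_(j < D) a j *: y j).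
Proof.
move=> fb yf ut a i; set v := \sum_(j < D) _.
elim/ltn_ind: i => i IH iD; have [fib fi1] := fb _ iD.
have fv : f i v = \sum_(j < i) a j * f i (y j) + a i.
  rewrite /v bfunctional_sum// (bigID (fun j : 'I_D => (j < i)%N)) /=; congr (_ + _).
    rewrite (big_ord_widen D (fun j => a j * f i (y j)) (ltnW iD)).
    by apply: eq_bigr => j _; rewrite bfunctionalZ.
  rewrite (bigD1 (Ordinal iD)) /=; last by rewrite ltnn.
  rewrite bfunctionalZ// (yf _ iD).2 mulr1 big1 ?addr0// => j /andP[ij ji].
  rewrite bfunctionalZ// ut ?mulr0// ltn_ord andbT.
  rewrite ltn_neqAle leqNgt ij andbT; apply: contra ji => /eqP e.
  by apply/eqP/val_inj.
have -> : a i = f i v - \sum_(j < i) a j * f i (y j) by rewrite fv addrC addKr.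
apply: le_trans (le_normcD _ _) _; rewrite normcN.
apply: (@le_trans _ _ (N v + \sum_(j < i) 2 ^+ j * N v)).
  apply: lerD; first exact: fi1.
  apply: le_trans (normc_sum _) _; apply: ler_sum => j _.
  have jD := ltn_trans (ltn_ord j) iD.
  rewrite normcM -[leRHS]mulr1; apply: ler_pM; rewrite ?Defs.normc_ge0//.
    exact: IH.
  exact: le_trans (fi1 _) (yf _ jD).1.
rewrite -mulr_suml -[X in X + _]mul1r -mulrDl ler_wpM2r ?rnorm_ge0//.
have := subrX1 (2 : R) i; rewrite (_ : 2 - 1 = 1 :> R); last by ring.
by rewrite mul1r => <-; rewrite addrC subrK.
Qed.

(** Build [x i], functionals [f i] and finite rank [K] step by step, with
    [P - K = P E] annihilated by the [f i] chosen so far. If [P - K] is not yet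
    within [1/2], then some [E z] has an image of comparable size; normalize it to
    get the next [x i], norm its image by the next [f i], and subtract from [E]
    the rank one operator that makes [f i] vanish on the range of [P E]. *)
Lemma greedy_family P M : norming -> blin P -> 0 <= M -> (forall x, N (P x) <= M * N x) ->
  (exists2 K, finite_rank K & forall x, N (P x - K x) <= 2^-1 * N x) \/
  forall D, exists2 x : nat -> V, forall i, (i < D)%N -> N (x i) <= 2 * greedy_bound M D &
    forall (a : nat -> R[i]) i, (i < D)%N ->
      normc (a i) <= 2 ^+ i * N (\sum_(j < D) a j *: P (x j)).
Proof.
move=> Vn Pb M0 PM.
have [|nK] := pselect (exists2 K, finite_rank K & forall x, N (P x - K x) <= 2^-1 * N x).
  by left.
right => D.
suff [x [f [E [K [xle [[fb yf ut] _]]]]]] : exists (x : nat -> V) (f : nat -> V -> R[i]) (E K : V -> V),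
    (forall i, (i < D)%N -> N (x i) <= 2 * greedy_bound M D) /\
    ([/\ forall i, (i < D)%N -> bfunctional (f i) /\ forall x, normc (f i x) <= N x,
      (forall i, (i < D)%N -> N (P (x i)) <= 1 /\ f i (P (x i)) = 1) &
      (forall i j, (i < j < D)%N -> f i (P (x j)) = 0)] /\
    [/\ blin E, forall x, N (E x) <= greedy_bound M D * N x,
      finite_rank K, forall x, P (E x) = P x - K x &
      forall i x, (i < D)%N -> f i (P (E x)) = 0]).
  by exists x => // a i iD; exact: (triangular_independence fb yf ut).
elim: D => [|D [x [f [E [K [xle [[fb yf ut] [Eb Ele Kf PE fE]]]]]]]].
  exists (fun=> 0), (fun=> fun=> 0), idfun, (fun=> 0).
  split=> //; split.
    by split => // i j; rewrite ltn0 andbF.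
  split => //; [exact: blin_id|by move=> y /=; rewrite mul1r| |by move=> y; rewrite subr0].
  by exists 0%N, (fun=> fun=> 0), (fun=> 0); split=> [[]//|y]; rewrite big_ord0.
set g := greedy_bound M D in xle Ele *.
have g1 : 1 <= g := greedy_bound_ge1 D M0.
have g0 : 0 <= g := le_trans ler01 g1.
have [z zP] : exists z, 2^-1 * N z < N (P (E z)).
  apply: contrapT => nz; apply: nK; exists K => // z; rewrite -PE leNgt.
  by apply/negP => h; apply: nz; exists z.
set c := N (P (E z)) in zP.
have c0 : 0 < c by apply: le_lt_trans zP; rewrite mulr_ge0 ?rnorm_ge0.
have nV : normc (c^-1)%:C = c^-1.
  by rewrite normcR_ge0// invr_ge0 ltW.
pose xD := (c^-1)%:C *: E z.
have PxD : P xD = (c^-1)%:C *: P (E z) by rewrite blinZ.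
have NPxD : N (P xD) = 1 by rewrite PxD rnormZ nV mulVf ?gt_eqF.
have NxD : N xD <= 2 * g.
  rewrite rnormZ nV mulrC ler_pdivrMr//; apply: le_trans (Ele z) _.
  rewrite [2 * g]mulrC -mulrA ler_wpM2l// -ler_pdivrMl//; exact: ltW.
have [fD fDb [fD1 fDy]] := Vn (P xD).
have fDv : fD (P xD) = 1 by rewrite fDy NPxD.
pose x' i := if i == D then xD else x i.
pose f' i := if i == D then fD else f i.
pose q y := fD (P (E y)).
have qb : bfunctional q by exact: (bfunctional_comp fDb (blin_comp Pb Eb)).
have qf : finite_rank (fun y => q y *: xD).
  by exists 1%N, (fun=> q), (fun=> xD); split=> // y; rewrite big_ord1.
pose E' y := E y - q y *: xD.
exists x', f', E', (fun y => K y + q y *: P xD).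
have gS : g <= greedy_bound M D.+1 by rewrite /= -/g lerDl !mulr_ge0.
have ltD i : (i < D.+1)%N -> i <> D -> (i < D)%N.
  by rewrite ltnS leq_eqVlt => /orP[/eqP|].
split; [|split; split].
- move=> i iD; apply: (@le_trans _ _ (2 * g)); last by rewrite ler_wpM2l.
  by rewrite /x'; case: eqP => // /(ltD _ iD)/xle.
- by move=> i iD; rewrite /f'; case: eqP => // /(ltD _ iD)/fb.
- move=> i iD; rewrite /f' /x'; case: eqP => [_|/(ltD _ iD)/yf//].
  by rewrite NPxD fDv.
- move=> i j /andP[ij jD]; rewrite /f' /x'.
  have -> : (i == D) = false.
    by apply/negbTE; rewrite neq_ltn (leq_trans ij)//.
  case: eqP => [jD'|/(ltD _ jD) {}jD]; last by rewrite ut// ij.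
  rewrite PxD; have iD : (i < D)%N by rewrite -jD'.
  by rewrite bfunctionalZ ?fE ?mulr0//; exact: (fb _ iD).1.
- exact: (blin_sub Eb (finite_rank_blin qf)).
- move=> y; apply: le_trans (rnormB _ _) _; rewrite /= -/g mulrDl; apply: lerD => //.
  rewrite rnormZ mulrAC; apply: ler_pM; rewrite ?Defs.normc_ge0 ?rnorm_ge0//.
  apply: le_trans (fD1 _) _; apply: le_trans (PM _) _; rewrite -mulrA.
  exact: ler_wpM2l.
- apply: finite_rank_add => //.
  by exists 1%N, (fun=> q), (fun=> P xD); split=> // y; rewrite big_ord1.
- move=> y; rewrite /E' (blinB _ _ Pb) (blinZ _ _ Pb) PE.
  by rewrite -addrA opprD.
- move=> i y iD; rewrite /f' /E' (blinB _ _ Pb) (blinZ _ _ Pb).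
  case: eqP => [_|/(ltD _ iD) {}iD].
    by rewrite bfunctionalB// bfunctionalZ// fDv mulr1 subrr.
  have fib := (fb _ iD).1.
  rewrite bfunctionalB// bfunctionalZ// fE// PxD (bfunctionalZ _ _ fib) fE//.
  by rewrite !mulr0 subrr.
Qed.
End independent_images.

(** * A criterion for the essential spectral radius *)

Lemma ultra_bounded_cvg (R : realType) (U : set_system nat) (u : nat -> R) K :
  UltraFilter U -> (forall n, `|u n| <= K) -> exists l : R, u @ U --> l.
Proof.
move=> UU uK.
have : (u @ U) `[- K, K]%classic.
  apply: (@filterS _ U _ setT); last exact: filterT.
  by move=> n _; rewrite /= in_itv/= -ler_norml.
move=> /(@segment_compact R (- K) K (u @ U) _)[l [_ lU]].
exists l => W Wl; have [//|nW] := in_ultra_setVsetC (u @^-1` W) UU.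
have [z [nWz Wz]] := lU (~` W) W nW Wl.
by case: (nWz Wz).
Qed.

Lemma free_ultrafilter : exists U : set_system nat, UltraFilter U /\ \oo `<=` U.
Proof. exact: ultraFilterLemma. Qed.

Section peripheral_criterion.
Context (R : realType) (V : normedModType R[i]).
Local Notation N := (@rnorm R V).

(** The vectors [y i] are the images of the [x i] under the operator
    [P = eta lam ((1 + eta) lam - T)^-1]. Excluding large independent families
    of such images leaves the first alternative of [greedy_family], so every
    unimodular [lam] has a good neighbourhood, and the unit circle is compact. *)
Theorem ess_spectral_radius_lt1 (T : {linear V -> V}) M :
  abs_complete V -> norming V -> 0 <= M ->
  (forall k x, N (iter k T x) <= M * N x) ->
  (forall lam : R[i], normc lam = 1 -> exists D, forall C, exists2 eta : R, 0 < eta &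
    forall x y : nat -> V, (forall i, (i < D)%N -> N (x i) <= C) ->
      (forall i, (i < D)%N ->
        ((1 + eta)%:C * lam) *: y i - T (y i) = (eta%:C * lam) *: x i) ->
      ~ (forall (a : nat -> R[i]) i, (i < D)%N ->
           normc (a i) <= 2 ^+ i * N (\sum_(j < D) a j *: y j))) ->
  (ess_spectral_radius T < 1)%E.
Proof.
move=> Vc Vn M0 TM nofam.
have Tb : blin T.
  by split; [move=> a x y; rewrite linearP|exists M => // x; exact: (TM 1%N)].
pose good z := resolvent_set T z \/
  [/\ resolvent_pole T z, is_eigenvalue T z & finite_multiplicity T z].
have near1 lam : normc lam = 1 ->
    exists2 e : R, 0 < e & forall z, normc (z - lam) < e -> good z.
  move=> lam1; have [D HD] := nofam _ lam1.
  have [eta eta0 Heta] := HD (2 * greedy_bound M D).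
  set w := ((1 + eta)%:C * lam); set dl := eta%:C * lam.
  have wE : w - lam = dl by rewrite /w /dl rmorphD; ring.
  have nw : normc w = 1 + eta by rewrite normcM lam1 mulr1 normcR_ge0// addr_ge0// ltW.
  have ndl : normc dl = eta by rewrite normcM lam1 mulr1 normcR_ge0// ltW.
  have wlam : w != lam.
    by rewrite -subr_eq0 wE; apply/eqP => d0; move: eta0; rewrite -ndl d0 normc0 ltxx.
  have w1 : 1 < normc w by rewrite nw ltrDl.
  have [J Jb [JT TJ Jle _]] := outer_resolvent Vc Tb M0 TM w1.
  pose P x := dl *: J x.
  have Pb : blin P by exact: blin_scale.
  have PM x : N (P x) <= M * N x.
    rewrite /P rnormZ ndl -ler_pdivlMl//; apply: le_trans (Jle x) _.
    by rewrite nw addrAC subrr add0r mulrA [eta^-1 * _]mulrC.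
  have [[K Kf PK]|fam] := greedy_family Vn Pb M0 PM.
    have Kb := finite_rank_blin Kf.
    have [] := @peripheral_splitting R V T J K (fun x => P x - K x) M lam w => //.
    - exact: blin_sub.
    - by move=> x; rewrite wE -/(P x) addrC subrK.
    move=> [Q [S0 QS]] fd; exact: (splitting_neighbourhood Vc Tb QS fd).
  have [x xle xind] := fam D.
  case: (Heta x (P \o x)) => // i iD; rewrite /= /P (blinZ _ _ Tb).
  by rewrite -[in RHS](TJ (x i)) /w /dl; lmod R[i].
have outer z : 1 < normc z -> good z.
  move=> z1; left; have [J Jb [JT TJ _ _]] := outer_resolvent Vc Tb M0 TM z1.
  by exists (to_linear Jb); split=> //; exact: blin_bounded.
suff [r [r0 r1 rP]] : exists r : R, [/\ 0 <= r, r < 1 & forall z, r < normc z -> good z].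
  apply: (@le_lt_trans _ _ r%:E); last by rewrite lte_fin.
  apply: ereal_inf_lbound; exists r => //; split=> // z.
  by rewrite (_ : `|z| = (normc z)%:C)// ltcR => /rP.
apply: contrapT => nr.
have seq n : exists z, [/\ 1 - n.+1%:R^-1 < normc z, normc z <= 1 & ~ good z].
  apply: contrapT => nz; apply: nr; exists (1 - n.+1%:R^-1); split.
  - by rewrite subr_ge0 invf_le1// ler1n.
  - by rewrite ltrBlDr ltrDl invr_gt0.
  move=> z zn; apply: contrapT => ngz; apply: nz; exists z; split=> //.
  by rewrite leNgt; apply/negP => /outer.
have [z zP] := choice seq.
have [U [UU Uoo]] := free_ultrafilter.
have [a aP] : exists a : R, (fun n => complex.Re (z n)) @ U --> a.
  apply: (@ultra_bounded_cvg R U _ 1) => n; apply: le_trans (Re_le_normc _) _.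
  by have [] := zP n.
have [b bP] : exists b : R, (fun n => complex.Im (z n)) @ U --> b.
  apply: (@ultra_bounded_cvg R U _ 1) => n; apply: le_trans (Im_le_normc _) _.
  by have [] := zP n.
have zlim e : 0 < e -> U [set n | normc (z n - (a +i* b)) < e].
  move=> e0; have e2 : 0 < e / 2 by rewrite divr_gt0.
  move/cvgrPdist_lt: aP => /(_ _ e2) aU; move/cvgrPdist_lt: bP => /(_ _ e2) bU.
  apply: filterS (filterI aU bU) => n [/= an bn].
  have zE : z n - (a +i* b) =
      (complex.Re (z n) - a)%:C + 'i * (complex.Im (z n) - b)%:C.
    by case: (z n) => s t; simpc.
  rewrite zE; apply: le_lt_trans (le_normcD _ _) _.
  rewrite normcM (_ : normc 'i = 1) ?mul1r; last by rewrite /= expr0n add0r expr1n sqrtr1.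
  rewrite /= !expr0n /= !addr0 !sqrtr_sqr (splitr e).
  by rewrite distrC in an; rewrite distrC in bn; exact: ltrD.
have lam1 : normc (a +i* b) = 1.
  apply/eqP; rewrite eq_le; apply/andP; split; apply/ler_addgt0Pl => e e0.
    have [n nP] := filter_ex (zlim _ e0); have [_ zn1 _] := zP n.
    rewrite (_ : a +i* b = - (z n - (a +i* b)) + z n); last by rewrite opprB subrK.
    apply: le_trans (le_normcD _ _) _; rewrite normcN.
    by apply: lerD => //; exact: ltW.
  have e2 : 0 < e / 2 by rewrite divr_gt0.
  have : U [set n | n.+1%:R^-1 <= e / 2].
    apply: Uoo; have /cvgrPdist_le/(_ _ e2) := @cvg_harmonic R.
    by apply: filterS => n /=; rewrite sub0r normrN ger0_norm// invr_ge0.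
  move=> he; have [n [/= nP ne]] := filter_ex (filterI (zlim _ e2) he).
  have [zn _ _] := zP n.
  rewrite -lerBlDl; apply: (@le_trans _ _ (normc (z n) - e / 2)); last first.
    rewrite lerBlDr -[in leLHS](subrK (a +i* b) (z n)).
    by apply: le_trans (le_normcD _ _) _; rewrite addrC lerD2l ltW.
  rewrite lerBrDr {1}(splitr e) opprD addrA subrK.
  by apply: le_trans (ltW zn); rewrite lerD2l lerN2.
have [e e0 eP] := near1 _ lam1.
have [n /= nP] := filter_ex (zlim _ e0).
by have [_ _] := zP n; apply; exact: eP.
Qed.

End peripheral_criterion.

(** * Orthonormal bases and nets of the unit ball *)

Section orthonormal_bases_and_nets.
Context (R : realType).

(** Gram and Schmidt: enlarge an orthonormal family by a vector orthogonal to
    it, until it has [n] elements. *)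
Lemma orthonormal_rows n (G : 'M[R]_n) : G^T = G ->
  (forall v : 'rV[R]_n, v != 0 -> 0 < (v *m G *m v^T) 0 0) ->
  exists E : 'M[R]_n, E *m G *m E^T = 1%:M.
Proof.
move=> Gsym Gpos.
suff : forall k, (k <= n)%N -> exists E : 'M[R]_(k, n), E *m G *m E^T = 1%:M.
  by move=> /(_ n (leqnn n)).
elim=> [|k IH] kn; first by exists 0; apply/matrixP => -[].
have [E EG] := IH (ltnW kn).
have : kermx (G *m E^T) != 0.
  rewrite -mxrank_eq0 mxrank_ker -lt0n subn_gt0.
  exact: leq_ltn_trans (rank_leq_col _) kn.
move=> /rowV0Pn[v /sub_kermxP vG v0].
set s := (v *m G *m v^T) 0 0; have s0 : 0 < s by exact: Gpos.
pose v' := (Num.sqrt s)^-1 *: v.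
have vGE : v' *m G *m E^T = 0.
  by rewrite /v' -!scalemxAl -mulmxA vG scaler0.
rewrite -addn1; exists (col_mx E v').
rewrite mul_col_mx tr_col_mx mul_col_row EG vGE scalar_mx_block; congr block_mx.
  by apply: trmx_inj; rewrite !trmx_mul trmxK Gsym mulmxA vGE trmx0.
rewrite {2}/v' linearZ /= -scalemxAr /v' -!scalemxAl scalerA.
apply/matrixP => i j; rewrite !ord1 [LHS]mxE [RHS]mxE eqxx -/s.
by rewrite -invfM -expr2 sqr_sqrtr ?ltW// mulVf// gt_eqF.
Qed.

(** Take the points of the grid [L^-1 Z^n] in the unit ball, and round the unit
    vector [a / |a|] towards the origin, coordinate by coordinate: the result
    stays in the ball. *)
Lemma unit_ball_net n (e : R) : 0 < e -> exists s : seq 'rV[R]_n,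
  (forall b, b \in s -> \sum_i b 0 i ^+ 2 <= 1) /\
  (forall a : 'I_n -> R, exists2 b, b \in s &
    (1 - e) * Num.sqrt (\sum_i a i ^+ 2) <= \sum_i b 0 i * a i).
Proof.
move=> e0; pose m := (Num.truncn e^-1).+1.
have me : m%:R^-1 <= e.
  rewrite -[leRHS]invrK lef_pV2 ?posrE ?invr_gt0// ?ltr0n//.
  exact/ltW/truncnS_gt.
(* rounding costs at most [|a| / L] in each of the [n] coordinates *)
pose L := (m * n)%N.
pose pt (f : {ffun 'I_n -> 'I_L.+1 * bool}) : 'rV[R]_n :=
  \row_i ((-1) ^+ (f i).2 * ((f i).1%:R / L%:R)).
exists (0 :: [seq b : 'rV[R]_n <- [seq pt f | f : {ffun 'I_n -> 'I_L.+1 * bool}] |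
             \sum_i b 0 i ^+ 2 <= 1]); split.
  move=> b; rewrite inE => /orP[/eqP ->|]; last by rewrite mem_filter => /andP[].
  by rewrite big1 ?ler01// => i _; rewrite mxE expr0n.
move=> a; set q := \sum_i _.
have q_ge0 : 0 <= q by apply: sumr_ge0 => i _; exact: sqr_ge0.
have [q0|q0] := eqVneq q 0.
  exists 0; rewrite ?inE ?eqxx// q0 sqrtr0 mulr0.
  by rewrite big1// => i _; rewrite mxE mul0r.
have qp : 0 < q by rewrite lt_def q0.
pose r := Num.sqrt q; have r0 : 0 < r by rewrite sqrtr_gt0.
have rq : r ^+ 2 = q by rewrite sqr_sqrtr.
have n0 : (0 < n)%N.
  by rewrite lt0n; apply: contra q0 => /eqP n0; rewrite /q; move: (a); rewrite n0 => a'; rewrite big_ord0.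
have L0 : 0 < L%:R :> R by rewrite ltr0n muln_gt0.
have ar i : `|a i| <= r.
  rewrite -(ler_pXn2r (ltn0Sn 1)) ?nnegrE ?(ltW r0)// rq real_normK ?num_real//.
  rewrite /q (bigD1 i)//= lerDl; apply: sumr_ge0 => j _; exact: sqr_ge0.
pose k i := Num.truncn (L%:R * `|a i| / r).
have k1 i : (k i)%:R <= L%:R * `|a i| / r.
  by rewrite truncn_le divr_ge0 ?mulr_ge0// (ltW r0).
have k2 i : L%:R * `|a i| / r - 1 <= (k i)%:R.
  by rewrite lerBlDr natr1; apply/ltW/truncnS_gt.
have kL i : (k i < L.+1)%N.
  rewrite ltnS -(ler_nat R); apply: le_trans (k1 i) _.
  by rewrite ler_pdivrMr// ler_wpM2l.
pose f := [ffun i => (Ordinal (kL i), a i < 0)].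
have ptE i : pt f 0 i = (-1) ^+ (a i < 0)%R * ((k i)%:R / L%:R).
  by rewrite mxE ffunE.
exists (pt f).
  rewrite inE mem_filter; apply/orP; right; apply/andP; split; last first.
    by apply: map_f; rewrite mem_enum.
  have -> : 1 = \sum_i a i ^+ 2 / q by rewrite -mulr_suml mulfV.
  apply: ler_sum => i _; rewrite ptE exprMn sqrr_sign mul1r -rq.
  rewrite -[a i ^+ 2]real_normK ?num_real// -exprVn -exprMn.
  rewrite ler_pXn2r ?nnegrE ?divr_ge0 ?(ltW r0)//.
  by rewrite ler_pdivrMr// [leRHS]mulrC mulrA.
rewrite -/r.
have dot : (1 - m%:R^-1) * r <= \sum_i pt f 0 i * a i.
  apply: (@le_trans _ _ (\sum_i (a i ^+ 2 / r - r / L%:R))); last first.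
    apply: ler_sum => i _; rewrite ptE.
    have -> : (-1) ^+ (a i < 0)%R * ((k i)%:R / L%:R) * a i = (k i)%:R / L%:R * `|a i|.
      by rewrite normrEsign; ring.
    apply: (@le_trans _ _ ((L%:R * `|a i| / r - 1) / L%:R * `|a i|)); last first.
      by rewrite ler_wpM2r// ler_wpM2r ?invr_ge0.
    rewrite mulrBl mulrBl -[a i ^+ 2]real_normK ?num_real//.
    have -> : L%:R * `|a i| / r / L%:R * `|a i| = `|a i| ^+ 2 / r.
      by field; rewrite !gt_eqF.
    by rewrite lerD2l lerN2 mul1r mulrC ler_pdivrMr// divfK ?gt_eqF.
  rewrite sumrB -mulr_suml -/q -rq sumr_const card_ord -mulr_natl.
  have mR : m%:R != 0 :> R by rewrite pnatr_eq0.
  have nR : n%:R != 0 :> R by rewrite pnatr_eq0 -lt0n.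
  have rN : r != 0 by rewrite gt_eqF.
  by rewrite le_eqVlt; apply/orP; left; apply/eqP; rewrite /L natrM; field; rewrite ?mR ?nR ?rN.
by apply: le_trans dot; rewrite ler_wpM2r ?(ltW r0)// lerD2l lerN2.
Qed.

End orthonormal_bases_and_nets.

(** * Iterated limits along an ultrafilter *)

Section double_limit.
Context (R : realType) (U : set_system nat).
Context {UU : UltraFilter U}.
Implicit Types (u : nat -> nat -> R) (l : R).

(** The outer variable [m] will be a cut-off level and the inner one [n] the
    index of the approximate eigenvectors; the cut-off is removed last. *)
Definition dlim u l := exists v : nat -> R,
  (forall m, (fun n => u m n) @ U --> v m) /\ v @ U --> l.

Lemma ultra_cvg_le (f : nat -> R) l s : f @ U --> l -> U [set n | f n <= s] -> l <= s.
Proof. by move=> fl h; exact: (ler_cvg_to fl (@cvg_cst _ s _ U _) h). Qed.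

Lemma ultra_cvg_ge (f : nat -> R) l s : f @ U --> l -> U [set n | s <= f n] -> s <= l.
Proof. by move=> fl h; exact: (ler_cvg_to (@cvg_cst _ s _ U _) fl h). Qed.

Lemma dlim_ex u K : (forall m n, `|u m n| <= K) -> exists l, dlim u l.
Proof.
move=> uK; have /choice[v vP] m : exists v : R, (fun n => u m n) @ U --> v.
  exact: (@ultra_bounded_cvg R U _ K).
have [|l lP] := @ultra_bounded_cvg R U v K UU; last by exists l, v.
move=> m; have h : (fun n => `|u m n|) @ U --> `|v m| by exact: cvg_norm.
by apply: (ultra_cvg_le h); apply: filterS (@filterT _ U _) => n _ /=.
Qed.

Lemma dlim_unique u l l' : dlim u l -> dlim u l' -> l = l'.
Proof.
move=> [v [uv vl]] [v' [uv' vl']].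
have vv : v = v'.
  by apply/funext => m; exact: (cvg_unique (@Rhausdorff R) (uv m) (uv' m)).
by rewrite -vv in vl'; exact: (cvg_unique (@Rhausdorff R) vl vl').
Qed.

Lemma dlimD u u' l l' : dlim u l -> dlim u' l' ->
  dlim (fun m n => u m n + u' m n) (l + l').
Proof.
move=> [v [uv vl]] [v' [uv' vl']]; exists (fun m => v m + v' m); split.
  by move=> m; apply: cvgD.
by apply: cvgD.
Qed.

Lemma dlimZ a u l : dlim u l -> dlim (fun m n => a * u m n) (a * l).
Proof.
move=> [v [uv vl]]; exists (fun m => a * v m); split; last exact: cvgMr.
by move=> m; exact: cvgMr.
Qed.

Lemma dlim0 : dlim (fun _ _ => 0) 0.
Proof. by exists (fun=> 0); split=> [m|]; exact: cvg_cst. Qed.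

Lemma dlim_sum I (r : seq I) (u : I -> nat -> nat -> R) (l : I -> R) :
  (forall i, dlim (u i) (l i)) ->
  dlim (fun m n => \sum_(i <- r) u i m n) (\sum_(i <- r) l i).
Proof.
move=> ul; elim: r => [|i r IH].
  rewrite big_nil (_ : (fun _ _ => _) = (fun _ _ => 0)); first exact: dlim0.
  by apply/funext => m; apply/funext => n; rewrite big_nil.
rewrite big_cons (_ : (fun _ _ => _) = (fun m n => u i m n + \sum_(i <- r) u i m n)).
  exact: dlimD.
by apply/funext => m; apply/funext => n; rewrite big_cons.
Qed.

Lemma dlim_ge u l s : \oo `<=` U -> dlim u l ->
  (exists m0, forall m, (m0 <= m)%N -> U [set n | s <= u m n]) -> s <= l.
Proof.
move=> oU [v [uv vl]] [m0 hm0]; apply: (ultra_cvg_ge vl).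
apply: oU; exists m0 => // m /= /hm0 h.
exact: (ultra_cvg_ge (uv m)).
Qed.

Lemma dlim_le u l s : dlim u l -> (forall m, U [set n | u m n <= s]) -> l <= s.
Proof.
move=> [v [uv vl]] h; apply: (ultra_cvg_le vl).
by apply: nearW => m; exact: (ultra_cvg_le (uv m)).
Qed.
End double_limit.

(** * A dimension bound for families of bounded functions *)

Section bounded_measurable.
Context d (Om : measurableType d) (R : realType).
Variable mu : {finite_measure set Om -> \bar R}.
Implicit Types (f g : Om -> R).

Definition bmeasurable f := measurable_fun setT f /\ exists K, forall x, `|f x| <= K.

Lemma bmeasurable_cst (r : R) : bmeasurable (cst r).
Proof. by split; [exact: measurable_cst|exists `|r|]. Qed.

Lemma bmeasurableD f g : bmeasurable f -> bmeasurable g -> bmeasurable (fun x => f x + g x).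
Proof.
move=> [mf [K fK]] [mg [L gL]]; split; first exact: measurable_funD.
by exists (K + L) => x; apply: le_trans (ler_normD _ _) (lerD _ _).
Qed.

Lemma bmeasurableM f g : bmeasurable f -> bmeasurable g -> bmeasurable (fun x => f x * g x).
Proof.
move=> [mf [K fK]] [mg [L gL]]; split; first exact: measurable_funM.
by exists (K * L) => x; rewrite normrM ler_pM.
Qed.

Lemma bmeasurableZ (r : R) f : bmeasurable f -> bmeasurable (fun x => r * f x).
Proof. by move=> bf; exact: (bmeasurableM (bmeasurable_cst r) bf). Qed.

Lemma bmeasurable_sum I (s : seq I) (f : I -> Om -> R) :
  (forall i, bmeasurable (f i)) -> bmeasurable (fun x => \sum_(i <- s) f i x).
Proof.
move=> bf; elim: s => [|i s IH].
  rewrite (_ : (fun x => _) = cst 0); first exact: bmeasurable_cst.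
  by apply/funext => x; rewrite big_nil.
rewrite (_ : (fun x => _) = (fun x => f i x + \sum_(i <- s) f i x)).
  exact: bmeasurableD.
by apply/funext => x; rewrite big_cons.
Qed.

Lemma bmeasurable_indic (A : set Om) : measurable A -> bmeasurable (\1_A : Om -> R).
Proof.
move=> mA; split; first exact: measurable_indic.
by exists 1 => x; rewrite indicE; case: (_ \in _); rewrite ?normr1 ?normr0.
Qed.

Lemma bmeasurable_integrable f : bmeasurable f -> mu.-integrable setT (EFin \o f).
Proof.
move=> [mf [K fK]]; apply: measurable_bounded_integrable => //.
  exact: fin_num_fun_lty.
by exists K; split; [exact: num_real|move=> z Kz x _ /=; apply: le_trans (fK x) (ltW Kz)].
Qed.

Local Notation I f := (\int[mu]_x f x).

Lemma Rintegral_sum J (s : seq J) (f : J -> Om -> R) : (forall i, bmeasurable (f i)) ->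
  I (fun x => \sum_(i <- s) f i x) = \sum_(i <- s) I (f i).
Proof.
move=> bf; elim: s => [|i s IH].
  rewrite big_nil (_ : (fun x => _) = cst 0); first by rewrite Rintegral_cst// mul0r.
  by apply/funext => x; rewrite big_nil.
rewrite big_cons -IH -RintegralD//; [|exact: bmeasurable_integrable..|]; last first.
  by apply: bmeasurable_integrable; exact: bmeasurable_sum.
by apply: eq_Rintegral => x _; rewrite big_cons.
Qed.

Lemma Rintegral_indic (A : set Om) : measurable A -> I (\1_A : Om -> R) = fine (mu A).
Proof. by move=> mA; rewrite /Rintegral integral_indic// setIT. Qed.

Lemma le_Rintegral_bm f g : bmeasurable f -> bmeasurable g ->
  (forall x, f x <= g x) -> I f <= I g.
Proof.
by move=> bf bg fg; apply: le_Rintegral => //; exact: bmeasurable_integrable.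
Qed.

Lemma measurable_superlevel f (s : R) : measurable_fun setT f ->
  measurable [set x | s < f x].
Proof.
move=> mf; rewrite (_ : [set x | _] = setT `&` f @^-1` `]s, +oo[%classic).
  by apply: mf => //; exact: measurable_itv.
by rewrite setTI; apply/seteqP; split => x /=; rewrite in_itv/= andbT.
Qed.
End bounded_measurable.

Section dimension_bound.
Context d (Om : measurableType d) (R : realType).
Variable mu : {finite_measure set Om -> \bar R}.
Context (U : set_system nat) {UU : UltraFilter U}.
Local Notation I f := (\int[mu]_x f x).

(** Suppose first that the functions [f j = a j + i b j] do not depend on [m]
    and [n]. The hypotheses then say that [|f|^2 > s] has measure at least [c]
    or [0] for every real combination [f], whence [c sup |f|^2 <= |f|_2^2].
    By Grothendieck's argument such a space has bounded dimension: apply this to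
    the combinations of an orthonormal basis with coefficients in the unit ball;
    the supremum over them of [|f x|^2] controls the sum of the squares of the
    basis at [x], and that sum has integral [D]. A finite net of the ball keeps
    the exceptional null sets finite in number.

    In general [a] and [b] stand for a limit object in which only integrals and
    measures of level sets make sense; the Gram matrix, and [D] as an integral,
    are iterated limits. *)
Lemma dimension_bound D (a b : 'I_D -> nat -> nat -> Om -> R) K (c : R) :
  \oo `<=` U -> 0 < c ->
  (forall j m n, measurable_fun setT (a j m n) /\ measurable_fun setT (b j m n)) ->
  (forall j m n x, `|a j m n x| <= K /\ `|b j m n x| <= K) ->
  let H (al : 'rV[R]_D) m n x :=
    (\sum_j al 0 j * a j m n x) ^+ 2 + (\sum_j al 0 j * b j m n x) ^+ 2 in
  let big al s := exists m0, forall m, (m0 <= m)%N ->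
    U [set n | (c%:E <= mu [set x | (s < H al m n x)%R])%E] in
  (forall al s, 0 <= s -> big al s \/ forall s', s < s' -> forall m e, 0 < e ->
    U [set n | (mu [set x | (s' < H al m n x)%R] <= e%:E)%E]) ->
  (forall al, al != 0 -> exists2 s, 0 < s & big al s) ->
  D%:R * c <= 32 * fine (mu setT).
Proof.
move=> oU c0 mab abK H big dich nondeg.
have ba j m n : bmeasurable (a j m n).
  by split; [exact: (mab j m n).1|exists K => x; exact: (abK j m n x).1].
have bb j m n : bmeasurable (b j m n).
  by split; [exact: (mab j m n).2|exists K => x; exact: (abK j m n x).2].
have bsum (al : 'rV[R]_D) (f : 'I_D -> Om -> R) : (forall j, bmeasurable (f j)) ->
    bmeasurable (fun x => \sum_j al 0 j * f j x).
  by move=> bf; apply: bmeasurable_sum => j; exact: bmeasurableZ.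
have bH al m n : bmeasurable (H al m n).
  by apply: bmeasurableD; apply: bmeasurableM; exact: bsum.
pose C j k m n x := a j m n x * a k m n x + b j m n x * b k m n x.
have bC j k m n : bmeasurable (C j k m n) by apply: bmeasurableD; exact: bmeasurableM.
have V0 : 0 <= fine (mu setT) by rewrite fine_ge0.
(* Gram matrix of the limit functions *)
have exG (jk : 'I_D * 'I_D) : exists g : R,
    dlim U (fun m n => I (C jk.1 jk.2 m n)) g.
  apply: (@dlim_ex _ _ _ _ ((K * K + K * K) * fine (mu setT))) => m n.
  have CK x : `|C jk.1 jk.2 m n x| <= K * K + K * K.
    have [ja jb] := abK jk.1 m n x; have [ka kb] := abK jk.2 m n x.
    apply: le_trans (ler_normD _ _) _; rewrite !normrM.
    by apply: lerD; exact: ler_pM.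
  rewrite -Rintegral_cst//; apply: le_trans (le_normr_Rintegral _ _) _ => //.
    exact: bmeasurable_integrable.
  apply: le_Rintegral_bm => //; last exact: bmeasurable_cst.
  split; last by exists (K * K + K * K) => x; rewrite normr_id.
  by apply: measurableT_comp => //; exact: (bC _ _ _ _).1.
have [G GP] := choice exG.
pose Gm : 'M[R]_D := \matrix_(j, k) G (j, k).
have Gsym : Gm^T = Gm.
  apply/matrixP => j k; rewrite !mxE; apply: (@dlim_unique _ U _ _ _ _ (GP (k, j))).
  rewrite (_ : (fun m n => _) = (fun m n => I (C j k m n))); first exact: (GP (j, k)).
  by apply/funext => m; apply/funext => n; apply: eq_Rintegral => x _; rewrite /C /=; ring.
have HC al m n x : H al m n x = \sum_j \sum_k al 0 j * al 0 k * C j k m n x.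
  rewrite /H !expr2 !big_distrlr /= -big_split; apply: eq_bigr => j _.
  rewrite -big_split; apply: eq_bigr => k _; rewrite /C /=; ring.
have qf (al : 'rV[R]_D) : (al *m Gm *m al^T) 0 0 = \sum_j \sum_k al 0 j * al 0 k * G (j, k).
  rewrite mxE exchange_big /=; apply: eq_bigr => k _.
  rewrite !mxE mulr_suml; apply: eq_bigr => j _; rewrite !mxE; ring.
have GH al : dlim U (fun m n => I (H al m n)) ((al *m Gm *m al^T) 0 0).
  rewrite qf (_ : (fun m n => _) =
      (fun m n => \sum_j \sum_k al 0 j * al 0 k * I (C j k m n))).
    by apply: dlim_sum => j; apply: dlim_sum => k; apply: dlimZ; exact: (GP (j, k)).
  apply/funext => m; apply/funext => n.
  rewrite (_ : I (H al m n) = I (fun x => \sum_j \sum_k al 0 j * al 0 k * C j k m n x)).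
    rewrite Rintegral_sum; last first.
      by move=> j; apply: bmeasurable_sum => k; exact: bmeasurableZ.
    apply: eq_bigr => j _; rewrite Rintegral_sum; last by move=> k; exact: bmeasurableZ.
    apply: eq_bigr => k _; rewrite RintegralZl//; exact: bmeasurable_integrable.
  by apply: eq_Rintegral => x _; rewrite HC.
have Hge0 al m n x : 0 <= H al m n x by rewrite addr_ge0 ?sqr_ge0.
have bigG al s : 0 <= s -> big al s -> s * c <= (al *m Gm *m al^T) 0 0.
  move=> s0 [m0 hm0]; apply: (dlim_ge oU (GH al)); exists m0 => m /hm0.
  apply: filterS => n /= cn; set A := [set x | _] in cn.
  have mA : measurable A by apply: measurable_superlevel; exact: (bH _ _ _).1.
  have cA : c <= fine (mu A) by rewrite -lee_fin fineK// fin_num_measure.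
  apply: (@le_trans _ _ (I (fun x => s * \1_A x))).
    rewrite RintegralZl//; first by rewrite Rintegral_indic// ler_wpM2l.
    by apply: bmeasurable_integrable; exact: bmeasurable_indic.
  apply: le_Rintegral_bm => [|//|x]; first exact/bmeasurableZ/bmeasurable_indic.
  rewrite indicE; case: (boolP (x \in A)) => [/set_mem/= h|_]; last by rewrite mulr0.
  by rewrite mulr1 ltW.
have Gpos (v : 'rV[R]_D) : v != 0 -> 0 < (v *m Gm *m v^T) 0 0.
  move=> /nondeg[s s0 bs]; apply: lt_le_trans (bigG _ _ (ltW s0) bs).
  exact: mulr_gt0.
have [E EG] := orthonormal_rows Gsym Gpos.
have half0 : 0 < 2^-1 :> R by rewrite invr_gt0.
have [net [net1 net2]] := @unit_ball_net R D 2^-1 half0.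
have netP (f : 'I_D -> R) : exists2 be, be \in net &
    \sum_i f i ^+ 2 <= 4 * (\sum_i be 0 i * f i) ^+ 2.
  have [be ben h] := net2 f; exists be => //.
  set q := \sum_i f i ^+ 2 in h *.
  have q0 : 0 <= q by apply: sumr_ge0 => i _; exact: sqr_ge0.
  have r0 := sqrtr_ge0 q.
  rewrite -(sqr_sqrtr q0) (_ : 4 * _ = (2 * \sum_i be 0 i * f i) ^+ 2); last by ring.
  rewrite ler_sqr ?nnegrE//; lra.
(* a combination of norm at most [1] cannot exceed the level [2 / c] on a set of
   measure [c], so the set where it exceeds a higher level is negligible *)
have small be : be \in net -> forall m e, 0 < e ->
    U [set n | (mu [set x | (4 / c < H (be *m E) m n x)%R] <= e%:E)%E].
  move=> /net1 be1; have [|/bigG h|h] := dich (be *m E) (2 / c).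
  - by rewrite divr_ge0// ltW.
  - exfalso; have : 2 / c * c <= 1.
      apply: le_trans (h _) _; first by rewrite divr_ge0// ltW.
      rewrite trmx_mul !mulmxA -(mulmxA be E Gm) -(mulmxA be (E *m Gm) E^T) EG mulmx1.
      rewrite mxE; apply: le_trans be1; rewrite le_eqVlt; apply/orP; left; apply/eqP.
      by apply: eq_bigr => i _; rewrite mxE expr2.
    by rewrite divfK ?gt_eqF//; lra.
  - by apply: h; rewrite ltr_pM2r ?invr_gt0// ltr_nat.
pose Q m n x := \sum_i H (row i E) m n x.
have bQ m n : bmeasurable (Q m n) by apply: bmeasurable_sum => i; exact: bH.
have QD : dlim U (fun m n => I (Q m n)) D%:R.
  rewrite (_ : D%:R = \sum_(i < D) ((row i E) *m Gm *m (row i E)^T) 0 0); last first.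
    rewrite (eq_bigr (fun=> 1)) ?sumr_const ?card_ord// => i _.
    have <- : (E *m Gm *m E^T) i i = 1 by rewrite EG mxE eqxx.
    rewrite -row_mul [LHS]mxE [RHS]mxE; apply: eq_bigr => j _.
    by congr (_ * _); [rewrite mxE|rewrite !mxE].
  rewrite (_ : (fun m n => _) = (fun m n => \sum_i I (H (row i E) m n))).
    by apply: dlim_sum => i; exact: GH.
  by apply/funext => m; apply/funext => n; rewrite Rintegral_sum.
have HE (be : 'rV[R]_D) m n x : H (be *m E) m n x =
    (\sum_i be 0 i * \sum_j E i j * a j m n x) ^+ 2 +
    (\sum_i be 0 i * \sum_j E i j * b j m n x) ^+ 2.
  have lin (f : 'I_D -> R) : \sum_j (be *m E) 0 j * f j =
      \sum_i be 0 i * \sum_j E i j * f j.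
    rewrite (eq_bigr (fun j => \sum_i be 0 i * E i j * f j)).
      rewrite exchange_big /=; apply: eq_bigr => i _; rewrite mulr_sumr.
      by apply: eq_bigr => j _; rewrite mulrA.
    by move=> j _; rewrite mxE mulr_suml.
  by rewrite /H !lin.
have QE m n x : Q m n x = \sum_i (\sum_j E i j * a j m n x) ^+ 2 +
    \sum_i (\sum_j E i j * b j m n x) ^+ 2.
  rewrite /Q /H big_split /=; congr (_ + _); apply: eq_bigr => i _; congr (_ ^+ 2);
    by apply: eq_bigr => j _; rewrite mxE.
have Qnet m n x : exists2 be, be \in net & Q m n x <= 8 * H (be *m E) m n x.
  have [b1 b1n h1] := netP (fun i => \sum_j E i j * a j m n x).
  have [b2 b2n h2] := netP (fun i => \sum_j E i j * b j m n x).
  have H1 : \sum_i (\sum_j E i j * a j m n x) ^+ 2 <= 4 * H (b1 *m E) m n x.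
    by apply: le_trans h1 _; rewrite ler_wpM2l// HE lerDl sqr_ge0.
  have H2 : \sum_i (\sum_j E i j * b j m n x) ^+ 2 <= 4 * H (b2 *m E) m n x.
    by apply: le_trans h2 _; rewrite ler_wpM2l// HE lerDr sqr_ge0.
  have [h|h] := leP (H (b1 *m E) m n x) (H (b2 *m E) m n x).
    by exists b2 => //; rewrite QE; lra.
  by exists b1 => //; rewrite QE; lra.
have Ebd (f : 'I_D -> nat -> nat -> Om -> R) : (forall j m n x, `|f j m n x| <= K) ->
  forall (al : 'rV[R]_D) m n x, (\sum_j al 0 j * f j m n x) ^+ 2 <= (\sum_j `|al 0 j| * K) ^+ 2.
  move=> fK al m n x; rewrite -[leLHS]real_normK ?num_real// ler_sqr ?nnegrE//; last first.
    by apply: sumr_ge0 => j _; rewrite mulr_ge0// (le_trans _ (fK j m n x)).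
  apply: le_trans (ler_norm_sum _ _ _) _; apply: ler_sum => j _.
  by rewrite normrM ler_wpM2l.
pose L := \sum_(be <- net) 2 * (\sum_j `|(be *m E) 0 j| * K) ^+ 2.
have HL be m n x : be \in net -> H (be *m E) m n x <= L.
  move=> ben; apply: (@le_trans _ _ (2 * (\sum_j `|(be *m E) 0 j| * K) ^+ 2)).
    rewrite mulr_natl mulr2n; apply: lerD; apply: Ebd => j m' n' x'.
      exact: (abK j m' n' x').1.
    exact: (abK j m' n' x').2.
  rewrite /L (big_rem be)//= lerDl; apply: sumr_ge0 => i _.
  by rewrite mulr_ge0// sqr_ge0.
have L0 : 0 <= L by apply: sumr_ge0 => i _; rewrite mulr_ge0// sqr_ge0.
(* 32 is the product of the factor [4 = 2 ^ 2] lost by a net of precision [1 / 2],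
   of 2 for the real and imaginary parts, and of the level [4 / c] *)
pose A be m n := [set x | 4 / c < H (be *m E) m n x].
have mA be m n : measurable (A be m n).
  by apply: measurable_superlevel; exact: (bH _ _ _).1.
have Qle m n x : Q m n x <= 32 / c + \sum_(be <- net) 8 * L * \1_(A be m n) x.
  have [be ben h] := Qnet m n x.
  have nn : 0 <= \sum_(be <- net) 8 * L * \1_(A be m n) x.
    by apply: sumr_ge0 => i _; rewrite !mulr_ge0// indicE.
  have c4 : 0 <= 32 / c by rewrite divr_ge0// ltW.
  apply: (le_trans h).
  have [xA|xA] := boolP (x \in A be m n); last first.
    apply: (@le_trans _ _ (32 / c)); last by rewrite lerDl.
    have : H (be *m E) m n x <= 4 / c.
      by rewrite leNgt; apply: contra xA => xA; exact: mem_set.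
    lra.
  apply: (@le_trans _ _ (\sum_(be <- net) 8 * L * \1_(A be m n) x)); last by rewrite lerDr.
  rewrite (big_rem be)//= indicE xA mulr1; apply: (@le_trans _ _ (8 * L)).
    by rewrite ler_wpM2l// HL.
  by rewrite lerDl; apply: sumr_ge0 => i _; rewrite !mulr_ge0.
suff : D%:R <= 32 / c * fine (mu setT).
  by rewrite mulrAC ler_pdivlMr.
apply/ler_addgt0Pl => e e0; apply: (dlim_le QD) => m.
pose e' := e / ((8 * L + 1) * (size net).+1%:R).
have e'0 : 0 < e' by rewrite divr_gt0// mulr_gt0// ltr_wpDl// mulr_ge0.
have : U [set n | forall be, be \in net -> (mu (A be m n) <= e'%:E)%E].
  have : forall be, be \in net -> U [set n | (mu (A be m n) <= e'%:E)%E].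
    by move=> be ben; exact: small.
  elim: (net) => [_|be s IH h].
    by apply: filterS (@filterT _ U _) => n _ be; rewrite in_nil.
  have h1 := h be (mem_head _ _).
  have h2 : U [set n | forall be, be \in s -> (mu (A be m n) <= e'%:E)%E].
    by apply: IH => be' be's; apply: h; rewrite inE be's orbT.
  apply: filterS (filterI h1 h2) => n /= [n1 n2] be'.
  by rewrite inE => /orP[/eqP ->//|]; exact: n2.
apply: filterS => n /= hn.
have bind be : bmeasurable (fun x => 8 * L * \1_(A be m n) x).
  by apply: bmeasurableZ; exact: bmeasurable_indic.
apply: (@le_trans _ _ (I (fun x => 32 / c + \sum_(be <- net) 8 * L * \1_(A be m n) x))).
  apply: le_Rintegral_bm => //; apply: bmeasurableD; first exact: bmeasurable_cst.
  exact: bmeasurable_sum.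
rewrite RintegralD//; first last.
- by apply: bmeasurable_integrable; exact: bmeasurable_sum.
- by apply: bmeasurable_integrable; exact: bmeasurable_cst.
rewrite Rintegral_cst// addrC; apply: lerD => //.
rewrite Rintegral_sum// big_seq.
apply: (@le_trans _ _ (\sum_(be <- net) 8 * L * e')).
  rewrite [leRHS]big_seq; apply: ler_sum => be /hn h.
  rewrite RintegralZl//; last by apply: bmeasurable_integrable; exact: bmeasurable_indic.
  rewrite Rintegral_indic// ler_wpM2l ?mulr_ge0//.
  by rewrite -lee_fin fineK// fin_num_measure.
rewrite big_const_seq iter_addr_0 count_predT -[_ *+ size net]mulr_natl.
rewrite (_ : _ * _ = e * ((size net)%:R * (8 * L) / ((8 * L + 1) * (size net).+1%:R))).
  rewrite ger_pMr// ler_pdivrMr ?mul1r; last by rewrite mulr_gt0// ltr_wpDl// mulr_ge0.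
  by rewrite mulrC ler_pM ?mulr_ge0// ?ler_nat// lerDl.
by rewrite /e'; ring.
Qed.
End dimension_bound.

(** * Almost everywhere calculus in complex L^p *)

Section complex_Lp_basics.
Context d (Om : measurableType d) (R : realType).
Variable mu : {finite_measure set Om -> \bar R}.
Variables (p : R) (p1 : 1 <= p).
Local Notation X := (cLspace mu p1).
Local Notation N := (@rnorm R X).
Implicit Types (f g : Om -> R[i]) (F G H : X).

Lemma p_gt0 : 0 < p. Proof. exact: lt_le_trans p1. Qed.
Let p0 := p_gt0.

Lemma Lnorm_fine F : (N F)%:E = cLnorm mu p F.
Proof. by rewrite -cLspace_fineK. Qed.

Lemma cLnorm_powR f : cmeasurable f ->
  (cLnorm mu p f `^ p = \int[mu]_x ((normc (f x)) `^ p)%:E)%E.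
Proof.
move=> mf; rewrite /cLnorm powR_Lnorm ?gt_eqF//; apply: eq_integral => x _.
by rewrite abse_EFin poweR_EFin ger0_norm ?Defs.normc_ge0.
Qed.

Lemma rnorm_powR F : ((N F) `^ p)%:E = (\int[mu]_x ((normc (F x)) `^ p)%:E)%E.
Proof. by rewrite -cLnorm_powR ?poweR_EFin -?Lnorm_fine//; exact: cLspace_meas. Qed.

Lemma measurable_normc_powR (r : R) f : cmeasurable f ->
  measurable_fun setT (fun x => ((normc (f x)) `^ r)%:E).
Proof.
move=> mf; apply/measurable_EFinP; apply: (measurableT_comp (measurable_powR _)).
exact: measurable_normc.
Qed.

Lemma normc_powR_le (r : R) (z w : R[i]) : 0 <= r -> normc z <= normc w ->
  normc z `^ r <= normc w `^ r.
Proof. by move=> r0 zw; rewrite ge0_ler_powR ?nnegrE ?Defs.normc_ge0. Qed.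

Lemma le_cLnorm f g : cmeasurable f -> cmeasurable g ->
  {ae mu, forall x, normc (f x) <= normc (g x)} -> (cLnorm mu p f <= cLnorm mu p g)%E.
Proof.
move=> mf mg fg.
have le_pow : (cLnorm mu p f `^ p <= cLnorm mu p g `^ p)%E.
  rewrite !cLnorm_powR//; apply: ae_ge0_le_integral => //.
  - by move=> x _; rewrite lee_fin powR_ge0.
  - exact: measurable_normc_powR.
  - by move=> x _; rewrite lee_fin powR_ge0.
  - exact: measurable_normc_powR.
  by apply: filterS fg => x fgx _; rewrite lee_fin normc_powR_le// ltW.
have inv h : (cLnorm mu p h = (cLnorm mu p h `^ p) `^ p^-1)%E.
  by rewrite -poweRrM mulfV ?gt_eqF// poweRe1// cLnorm_ge0.
rewrite (inv f) (inv g); apply: gt0_ler_poweR => //.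
- by rewrite invr_ge0 ltW.
- by rewrite in_itv/= leey andbT poweR_ge0.
- by rewrite in_itv/= leey andbT poweR_ge0.
Qed.

Lemma le_rnorm F G : {ae mu, forall x, normc (F x) <= normc (G x)} -> N F <= N G.
Proof.
move=> FG; rewrite -lee_fin !Lnorm_fine.
by apply: le_cLnorm => //; exact: cLspace_meas.
Qed.

Lemma cLfun_dominated f G : cmeasurable f ->
  {ae mu, forall x, normc (f x) <= normc (G x)} -> f \in cLfun mu p.
Proof.
move=> mf fG; apply/cLfunP; split => //.
apply: (le_lt_trans (le_cLnorm mf (cLspace_meas G) fG)).
by rewrite -Lnorm_fine ltry.
Qed.

(** Total, with junk value [0] outside [cLfun mu p], so that a class can be
    written down before its membership is proved. *)
Definition Lclass f : X :=
  match pselect (f \in cLfun mu p) with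
  | left H => cLclass (CLfun (H : f \in cLfun_pred mu p1))
  | right _ => 0
  end.

Lemma LclassE f : f \in cLfun mu p -> {ae mu, forall x, Lclass f x = f x}.
Proof.
move=> fL; rewrite /Lclass; case: pselect => // H.
exact: (cLclass_funE (CLfun (H : f \in cLfun_pred mu p1))).
Qed.

Lemma Lclass_ae f G : cmeasurable f ->
  {ae mu, forall x, normc (f x) <= normc (G x)} -> {ae mu, forall x, Lclass f x = f x}.
Proof. by move=> mf fG; apply: LclassE; exact: cLfun_dominated fG. Qed.

Lemma ae_eqL F G : {ae mu, forall x, F x = G x} -> F = G.
Proof. by move=> FG; apply/cLspace_eqP. Qed.

Lemma ae0 : {ae mu, forall x, (0 : X) x = 0}.
Proof.
have := @cLclass_funE _ Om R mu p p1 0.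
suff -> : cLclass (0 : cLfunType mu p1) = 0 by [].
by apply: (addrI (cLclass 0)); rewrite addr0 -cLclassD addr0.
Qed.

Lemma aeD F G : {ae mu, forall x, (F + G : X) x = F x + G x}.
Proof. exact: cLspaceDE. Qed.

Lemma aeZ (a : R[i]) F : {ae mu, forall x, (a *: F : X) x = a * F x}.
Proof. exact: cLspaceZE. Qed.

Lemma aeB F G : {ae mu, forall x, (F - G : X) x = F x - G x}.
Proof.
rewrite -scaleN1r; apply: filterS2 (aeD F (-1 *: G)) (aeZ (-1) G) => x -> ->.
by rewrite mulN1r.
Qed.

Lemma ae_all_seq (J : eqType) (s : seq J) (P : J -> Om -> Prop) :
  (forall i, i \in s -> {ae mu, forall x, P i x}) ->
  {ae mu, forall x, forall i, i \in s -> P i x}.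
Proof.
elim: s => [_|j s IH h]; first by apply: nearW => x i; rewrite in_nil.
have h1 := h j (mem_head _ _).
have h2 : {ae mu, forall x, forall i, i \in s -> P i x}.
  by apply: IH => i si; apply: h; rewrite inE si orbT.
apply: filterS2 h1 h2 => x x1 x2 i; rewrite inE => /orP[/eqP ->//|]; exact: x2.
Qed.

Lemma ae_all_ord n (P : 'I_n -> Om -> Prop) :
  (forall i, {ae mu, forall x, P i x}) -> {ae mu, forall x, forall i, P i x}.
Proof.
move=> h; have := @ae_all_seq _ (enum 'I_n) P (fun i _ => h i).
by apply: filterS => x hx i; apply: hx; rewrite mem_enum.
Qed.

Lemma ae_sum n (F : 'I_n -> X) :
  {ae mu, forall x, (\sum_i F i : X) x = \sum_i F i x}.
Proof.
elim: n F => [|n IH] F.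
  by rewrite big_ord0; apply: filterS ae0 => x ->; rewrite big_ord0.
rewrite big_ord_recr /=; set S := \sum_(i < n) _.
apply: filterS2 (aeD S (F ord_max)) (IH (fun i => F (widen_ord (leqnSn n) i))) => x -> ->.
by rewrite big_ord_recr.
Qed.

Lemma cmeasurable_real (f : Om -> R) : measurable_fun setT f ->
  cmeasurable (fun x => (f x)%:C).
Proof. by move=> mf; split => //=; exact: measurable_cst. Qed.

Definition Labs F : X := Lclass (fun x => (normc (F x))%:C).

Lemma LabsE F : {ae mu, forall x, Labs F x = (normc (F x))%:C}.
Proof.
apply: (@Lclass_ae _ F).
  by apply: cmeasurable_real; apply: measurable_normc; exact: cLspace_meas.
by apply: nearW => x; rewrite normcR_ge0 ?Defs.normc_ge0.
Qed.

Lemma rnorm_Labs F : N (Labs F) = N F.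
Proof.
by apply/eqP; rewrite eq_le; apply/andP; split; apply: le_rnorm;
   apply: filterS (LabsE F) => x ->; rewrite normcR_ge0 ?Defs.normc_ge0.
Qed.

Definition Lrestr (A : set Om) F : X := Lclass (fun x => (\1_A x)%:C * F x).

Lemma LrestrE A F : measurable A ->
  {ae mu, forall x, Lrestr A F x = (\1_A x)%:C * F x}.
Proof.
move=> mA; have [mr mi] := cLspace_meas F.
have mI : measurable_fun setT (\1_A : Om -> R) by exact: measurable_indic.
apply: (@Lclass_ae _ F); first split.
- rewrite (_ : (fun x => _) = (fun x => \1_A x * complex.Re (F x))).
    exact: measurable_funM.
  by apply/funext => x; case: (F x) => a b; simpc.
- rewrite (_ : (fun x => _) = (fun x => \1_A x * complex.Im (F x))).
    exact: measurable_funM.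
  by apply/funext => x; case: (F x) => a b; simpc.
apply: nearW => x; rewrite normcM normcR indicE.
by case: (_ \in _); rewrite ?normr1 ?mul1r// normr0 mul0r Defs.normc_ge0.
Qed.

(** Pointwise, the positive part of [Re F] is the nearest element of the cone,
    so its distance to [F] is at most that of every [G]. *)
Lemma closed_cone F :
  (forall e : R, 0 < e -> exists2 G : X, {ae mu, forall x, 0 <= G x} & N (F - G) <= e) ->
  {ae mu, forall x, 0 <= F x}.
Proof.
move=> Fcl; pose e x : R[i] := F x - (Num.max (complex.Re (F x)) 0)%:C.
have [mr mi] := cLspace_meas F.
have me : cmeasurable e.
  split.
    rewrite (_ : (fun x => _) = (fun x => complex.Re (F x) - Num.max (complex.Re (F x)) 0)).
      by apply: measurable_funB => //; apply: measurable_maxr => //; exact: measurable_cst.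
    by apply/funext => x; rewrite /e; case: (F x).
  rewrite (_ : (fun x => _) = (fun x => complex.Im (F x)))//.
  by apply/funext => x; rewrite /e; case: (F x) => a b; rewrite /= subr0.
have dist (z g : R[i]) : 0 <= g -> normc (z - (Num.max (complex.Re z) 0)%:C) <= normc (z - g).
  case: z g => a b [c c']; rewrite lecE /= => /andP[/eqP -> c0].
  rewrite !subr0 ler_sqrt ?addr_ge0 ?sqr_ge0// lerD2r.
  have [a0|a0] := leP a 0.
    rewrite subr0 -[leLHS]sqrrN -[leRHS]sqrrN ler_sqr ?nnegrE ?opprB ?oppr_ge0//.
      by rewrite lerDr.
    by rewrite subr_ge0 (le_trans a0).
  by rewrite subrr expr0n/= sqr_ge0.
have eF : {ae mu, forall x, normc (e x) <= normc (F x)}.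
  by apply: nearW => x; rewrite -[in leRHS](subr0 (F x)); exact: dist.
have eE := Lclass_ae me eF.
have : Lclass e = 0.
  apply: (@rnorm_le0 R X); apply/ler_addgt0Pl => eps eps0; rewrite addr0.
  have [G G0 FG] := Fcl _ eps0; apply: le_trans FG; apply: le_rnorm.
  by apply: filterS3 eE G0 (aeB F G) => x -> G0x ->; exact: dist.
move=> e0; rewrite e0 in eE; apply: filterS2 eE ae0 => x -> /eqP.
rewrite /e subr_eq0 => /eqP ->; rewrite lecR le_max lexx orbT//.
Qed.

End complex_Lp_basics.

(** * Completeness of L^p *)

Section Lp_complete.
Context d (Om : measurableType d) (R : realType).
Variable mu : {finite_measure set Om -> \bar R}.
Variables (p : R) (p1 : 1 <= p).
Local Notation X := (cLspace mu p1).
Local Notation N := (@rnorm R X).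
Let p0 : 0 < p := p_gt0 p1.

Let psum (u : nat -> X) m x : R := \sum_(i < m) normc (u i x).

Lemma measurable_psum (u : nat -> X) m : measurable_fun setT (psum u m).
Proof.
apply: measurable_sum => i; apply: measurable_normc; exact: cLspace_meas.
Qed.

Lemma psum_ge0 (u : nat -> X) m x : 0 <= psum u m x.
Proof. by apply: sumr_ge0 => i _; exact: Defs.normc_ge0. Qed.

Lemma nondecreasing_psum (u : nat -> X) x : {homo (psum u)^~ x : m n / (m <= n)%N >-> m <= n}.
Proof.
move=> m n mn; rewrite /psum -(subnK mn) addnC big_split_ord /= lerDl.
by apply: sumr_ge0 => i _; exact: Defs.normc_ge0.
Qed.

Lemma integral_psum (u : nat -> X) m :
  (\int[mu]_x ((psum u m x) `^ p)%:E <= ((\sum_(i < m) N (u i)) `^ p)%:E)%E.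
Proof.
pose G : X := \sum_(i < m) Labs (u i).
have GE : {ae mu, forall x, G x = (psum u m x)%:C}.
  have h : {ae mu, forall x, forall i, Labs (u i) x = (normc (u i x))%:C}.
    by apply: ae_foralln => i; exact: LabsE.
  apply: filterS2 (ae_sum (fun i : 'I_m => Labs (u i))) h => x -> hx.
  by rewrite /psum rmorph_sum; apply: eq_bigr => i _; rewrite hx.
have NG : N G <= \sum_(i < m) N (u i).
  apply: le_trans (rnorm_sum _) _; apply: ler_sum => i _; by rewrite rnorm_Labs.
rewrite (_ : (\int[mu]_x _)%E = (\int[mu]_x ((normc (G x)) `^ p)%:E)%E).
  by rewrite -rnorm_powR lee_fin ge0_ler_powR ?nnegrE ?rnorm_ge0 ?sumr_ge0// ?(ltW p0)//;
     move=> *; exact: rnorm_ge0.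
apply: ge0_ae_eq_integral => //.
- apply/measurable_EFinP; apply: (measurableT_comp (measurable_powR _)).
  exact: measurable_psum.
- by apply: measurable_normc_powR; exact: cLspace_meas.
- by move=> x _; rewrite lee_fin powR_ge0.
- by move=> x _; rewrite lee_fin powR_ge0.
by apply: filterS GE => x -> _; rewrite normcR_ge0 ?psum_ge0.
Qed.

(** The supremum of the [p]-th powers of the partial sums. It may be infinite on
    a null set, hence its values in the extended reals. *)
Lemma psum_majorant (u : nat -> X) C : (forall m, \sum_(i < m) N (u i) <= C) ->
  exists L : Om -> \bar R, [/\ measurable_fun setT L, forall x, (0 <= L x)%E,
    (\int[mu]_x L x <= (C `^ p)%:E)%E &
    forall m x, (((psum u m x) `^ p)%:E <= L x)%E].
Proof.
move=> uC; pose h m x : \bar R := ((psum u m x) `^ p)%:E.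
have mh m : measurable_fun setT (h m).
  apply/measurable_EFinP; apply: (measurableT_comp (measurable_powR _)).
  exact: measurable_psum.
have h0 m x : (0 <= h m x)%E by rewrite lee_fin powR_ge0.
have ndh x : {homo h^~ x : m n / (m <= n)%N >-> (m <= n)%E}.
  move=> m n mn; rewrite lee_fin ge0_ler_powR ?nnegrE ?psum_ge0// ?(ltW p0)//.
  exact: nondecreasing_psum.
have cvh x : cvgn (h^~ x) by apply: ereal_nondecreasing_is_cvgn; exact: ndh.
exists (fun x => limn (h^~ x)); split.
- by apply: (emeasurable_fun_cvg _ _ mh) => x _; exact: cvh.
- by move=> x; apply: lime_ge => //; exact: nearW.
- rewrite monotone_convergence//.
  apply: lime_le.
    apply: ereal_nondecreasing_is_cvgn => m n mn; apply: ge0_le_integral => //.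
    by move=> x _; exact: ndh.
  apply: nearW => m; apply: le_trans (integral_psum u m) _.
  have s0 : 0 <= \sum_(i < m) N (u i) by apply: sumr_ge0 => i _; exact: rnorm_ge0.
  rewrite lee_fin; apply: ge0_ler_powR; rewrite ?nnegrE ?(ltW p0)//.
  exact: le_trans (uC m).
- move=> m x; apply: lime_ge => //; exists m => // n /=; exact: ndh.
Qed.

(** Used both for the sum of the series and for its tails: dominating [f] by
    every bound of the partial sums avoids their limit. *)
Lemma cLnorm_psum (u : nat -> X) C (f : Om -> R[i]) :
  (forall m, \sum_(i < m) N (u i) <= C) -> cmeasurable f ->
  {ae mu, forall x, forall c, (forall m, psum u m x <= c) -> normc (f x) <= c} ->
  (cLnorm mu p f <= C%:E)%E.
Proof.
move=> uC mf fu; have [L [mL L0 LC hL]] := psum_majorant uC.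
have C0 : 0 <= C by have := uC 0%N; rewrite big_ord0.
have : (cLnorm mu p f `^ p <= C%:E `^ p)%E.
  rewrite cLnorm_powR// poweR_EFin; apply: le_trans LC.
  apply: ae_ge0_le_integral => //.
  - by move=> x _; rewrite lee_fin powR_ge0.
  - exact: measurable_normc_powR.
  apply: filterS fu => x fx _.
  have [Lfin|] := boolP (L x \is a fin_num); last first.
    by rewrite ge0_fin_numE// -leNgt leye_eq => /eqP ->; rewrite leey.
  have l0 : 0 <= fine (L x) by rewrite fine_ge0.
  rewrite -(fineK Lfin) lee_fin.
  have -> : fine (L x) = (fine (L x) `^ p^-1) `^ p.
    by rewrite -powRrM mulVf ?gt_eqF// powRr1.
  rewrite ge0_ler_powR ?nnegrE ?Defs.normc_ge0 ?powR_ge0// ?(ltW p0)//.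
  apply: fx => m.
  have -> : psum u m x = (psum u m x `^ p) `^ p^-1.
    by rewrite -powRrM mulfV ?gt_eqF// powRr1// psum_ge0.
  rewrite ge0_ler_powR ?nnegrE ?invr_ge0 ?powR_ge0// ?(ltW p0)//.
  by rewrite -lee_fin fineK.
move=> h; have inv (z : \bar R) : (0 <= z -> z = (z `^ p) `^ p^-1)%E.
  by move=> z0; rewrite -poweRrM mulfV ?gt_eqF// poweRe1.
rewrite (inv (cLnorm mu p f)) ?cLnorm_ge0// (inv C%:E) ?lee_fin//.
apply: gt0_ler_poweR => //.
- by rewrite invr_ge0 ltW.
- by rewrite in_itv/= leey andbT poweR_ge0.
- by rewrite in_itv/= leey andbT lee_fin powR_ge0.
Qed.

(** Riesz and Fischer: an absolutely convergent series converges pointwise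
    almost everywhere, and its tails are controlled by monotone convergence. *)
Lemma Lp_abs_complete : abs_complete X.
Proof.
(* the same statement, with vectors typed so that they act as functions *)
suff : forall u : nat -> X, (exists M, forall n, \sum_(i < n) N (u i) <= M) ->
    exists l : X, forall e : R, 0 < e -> exists n0, forall n, (n0 <= n)%N ->
      N (l - \sum_(i < n) u i) <= e by [].
move=> u [M uM].
have [L [mL L0 LM hL]] := psum_majorant uM.
have : {ae mu, forall x, setT x -> L x \is a fin_num}.
  apply: integrable_ae => //; apply/integrableP; split => //.
  apply: (@le_lt_trans _ _ (M `^ p)%:E); last by rewrite ltry.
  by apply: le_trans LM; under eq_integral do rewrite gee0_abs//.
move=> [A [mA muA subA]].
pose E := ~` A.
have mE : measurable E by exact: measurableC.
have EL x : E x -> exists K, forall m, psum u m x <= K.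
  move=> Ex; have Lfin : L x \is a fin_num.
    by apply: contrapT => nL; apply: Ex; apply: subA => /(_ I).
  exists (fine (L x) `^ p^-1) => m.
  have -> : psum u m x = (psum u m x `^ p) `^ p^-1.
    by rewrite -powRrM mulfV ?gt_eqF// powRr1// psum_ge0.
  rewrite ge0_ler_powR ?nnegrE ?invr_ge0 ?powR_ge0 ?fine_ge0// ?(ltW p0)//.
  by rewrite -lee_fin fineK.
have aeE : {ae mu, forall x, E x}.
  by exists A; split => // x /=; rewrite /E /= notK.
(* [c] is the real or the imaginary part; the factor [\1_E] makes the limit
   measurable on the whole space *)
have comp (c : R[i] -> R) : (forall z, `|c z| <= normc z) ->
    (forall i, measurable_fun setT (fun x : Om => c (u i x))) ->
    exists2 f : Om -> R, measurable_fun setT f &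
      forall x, E x -> (fun m => \sum_(i < m) c (u i x)) @ \oo --> f x.
  move=> cle mc; pose v i x := \1_E x * c (u i x).
  have cvv x : cvgn (series (v^~ x)).
    apply: normed_cvg; apply: nondecreasing_is_cvgn.
      move=> m n mn; rewrite /= seriesEord /= -(subnK mn) addnC big_split_ord /= lerDl.
      by apply: sumr_ge0 => i _.
    have [xE|xE] := boolP (x \in E); last first.
      exists 0 => _ [m _ <-]; rewrite /= seriesEord /= big1// => i _.
      by rewrite /v indicE (negbTE xE) mul0r normr0.
    have [K hK] := EL x (set_mem xE).
    exists K => _ [m _ <-]; rewrite /=; apply: le_trans (hK m); rewrite /= seriesEord /=.
    by apply: ler_sum => i _; rewrite /v indicE xE mul1r.
  exists (fun x => limn (series (v^~ x))).
    apply: (measurable_fun_cvg (h := fun m x => series (v^~ x) m)) => [m|x _].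
      rewrite (_ : (fun x => _) = (fun x => \sum_(i < m) v i x)); last first.
        by apply/funext => x; rewrite seriesEord.
      apply: measurable_sum => i.
      by apply: measurable_funM => //; exact: measurable_indic.
    exact: cvv.
  move=> x Ex; have := cvv x.
  rewrite (_ : (fun m => \sum_(i < m) c (u i x)) = series (v^~ x))//.
  apply/funext => m; rewrite /= seriesEord /=; apply: eq_bigr => i _.
  by rewrite /v indicE mem_set// mul1r.
have [fr mfr frP] := comp (@complex.Re R) (@Re_le_normc R) (fun i => (cLspace_meas (u i)).1).
have [fi mfi fiP] := comp (@complex.Im R) (@Im_le_normc R) (fun i => (cLspace_meas (u i)).2).
pose f x := fr x +i* fi x.
have mf : cmeasurable f by [].
have fP x : E x -> forall e, 0 < e -> \forall m \near \oo,
    normc (f x - \sum_(i < m) u i x) <= e.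
  move=> Ex e e0; have e2 : 0 < e / 2 by rewrite divr_gt0.
  have /cvgrPdist_le/(_ _ e2) h1 := frP x Ex; have /cvgrPdist_le/(_ _ e2) h2 := fiP x Ex.
  near=> m.
  rewrite [_ - _]normc_ReIm; apply: le_trans (le_normcD _ _) _.
  rewrite normcM !normcR (_ : normc 'i = 1) ?mul1r; last by rewrite /= expr0n add0r expr1n sqrtr1.
  rewrite ReB ImB Re_sum Im_sum /= (splitr e).
  by apply: lerD; near: m.
have tail n C : (forall m, \sum_(i < m) N (u (n + i)%N) <= C) ->
    (cLnorm mu p (fun x => (f x - (\sum_(i < n) u i : X) x)%R) <= C%:E)%E.
  move=> hC; apply: (@cLnorm_psum (fun i => u (n + i)%N)) => //.
    exact: (cmeasurableB mf (cLspace_meas _)).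
  apply: filterS2 aeE (ae_sum (fun i : 'I_n => u i)) => x Ex -> c hc.
  apply/ler_addgt0Pl => e e0.
  have [m0 _ hm0] := fP x Ex e e0.
  have {}hm0 := hm0 (n + m0)%N (leq_addl _ _).
  rewrite /= big_split_ord /= in hm0.
  set s := \sum_(i < n) u i x in hm0 *.
  set t := \sum_(i < m0) u (n + i)%N x in hm0.
  rewrite (_ : f x - s = (f x - (s + t)) + t); last by ring.
  apply: le_trans (le_normcD _ _) _; apply: lerD => //.
  apply: le_trans (hc m0); rewrite /t /psum.
  exact: normc_sum.
have fL : f \in cLfun mu p.
  apply/cLfunP; split => //; apply: (@le_lt_trans _ _ M%:E); last by rewrite ltry.
  apply: cLnorm_psum uM mf _; apply: filterS aeE => x Ex c hc.
  apply/ler_addgt0Pl => e e0; have [m0 _ hm0] := fP x Ex e e0.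
  rewrite -[f x](subrK (\sum_(i < m0) u i x)).
  apply: le_trans (le_normcD _ _) _; apply: lerD; first exact: (hm0 m0 (leqnn m0)).
  apply: le_trans (hc m0); rewrite /psum.
  exact: normc_sum.
exists (Lclass mu p1 f) => e e0.
pose s n := \sum_(i < n) N (u i).
have bs : has_sup (range s).
  by split; [exists (s 0%N); exists 0%N|exists M => _ [n _ <-]; exact: uM].
have [_ [n0 _ <-] hn0] := sup_adherent e0 bs.
have nds m n : (m <= n)%N -> s m <= s n.
  move=> mn; rewrite /s -(subnK mn) addnC big_split_ord /= lerDl.
  by apply: sumr_ge0 => i _; exact: rnorm_ge0.
exists n0 => n n0n; rewrite -lee_fin Lnorm_fine.
apply: (@le_trans _ _ (cLnorm mu p (fun x => (f x - (\sum_(i < n) u i : X) x)%R))).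
  apply: (le_cLnorm p1); [exact: cLspace_meas| |].
    exact: (cmeasurableB mf (cLspace_meas _)).
  by apply: filterS2 (aeB (Lclass mu p1 f) (\sum_(i < n) u i)) (LclassE p1 fL) => x -> ->.
apply: tail => m.
have -> : \sum_(i < m) N (u (n + i)%N) = s (n + m)%N - s n.
  by rewrite /s big_split_ord /= addrAC subrr add0r.
have := ub_le_sup bs.2 (ex_intro2 _ _ (n + m)%N I erefl).
have := nds _ _ n0n; lra.
Unshelve. all: by end_near.
Qed.
End Lp_complete.

(** * Norming functionals on L^p *)

Section real_part_of_functional.
Context (R : realType) (V : normedModType R[i]).
Local Notation N := (@rnorm R V).

(** A real functional is the real part of exactly one complex functional, and
    rotating the argument shows that both have the same norm. *)
Lemma complex_functional (psi : V -> R) y :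
  (forall x z, psi (x + z) = psi x + psi z) ->
  (forall (r : R) x, psi (r%:C *: x) = r * psi x) ->
  (forall x, psi x <= N x) -> psi y = N y -> psi ('i *: y) = 0 ->
  exists2 f, bfunctional f & (forall x, normc (f x) <= N x) /\ f y = (N y)%:C.
Proof.
move=> psiD psiZ psile psiy psiiy.
pose f x : R[i] := psi x +i* (- psi ('i *: x)).
have fZ (a : R[i]) x : f (a *: x) = a * f x.
  have E (r s : R) z : psi ((r +i* s) *: z) = r * psi z + s * psi ('i *: z).
    rewrite -!psiZ -psiD scalerA -scalerDl; congr (psi (_ *: _)).
    by simpc.
  have Ei (r s : R) z : psi ('i *: ((r +i* s) *: z)) = r * psi ('i *: z) - s * psi z.
    rewrite scalerA (_ : 'i * (r +i* s) = (- s) +i* r); last by simpc.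
    by rewrite E addrC mulNr.
  case: a => r s; rewrite /f (E r s x) (Ei r s x); simpc.
  by apply/eqP; rewrite eq_complex /=; apply/andP; split; apply/eqP; ring.
have fD x z : f (x + z) = f x + f z.
  rewrite /f scalerDr !psiD.
  by apply/eqP; rewrite eq_complex /=; apply/andP; split; apply/eqP; ring.
have fle x : normc (f x) <= N x.
  have [/eqP/eq0_normc f0|f0] := boolP (normc (f x) == 0).
    by rewrite f0 normc0 rnorm_ge0.
  have n0 : 0 < normc (f x) by rewrite lt_def f0 Defs.normc_ge0.
  pose a : R[i] := ((normc (f x))^-1)%:C * (complex.Re (f x) -i* complex.Im (f x)).
  have na : normc a = 1.
    rewrite normcM normcR_ge0 ?invr_ge0 ?Defs.normc_ge0//.
    rewrite (_ : normc (_ -i* _) = normc (f x)) ?mulVf//.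
    by case: (f x) => b c /=; rewrite sqrrN.
  have af : a * f x = (normc (f x))%:C.
    rewrite /a -mulrA (_ : (_ -i* _) * f x = ((normc (f x)) ^+ 2)%:C).
      by rewrite -rmorphM /= expr2 mulrA mulVf ?mul1r.
    case: (f x) => b c /=; rewrite sqr_sqrtr ?addr_ge0 ?sqr_ge0//; simpc.
    by congr (_ +i* _); ring.
  have := psile (a *: x); rewrite rnormZ na mul1r; apply: le_trans.
  by have := congr1 (@complex.Re R) (fZ a x); rewrite af /= => ->.
exists f; last split=> //.
- split=> [a x z|]; first by rewrite fD fZ.
  by exists 1 => // x; rewrite mul1r.
- by rewrite /f psiy psiiy oppr0.
Qed.
End real_part_of_functional.

Section Lp_duality.
Context d (Om : measurableType d) (R : realType).
Variable mu : {finite_measure set Om -> \bar R}.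
Variables (p : R) (p1 : 1 < p).
Local Notation X := (cLspace mu (ltW p1)).
Local Notation N := (@rnorm R X).
Let p0 : 0 < p := lt_trans ltr01 p1.

Section pairing.
Variable y : X.
Hypothesis y0 : 0 < N y.

Let g x : R := normc (y x) `^ (p - 2).
(* real part of [f conj(y) |y|^(p - 2)] *)
Let K (f : Om -> R[i]) x : R :=
  complex.Re (f x) * (complex.Re (y x) * g x) + complex.Im (f x) * (complex.Im (y x) * g x).

Let mK f : cmeasurable f -> measurable_fun setT (K f).
Proof.
move=> [fr fi]; have [yr yi] := cLspace_meas y.
have mg : measurable_fun setT g.
  apply: (measurableT_comp (measurable_powR _)).
  by apply: measurable_normc; exact: cLspace_meas.
by apply: measurable_funD; apply: measurable_funM => //; exact: measurable_funM.
Qed.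

Let gE x : normc (y x) * g x = normc (y x) `^ (p - 1).
Proof.
have [n0|n0] := eqVneq (normc (y x)) 0.
  by rewrite n0 mul0r powR0// subr_eq0 gt_eqF.
rewrite /g -{1}(powRr1 (Defs.normc_ge0 (y x))) -powRD; first by congr (_ `^ _); ring.
by rewrite n0 implybT.
Qed.

Let Kle f x : `|K f x| <= normc (f x) * normc (y x) `^ (p - 1).
Proof.
rewrite -gE mulrA /K.
rewrite (_ : _ + _ = (complex.Re (f x) * complex.Re (y x) + complex.Im (f x) * complex.Im (y x)) * g x);
  last by ring.
rewrite normrM [`|g x|]ger0_norm ?powR_ge0// ler_wpM2r ?powR_ge0//.
rewrite -normcM.
have -> : normc (f x * y x) = normc (f x * (complex.Re (y x) -i* complex.Im (y x))).
  by rewrite !normcM; congr (_ * _); case: (y x) => b c /=; rewrite sqrrN.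
apply: le_trans (Re_le_normc _).
by rewrite le_eqVlt; apply/orP; left; apply/eqP; case: (f x) (y x) => a b [c c']; simpc.
Qed.

Let hoelder_bound (x : X) :
  (\int[mu]_t (`|K x t|)%:E <= (N x * N y `^ (p - 1))%:E)%E.
Proof.
pose q := p / (p - 1).
have p10 : 0 < p - 1 by rewrite subr_gt0.
have q0 : 0 < q by rewrite divr_gt0.
have pq : p^-1 + q^-1 = 1 by rewrite /q; field; rewrite !gt_eqF.
have mx : measurable_fun setT (fun t => normc (x t)).
  by apply: measurable_normc; exact: cLspace_meas.
have my : measurable_fun setT (fun t => normc (y t) `^ (p - 1)).
  apply: (measurableT_comp (measurable_powR _)).
  by apply: measurable_normc; exact: cLspace_meas.
have := hoelder mu mx my p0 q0 pq.
have -> : Lnorm mu p%:E (EFin \o (fun t => normc (x t))) = (N x)%:E.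
  by rewrite Lnorm_fine.
have -> : Lnorm mu q%:E (EFin \o (fun t => normc (y t) `^ (p - 1))) = (N y `^ (p - 1))%:E.
  rewrite unlock /=.
  rewrite (_ : (\int[mu]_x0 _)%E = (\int[mu]_t ((normc (y t)) `^ p)%:E)%E).
    rewrite -rnorm_powR poweR_EFin -powRrM; congr (_ `^ _)%:E.
    by rewrite /q; field; rewrite !gt_eqF.
  apply: eq_integral => t _; rewrite ger0_norm ?powR_ge0// -powRrM; congr (_ `^ _)%:E.
  by rewrite /q; field; rewrite !gt_eqF.
rewrite Lnorm1 -EFinM; apply: le_trans.
apply: ge0_le_integral => //.
- apply/measurable_EFinP; apply: measurableT_comp => //; apply: mK; exact: cLspace_meas.
- apply: measurableT_comp => //; apply/measurable_EFinP; exact: measurable_funM.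
by move=> t _ /=; rewrite lee_fin [leRHS]ger0_norm ?mulr_ge0 ?Defs.normc_ge0 ?powR_ge0.
Qed.

Let integrable_pairing (x : X) : mu.-integrable setT (EFin \o K x).
Proof.
apply/integrableP; split.
  by apply/measurable_EFinP; apply: mK; exact: cLspace_meas.
by apply: le_lt_trans (hoelder_bound x) _; rewrite ltry.
Qed.

(** The norming functional of [y] is integration against
    [conj y |y| ^ (p - 2)], up to normalization. *)
Lemma Lp_norming_nonzero :
  exists2 f, bfunctional f & (forall x, normc (f x) <= N x) /\ f y = (N y)%:C.
Proof.
pose c := N y `^ (p - 1); have c0 : 0 < c by exact: powR_gt0.
pose psi (x : X) : R := (\int[mu]_t K x t) / c.
have psi_ae (f : Om -> R) (x : X) : measurable_fun setT f ->
    {ae mu, forall t, K x t = f t} -> \int[mu]_t K x t = \int[mu]_t f t.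
  move=> mf h; congr fine; apply: ae_eq_integral => //.
  - by apply/measurable_EFinP; apply: mK; exact: cLspace_meas.
  - exact/measurable_EFinP.
  - by apply: filterS h => t -> _.
apply: (@complex_functional R X psi).
- move=> x z; rewrite /psi -mulrDl -RintegralD//; congr (_ / _).
  apply: psi_ae; first by apply: measurable_funD; apply: mK; exact: cLspace_meas.
  by apply: filterS (aeD x z) => t h; rewrite /K h ReD ImD; ring.
- move=> r x; rewrite /psi mulrA -RintegralZl//; congr (_ / _).
  apply: psi_ae; first by apply: measurable_funM => //; apply: mK; exact: cLspace_meas.
  apply: filterS (aeZ (r%:C) x) => t h; rewrite /K h.
  by case: ((x : X) t) => a b; simpc => /=; ring.
- move=> x; rewrite /psi ler_pdivrMr//; apply: le_trans (ler_norm _) _.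
  apply: le_trans (le_normr_Rintegral _ _) _ => //.
  rewrite -lee_fin /Rintegral fineK; first exact: hoelder_bound.
  rewrite ge0_fin_numE; last by apply: integral_ge0.
  by apply: le_lt_trans (hoelder_bound x) _; rewrite ltry.
- rewrite /psi.
  have -> : \int[mu]_t K y t = N y `^ p.
    rewrite /Rintegral (_ : (\int[mu]_t _)%E = (\int[mu]_t ((normc (y t)) `^ p)%:E)%E).
      by rewrite -rnorm_powR.
    apply: eq_integral => t _; congr EFin; rewrite /K.
    transitivity (normc (y t) * (normc (y t) * g t)).
      rewrite [RHS]mulrA -[normc (y t) * normc (y t)]expr2.
      have -> : normc (y t) ^+ 2 = complex.Re (y t) ^+ 2 + complex.Im (y t) ^+ 2.
        by case: (y t) => a b /=; rewrite sqr_sqrtr// addr_ge0 ?sqr_ge0.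
      by ring.
    by rewrite gE mulr_powRB1 ?Defs.normc_ge0.
  by rewrite /c -(mulr_powRB1 (rnorm_ge0 y) p0) mulfK// gt_eqF.
- rewrite /psi (psi_ae (cst 0)).
  + by rewrite Rintegral_cst// mul0r mul0r.
  + exact: measurable_cst.
  + apply: filterS (aeZ 'i y) => t h; rewrite /K h.
    by case: (y t) => a b; simpc => /=; ring.
Qed.
End pairing.

Lemma Lp_norming : norming X.
Proof.
move=> y; have [y0|] := ltP 0 (N y); first exact: Lp_norming_nonzero.
move=> /rnorm_le0 ->; exists (fun=> 0).
  by split=> [a x z|]; [rewrite mulr0 addr0|exists 0 => // x; rewrite normc0 mul0r].
by split=> [x|]; rewrite ?normc0 ?rnorm_ge0// rnorm0.
Qed.
End Lp_duality.

(** * Positive operators and the modulus *)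

Section positive_operators.
Context d (Om : measurableType d) (R : realType).
Variable mu : {finite_measure set Om -> \bar R}.
Variables (p : R) (p1 : 1 <= p).
Local Notation X := (cLspace mu p1).
Local Notation N := (@rnorm R X).
Implicit Types (F G : X).
Variable T : X -> X.
Hypotheses (Tb : @blin R X T) (Tpos : positive_op T).

Lemma positive_le F G : {ae mu, forall x, F x <= G x} -> {ae mu, forall x, T F x <= T G x}.
Proof.
move=> FG; have GF : {ae mu, forall x, 0 <= (G - F : X) x}.
  by apply: filterS2 FG (aeB G F) => x h ->; rewrite subr_ge0.
have := Tpos GF; rewrite (blinB _ _ Tb) => h.
by apply: filterS2 h (aeB (T G) (T F)) => x + E; rewrite E subr_ge0.
Qed.

Definition LRe F : X := Lclass mu p1 (fun x => (complex.Re (F x))%:C).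
Definition LIm F : X := Lclass mu p1 (fun x => (complex.Im (F x))%:C).

Lemma LReE F : {ae mu, forall x, LRe F x = (complex.Re (F x))%:C}.
Proof.
apply: (@Lclass_ae _ _ _ _ _ p1 _ F).
  by apply: cmeasurable_real; exact: (cLspace_meas F).1.
by apply: nearW => x; rewrite normcR Re_le_normc.
Qed.

Lemma LImE F : {ae mu, forall x, LIm F x = (complex.Im (F x))%:C}.
Proof.
apply: (@Lclass_ae _ _ _ _ _ p1 _ F).
  by apply: cmeasurable_real; exact: (cLspace_meas F).2.
by apply: nearW => x; rewrite normcR Im_le_normc.
Qed.

Lemma LReIm F : F = LRe F + 'i *: LIm F.
Proof.
apply: ae_eqL; apply: filterS3 (aeD (LRe F) ('i *: LIm F)) (aeZ 'i (LIm F))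
  (filterI (LReE F) (LImE F)) => x -> -> [-> ->].
exact: normc_ReIm.
Qed.

(** For real [F], [2 F] is the difference of the nonnegative [|F| + F] and
    [|F| - F]. *)
Lemma positive_real F : {ae mu, forall x, complex.Im (F x) = 0} ->
  {ae mu, forall x, complex.Im (T F x) = 0}.
Proof.
move=> Fr; pose P : X := Labs F + F; pose Q : X := Labs F - F.
have real_abs (z : R[i]) : complex.Im z = 0 ->
    0 <= (normc z)%:C + z /\ 0 <= (normc z)%:C - z.
  case: z => a b /= ->; rewrite expr0n addr0 sqrtr_sqr.
  rewrite !lecE /= addr0 subr0 eqxx /=; split.
    by rewrite -lerBlDr sub0r -normrN ler_norm.
  by rewrite subr_ge0 ler_norm.
have P0 : {ae mu, forall x, 0 <= P x}.
  apply: filterS3 (aeD (Labs F) F) (LabsE F) Fr => x -> -> /real_abs[]//.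
have Q0 : {ae mu, forall x, 0 <= Q x}.
  apply: filterS3 (aeB (Labs F) F) (LabsE F) Fr => x -> -> /real_abs[]//.
have TF : T P - T Q = 2%:R *: T F.
  by rewrite -(blinB _ _ Tb) -(blinZ _ _ Tb); congr (T _); rewrite /P /Q; lmod R[i].
have := aeB (T P) (T Q); rewrite TF => h.
apply: filterS3 h (aeZ 2%:R (T F)) (filterI (Tpos P0) (Tpos Q0)) => x h1 h2 [].
have := etrans (esym h2) h1; rewrite !ge0cP => + hP hQ; rewrite hP hQ.
case: (T F x) => a b /= /(congr1 (@complex.Im R)).
rewrite -[2%:R : R[i]](rmorph_nat (real_complex R)) /= ?mulr0 ?mul0r subr0 addr0.
by move=> /eqP; rewrite mulf_eq0 pnatr_eq0 /= => /eqP.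
Qed.

(** The vector [(u, v)] of the plane is tested against a net of the unit ball for
    each precision [1 / (m + 1)]: countably many conditions, so that they can be
    imposed almost everywhere. *)
Lemma modulus_from_net (s : nat -> seq 'rV[R]_2) (u v t : R[i]) :
  (forall m, (forall b, b \in s m -> \sum_i b 0 i ^+ 2 <= 1) /\
    (forall a : 'I_2 -> R, exists2 b, b \in s m &
      (1 - m.+1%:R^-1) * Num.sqrt (\sum_i a i ^+ 2) <= \sum_i b 0 i * a i)) ->
  (forall m b, b \in s m -> (b 0 0)%:C * u + (b 0 1)%:C * v <= t) ->
  complex.Im u = 0 -> complex.Im v = 0 -> 0 <= t -> (normc (u + 'i * v))%:C <= t.
Proof.
case: u v t => u u' [v v'] [t t'] sP h u0 v0 tt0.
have {}u0 : u' = 0 by []; have {}v0 : v' = 0 by [].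
rewrite {}u0 {}v0 in h *.
rewrite (_ : (u +i* 0) + _ = u +i* v); last by simpc.
have /andP[/eqP t'0 t0] : (t' == 0) && (0 <= t) by move: tt0; rewrite lecE.
rewrite {}t'0 in h tt0 *.
rewrite (_ : normc _ = Num.sqrt (u ^+ 2 + v ^+ 2))//; set r := Num.sqrt _.
rewrite -[t +i* 0]/(t%:C) lecR.
have rm m : (1 - m.+1%:R^-1) * r <= t.
  have [b bs] := (sP m).2 (fun i => if i == 0 then u else v).
  rewrite !big_ord_recl !big_ord0 !addr0 /= -/r => /le_trans; apply.
  have := h _ _ bs; rewrite lecE /= !mul0r !subr0 => /andP[_].
  by rewrite (_ : lift ord0 ord0 = 1)//; apply/val_inj.
rewrite leNgt; apply/negP => tr.
pose m := Num.truncn (r / (r - t)).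
have rt : 0 < r - t by rewrite subr_gt0.
have : r / (r - t) < m.+1%:R by exact: truncnS_gt.
rewrite ltr_pdivrMr// => h1.
have := rm m; rewrite mulrBl mul1r lerBlDl -lerBlDr => h2.
have : r - t <= m.+1%:R^-1 * r by [].
by rewrite ler_pdivlMl// leNgt h1.
Qed.

(** For [b] in the unit ball [b0 Re F + b1 Im F <= |F|], an inequality that [T]
    preserves; [modulus_from_net] recovers the modulus of [T F] from these. *)
Lemma positive_modulus F : {ae mu, forall x, (normc (T F x))%:C <= T (Labs F) x}.
Proof.
have e0 m : 0 < m.+1%:R^-1 :> R by rewrite invr_gt0.
have [s sP] := choice (fun m => @unit_ball_net R 2 _ (e0 m)).
pose W (b : 'rV[R]_2) : X := (b 0 0)%:C *: LRe F + (b 0 1)%:C *: LIm F.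
have WF m (b : 'rV[R]_2) : b \in s m -> {ae mu, forall x, W b x <= Labs F x}.
  move=> /(sP m).1; rewrite !big_ord_recl big_ord0 addr0 => b1.
  apply: filterS3 (LabsE F) (filterI (LReE F) (LImE F)) (filterI
    (aeD ((b 0 0)%:C *: LRe F) ((b 0 1)%:C *: LIm F))
    (filterI (aeZ (b 0 0)%:C (LRe F)) (aeZ (b 0 1)%:C (LIm F)))) => x -> [hR hI] [-> [-> ->]].
  rewrite hR hI -!rmorphM -rmorphD lecR.
  have n1 : normc (b 0 0 -i* b 0 1) <= 1.
    rewrite /= sqrrN -[leRHS]sqrtr1 ler_sqrt//.
    by move: b1; rewrite (_ : lift ord0 ord0 = 1)//; apply/val_inj.
  apply: (@le_trans _ _ (normc ((b 0 0 -i* b 0 1) * F x))).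
    apply: le_trans (ler_norm _) _; apply: le_trans (Re_le_normc _).
    by rewrite le_eqVlt; apply/orP; left; apply/eqP; case: (F x) => c c'; simpc => /=; congr (`|_|); ring.
  by rewrite normcM ler_piMl// Defs.normc_ge0.
have TW (b : 'rV[R]_2) : T (W b) = (b 0 0)%:C *: T (LRe F) + (b 0 1)%:C *: T (LIm F).
  by rewrite /W (blinD _ _ Tb) !(blinZ _ _ Tb).
have hW : {ae mu, forall x, forall m, forall b, b \in s m ->
    (b 0 0)%:C * T (LRe F) x + (b 0 1)%:C * T (LIm F) x <= T (Labs F) x}.
  apply: ae_foralln => m; apply: ae_all_seq => b bs.
  have h := positive_le (WF _ _ bs); rewrite TW in h.
  by apply: filterS3 h (aeD ((b 0 0)%:C *: T (LRe F)) ((b 0 1)%:C *: T (LIm F)))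
    (filterI (aeZ (b 0 0)%:C (T (LRe F))) (aeZ (b 0 1)%:C (T (LIm F)))) => x + E [E1 E2];
    rewrite E E1 E2.
have rRe : {ae mu, forall x, complex.Im (T (LRe F) x) = 0}.
  by apply: positive_real; apply: filterS (LReE F) => x ->.
have rIm : {ae mu, forall x, complex.Im (T (LIm F) x) = 0}.
  by apply: positive_real; apply: filterS (LImE F) => x ->.
have TF : T F = T (LRe F) + 'i *: T (LIm F) by rewrite {1}(LReIm F) (blinD _ _ Tb) (blinZ _ _ Tb).
have abs0 : {ae mu, forall x, 0 <= T (Labs F) x}.
  by apply: Tpos; apply: filterS (LabsE F) => x ->; rewrite lecR Defs.normc_ge0.
have h1 := aeD (T (LRe F)) ('i *: T (LIm F)); rewrite -TF in h1.
apply: filterS3 h1 hW (filterI (filterI rRe rIm) (filterI abs0 (aeZ 'i (T (LIm F))))).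
move=> x -> hb [[R1 I1] [t0 ->]]; exact: (modulus_from_net sP).
Qed.
End positive_operators.

(** * Uniform integrability of the range *)

Section uniform_integrability.
Context d (Om : measurableType d) (R : realType).
Variable mu : {finite_measure set Om -> \bar R}.
Variables (p q : R) (p1 : 1 <= p) (pq : p < q).
Local Notation X := (cLspace mu p1).
Local Notation N := (@rnorm R X).
Implicit Types (F G : X).
Let p0 : 0 < p := p_gt0 p1.
Let q0 : 0 < q := lt_trans p0 pq.

(** Split at the height [K]: below it [|H|^p <= K^p], above it
    [|H|^p <= K^(p - q) |H|^q]. *)
Lemma restr_Lq_bound (H : X) : (H : Om -> R[i]) \in cLfun mu q ->
  exists2 J : R, 0 <= J & forall (A : set Om) (K e : R), measurable A -> 0 < K ->
    (mu A <= e%:E)%E -> N (Lrestr A H) `^ p <= K `^ p * e + K `^ (p - q) * J.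
Proof.
move=> /cLfunP[mH Hq].
pose I : \bar R := (\int[mu]_x ((normc (H x)) `^ q)%:E)%E.
have I0 : (0 <= I)%E by apply: integral_ge0 => x _; rewrite lee_fin powR_ge0.
have Ifin : I \is a fin_num.
  rewrite ge0_fin_numE// /I -(cLnorm_powR mu (ltW (le_lt_trans p1 pq)) mH).
  exact: poweR_lty.
exists (fine I); first by rewrite fine_ge0.
move=> A K e mA K0 Ae; rewrite -lee_fin rnorm_powR.
have K_pos r : 0 < K `^ r by exact: powR_gt0.
have mI : measurable_fun setT (\1_A : Om -> R) by exact: measurable_indic.
have m1 : measurable_fun setT (fun x => (K `^ p * \1_A x)%:E).
  by apply/measurable_EFinP; exact: measurable_funM.
have m2 : measurable_fun setT (fun x => (K `^ (p - q) * normc (H x) `^ q)%:E).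
  apply/measurable_EFinP; apply: measurable_funM => //.
  apply: (measurableT_comp (measurable_powR _)); exact: measurable_normc.
apply: (@le_trans _ _ (\int[mu]_x ((K `^ p * \1_A x)%:E + (K `^ (p - q) * normc (H x) `^ q)%:E))%E).
  apply: ae_ge0_le_integral => //.
  - by move=> x _; rewrite lee_fin powR_ge0.
  - by apply: measurable_normc_powR; exact: cLspace_meas.
  - by move=> x _; rewrite -EFinD lee_fin addr_ge0 ?mulr_ge0 ?powR_ge0 ?indicE.
  - exact: emeasurable_funD.
  apply: filterS (LrestrE H mA) => x -> _; rewrite -EFinD lee_fin.
  rewrite normcM normcR indicE; case: (boolP (x \in A)) => xA; last first.
    by rewrite normr0 mul0r powR0 ?gt_eqF// mulr0 add0r mulr_ge0 ?powR_ge0.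
  rewrite normr1 mul1r mulr1; set h := normc (H x).
  have h0 : 0 <= h by exact: Defs.normc_ge0.
  have [hK|Kh] := leP h K.
    apply: (@le_trans _ _ (K `^ p)); last by rewrite lerDl mulr_ge0 ?powR_ge0.
    by rewrite ge0_ler_powR ?nnegrE ?(ltW p0) ?(ltW K0).
  have hp : 0 < h by exact: lt_trans Kh.
  apply: (@le_trans _ _ (K `^ (p - q) * h `^ q)); last by rewrite lerDr powR_ge0.
  have -> : h `^ p = h `^ (p - q) * h `^ q.
    by rewrite -powRD ?subrK// gt_eqF// implybT.
  rewrite ler_wpM2r ?powR_ge0// -(opprB q p) !powRN lef_pV2 ?posrE ?powR_gt0//.
  by rewrite ge0_ler_powR ?nnegrE ?subr_ge0 ?(ltW pq) ?(ltW Kh) ?(ltW K0).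
rewrite ge0_integralD//; first last.
- by move=> x _; rewrite lee_fin mulr_ge0 ?powR_ge0.
- by move=> x _; rewrite lee_fin mulr_ge0 ?powR_ge0 ?indicE.
rewrite EFinD; apply: leeD.
  under eq_integral do rewrite EFinM.
  rewrite ge0_integralZl_EFin ?powR_ge0//; first last.
    exact/measurable_EFinP.
  by rewrite integral_indic// setIT EFinM lee_wpmul2l// lee_fin powR_ge0.
under eq_integral do rewrite EFinM.
rewrite ge0_integralZl_EFin ?powR_ge0//; first last.
- apply/measurable_EFinP; apply: (measurableT_comp (measurable_powR _)).
  exact: measurable_normc.
- by move=> x _; rewrite lee_fin powR_ge0.
by rewrite EFinM fineK.
Qed.

Variable T : X -> X.
Hypotheses (Tb : @blin R X T) (Tpos : positive_op T).
Hypothesis TLq : forall F, (T F : Om -> R[i]) \in cLfun mu q.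

(** Gliding hump: otherwise there are sets [A n] of rapidly decreasing measure
    and vectors [F n] such that [T (F n)] has on [A n] more than half the norm of
    [F n]. Sum the [|F n|], normalized to the summable norms [r n]: the image of
    the sum under [T] has too much mass on every [A n] to belong to [L^q]. *)
Lemma positive_uniformly_integrable : exists2 c : R, 0 < c &
  forall A, measurable A -> (mu A < c%:E)%E -> forall F, N (Lrestr A (T F)) <= 2^-1 * N F.
Proof.
apply: contrapT => nc.
pose r n : R := 2^-1 ^+ n.+1.
have r_pos n : 0 < r n by rewrite exprn_gt0// invr_gt0.
pose rho n := (r n / 2) `^ p.
have rho_pos n : 0 < rho n by rewrite powR_gt0// divr_gt0.
pose K n := (rho n * r n) `^ (p - q)^-1.
have K_pos n : 0 < K n by rewrite powR_gt0// mulr_gt0.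
have KE n : K n `^ (p - q) = rho n * r n.
  rewrite /K -powRrM mulVf ?powRr1 ?mulr_ge0 ?ltW//.
  by rewrite subr_eq0 lt_eqF.
(* [K n] balances the two terms of [restr_Lq_bound] on a set of measure [eps n] *)
pose eps n := rho n * r n / K n `^ p.
have eps_pos n : 0 < eps n by rewrite divr_gt0 ?powR_gt0// mulr_gt0.
have hump n : exists AF : set Om * X, [/\ measurable AF.1, (mu AF.1 < (eps n)%:E)%E &
    2^-1 * N AF.2 < N (Lrestr AF.1 (T AF.2))].
  apply: contrapT => nh; apply: nc; exists (eps n) => // A mA Ae F.
  by rewrite leNgt; apply/negP => h; apply: nh; exists (A, F).
have [AF AFP] := choice hump.
pose A n := (AF n).1; pose F n := (AF n).2.
have NF n : 0 < N (F n).
  rewrite lt_def rnorm_ge0 andbT; apply/eqP => F0.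
  have [mA _] := AFP n; rewrite -/(F n) F0 mulr0 (rnorm0_eq0 F0) (blin0 Tb).
  suff -> : Lrestr (AF n).1 (0 : X) = 0 by rewrite rnorm0 ltxx.
  apply: ae_eqL; apply: filterS2 (LrestrE (0 : X) mA) (ae0 mu p1) => x -> ->.
  by rewrite mulr0.
pose u n : X := (r n / N (F n))%:C *: Labs (F n).
have Nu n : N (u n) = r n.
  rewrite rnormZ normcR_ge0 ?divr_ge0 ?ltW// rnorm_Labs divfK//.
  by rewrite gt_eqF.
have u0 : {ae mu, forall x, forall n, 0 <= u n x}.
  apply: ae_foralln => n; apply: filterS2 (aeZ (r n / N (F n))%:C (Labs (F n))) (LabsE (F n)).
  by move=> x -> ->; rewrite -rmorphM lecR mulr_ge0 ?Defs.normc_ge0// divr_ge0 ?ltW.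
have [|G hG] := Lp_abs_complete (mu := mu) (p1 := p1) (u := u).
  exists 1 => n; rewrite (eq_bigr (fun i : 'I_n => 2^-1 * 2^-1 ^+ i)); last first.
    by move=> i _; rewrite Nu /r exprS.
  rewrite -mulr_sumr; apply: (@le_trans _ _ (2^-1 * (1 - 2^-1)^-1)).
    by rewrite ler_wpM2l ?invr_ge0//; apply: geometric_sum_le; lra.
  by rewrite le_eqVlt; apply/orP; left; apply/eqP; field.
pose G' : X := G.
have uG n : {ae mu, forall x, u n x <= G' x}.
  have : {ae mu, forall x, 0 <= (G' - u n : X) x}.
    apply: closed_cone => e e0; have [m0 hm0] := hG _ e0.
    pose m := maxn m0 n.+1.
    exists (\sum_(i < m) u i - u n); last first.
      rewrite (_ : G' - u n - _ = G' - \sum_(i < m) u i); last by lmod R[i].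
      by apply: hm0; exact: leq_maxl.
    apply: filterS3 (aeB (\sum_(i < m) u i) (u n)) (ae_sum (fun i : 'I_m => u i)) u0 => x -> -> hx.
    have nm : (n < m)%N by exact: leq_maxr.
    rewrite (bigD1 (Ordinal nm))//= [leRHS]addrC addKr.
    by apply: sumr_ge0 => i _; exact: hx.
  move=> h; apply: filterS2 h (aeB G' (u n)) => x + E.
  by rewrite E subr_ge0.
have low n : r n / 2 <= N (Lrestr (A n) (T G')).
  have [mA _ FA] := AFP n.
  apply: (@le_trans _ _ (r n / N (F n) * N (Lrestr (A n) (T (F n))))).
    rewrite mulrAC ler_pdivlMr// -[leLHS]mulrA ler_wpM2l ?(ltW (r_pos n))//.
    exact: ltW.
  rewrite -[X in X * _](@normcR_ge0 R); last by rewrite divr_ge0// ltW.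
  rewrite -rnormZ; apply: le_rnorm.
  have Tu : T (u n) = (r n / N (F n))%:C *: T (Labs (F n)) by rewrite (blinZ _ _ Tb).
  have h := positive_le Tb Tpos (uG n); rewrite Tu in h.
  apply: filterS3 (LrestrE (T G') mA)
    (filterI (aeZ (r n / N (F n))%:C (Lrestr (A n) (T (F n)))) (LrestrE (T (F n)) mA))
    (filterI h (filterI (aeZ (r n / N (F n))%:C (T (Labs (F n)))) (positive_modulus Tb Tpos (F n)))).
  move=> x -> [-> ->] [+ [E hmod]]; rewrite E => h1.
  rewrite mulrCA !normcM ler_wpM2l ?Defs.normc_ge0//.
  have rN0 : 0 <= r n / N (F n) by rewrite divr_ge0// ltW.
  have h2 : (r n / N (F n))%:C * (normc (T (F n) x))%:C <= T G' x.
    by apply: le_trans h1; rewrite ler_wpM2l// lecR.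
  have : 0 <= T G' x.
    by apply: le_trans h2; rewrite -rmorphM lecR mulr_ge0// Defs.normc_ge0.
  move: h2 => /[swap] /ge0cP ->; rewrite -rmorphM lecR => h2.
  by rewrite !normcR_ge0 ?Defs.normc_ge0.
have [J J0 hJ] := restr_Lq_bound (TLq G').
have key n : 1 <= r n * (1 + J).
  have [mA Ae _] := AFP n.
  have hi := hJ (A n) (K n) (eps n) mA (K_pos n) (ltW Ae).
  have : rho n <= rho n * r n * (1 + J).
    apply: (@le_trans _ _ (N (Lrestr (A n) (T G')) `^ p)).
      rewrite ge0_ler_powR ?nnegrE ?rnorm_ge0 ?(ltW p0)//.
      by rewrite divr_ge0// ltW.
    apply: le_trans hi _; rewrite KE /eps mulrC divfK ?(gt_eqF (powR_gt0 _ (K_pos n)))//.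
    by rewrite mulrDr mulr1.
  by rewrite -mulrA ler_pMr.
have h01 : 0 <= (2^-1 : R) < 1 by apply/andP; split; lra.
have [n hn] := geometric_small (1 + J) h01 (ltr01 : (0 : R) < 1).
have := key n; rewrite /r exprS leNgt => /negP; apply.
rewrite -mulrA [2^-1 ^+ n * _]mulrC; apply: (@le_lt_trans _ _ (2^-1 * 1)).
  by rewrite ler_wpM2l ?invr_ge0.
by lra.
Qed.
End uniform_integrability.


(** * Excess over a superharmonic function *)

Section excess.
Context d (Om : measurableType d) (R : realType).
Variable mu : {finite_measure set Om -> \bar R}.
Variables (p : R) (p1 : 1 <= p).
Local Notation X := (cLspace mu p1).
Local Notation N := (@rnorm R X).
Implicit Types (F G H x y g h : X).
Let p0 : 0 < p := p_gt0 p1.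

(** Unlike the set where [|y| > t g], this function satisfies an inequality that
    [T] transports; see [excess_subharmonic]. *)
Definition excess (t : R) y g : X :=
  Lclass mu p1 (fun z => (Num.max (normc (y z) - t * complex.Re (g z)) 0)%:C).

Lemma excessE t y g : 0 <= t -> {ae mu, forall z, 0 <= g z} ->
  {ae mu, forall z, excess t y g z = (Num.max (normc (y z) - t * complex.Re (g z)) 0)%:C}.
Proof.
move=> t0 g0; apply: (@Lclass_ae _ _ _ _ _ p1 _ y).
  apply: cmeasurable_real; apply: measurable_maxr; last exact: measurable_cst.
  apply: measurable_funB; first by apply: measurable_normc; exact: cLspace_meas.
  by apply: measurable_funM => //; exact: (cLspace_meas g).1.
apply: filterS g0 => z gz.
have {}gz : 0 <= complex.Re (g z) by move: gz; rewrite lecE => /andP[].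
rewrite normcR_ge0 ?le_max ?lexx ?orbT// ge_max Defs.normc_ge0 andbT.
by rewrite gerBl mulr_ge0.
Qed.

Lemma excess_ge0 t y g : 0 <= t -> {ae mu, forall z, 0 <= g z} ->
  {ae mu, forall z, 0 <= excess t y g z}.
Proof.
move=> t0 g0; apply: filterS (excessE y t0 g0) => z ->.
by rewrite lecR le_max lexx orbT.
Qed.

Variable T : X -> X.
Hypotheses (Tb : @blin R X T) (Tpos : positive_op T).
Variable M : R.
Hypotheses (M0 : 0 <= M) (TM : forall k F, N (iter k T F) <= M * N F).

Lemma positive_iter k F : {ae mu, forall z, 0 <= F z} -> {ae mu, forall z, 0 <= iter k T F z}.
Proof. by move=> F0; elim: k => //= k IH; exact: Tpos. Qed.

(** The witness is [eta (1 + eta - T)^-1 h]: its Neumann series has nonnegative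
    terms, and power-boundedness controls it independently of [eta]. *)
Lemma superharmonic (eta : R) h : 0 < eta -> {ae mu, forall z, 0 <= h z} ->
  exists g, [/\ (1 + eta)%:C *: g - T g = eta%:C *: h,
    {ae mu, forall z, 0 <= g z} & N g <= M * N h].
Proof.
move=> eta0 h0; set w : R[i] := (1 + eta)%:C.
have nw : normc w = 1 + eta by rewrite normcR_ge0// addr_ge0// ltW.
have w1 : 1 < normc w by rewrite nw ltrDl.
have [J1 J1b [_ TJ1 J1le J1ser]] := @outer_resolvent R X T M w (@Lp_abs_complete _ _ _ mu p p1) Tb M0 TM w1.
pose J : X -> X := J1.
have TJ F : w *: J F - T (J F) = F := TJ1 F.
have Jle F : N (J F) <= M / (normc w - 1) * N F := J1le F.
have Jser F e : 0 < e -> exists n,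
  N (J F - \sum_(i < n) w^-1 ^+ i.+1 *: (iter i T F : X)) <= e := J1ser F e.
exists (eta%:C *: J h); split.
- by rewrite (blinZ _ _ Tb) -[in RHS](TJ h) /w; lmod R[i].
- suff J0 : {ae mu, forall z, 0 <= J h z}.
    by apply: filterS2 J0 (aeZ eta%:C (J h)) => z Jz ->; rewrite mulr_ge0// lecR ltW.
  apply: closed_cone => e e0; have [n hn] := Jser h e e0.
  exists (\sum_(i < n) w^-1 ^+ i.+1 *: iter i T h) => //.
  have it : {ae mu, forall z, forall k, 0 <= iter k T h z}.
    by apply: ae_foralln => k; exact: positive_iter.
  have sc : {ae mu, forall z, forall k, (w^-1 ^+ k.+1 *: iter k T h : X) z = w^-1 ^+ k.+1 * iter k T h z}.
    by apply: ae_foralln => k; exact: aeZ.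
  apply: filterS3 (ae_sum (fun i : 'I_n => w^-1 ^+ i.+1 *: iter i T h : X)) it sc => z -> itz scz.
  apply: sumr_ge0 => i _; rewrite scz mulr_ge0// exprn_ge0// invr_ge0 lecR.
  by rewrite addr_ge0// ltW.
- rewrite rnormZ normcR_ge0 ?(ltW eta0)// -ler_pdivlMl//; apply: le_trans (Jle h) _.
  by rewrite nw addrAC subrr add0r mulrA [eta^-1 * _]mulrC.
Qed.

(** The equation of [y] gives [(1 + eta)|y| <= T|y| + eta |x|]. Subtract [t]
    times the equation of [g]: with [v = |y| - t g] and [v' = |x| - t h] this
    reads [(1 + eta) v <= T v + eta v'], and [T] being positive, one may pass to
    positive parts. *)
Lemma excess_subharmonic (eta t : R) (lam : R[i]) x y g h : 0 < eta -> 0 <= t ->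
  normc lam = 1 -> {ae mu, forall z, 0 <= g z} -> {ae mu, forall z, 0 <= h z} ->
  (1 + eta)%:C *: g - T g = eta%:C *: h ->
  ((1 + eta)%:C * lam) *: y - T y = (eta%:C * lam) *: x ->
  {ae mu, forall z, (1 + eta) * normc (excess t y g z) <=
     normc (T (excess t y g) z) + eta * normc (excess t x h z)}.
Proof.
move=> eta0 t0 lam1 g0 h0 gE yE; set u := excess t y g.
have uE := excessE y t0 g0.
have Tu0 : {ae mu, forall z, 0 <= T u z} by apply: Tpos; exact: excess_ge0.
pose v : X := Labs y - t%:C *: g.
have vu : {ae mu, forall z, v z <= u z}.
  apply: filterS3 (filterI uE g0) (aeB (Labs y) (t%:C *: g))
    (filterI (LabsE y) (aeZ t%:C g)) => z [-> /ge0cP gz] -> [-> ->].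
  rewrite {1}gz -rmorphM -rmorphB lecR le_max; apply/orP; left.
  by rewrite {2}gz.
have Tv : T v = T (Labs y) - t%:C *: T g by rewrite (blinB _ _ Tb) (blinZ _ _ Tb).
have Tvu := positive_le Tb Tpos vu; rewrite Tv in Tvu.
have Tg : T g = (1 + eta)%:C *: g - eta%:C *: h by rewrite -gE; lmod R[i].
have Ty : T y = ((1 + eta)%:C * lam) *: y - (eta%:C * lam) *: x by rewrite -yE; lmod R[i].
have aeTg : {ae mu, forall z, T g z = (1 + eta)%:C * g z - eta%:C * h z}.
  rewrite Tg; apply: filterS3 (aeB ((1 + eta)%:C *: g) (eta%:C *: h))
    (aeZ (1 + eta)%:C g) (aeZ eta%:C h) => z -> -> ->//.
have aeTy : {ae mu, forall z, T y z = (1 + eta)%:C * lam * y z - eta%:C * lam * x z}.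
  rewrite Ty; apply: filterS3 (aeB (((1 + eta)%:C * lam) *: y) ((eta%:C * lam) *: x))
    (aeZ ((1 + eta)%:C * lam) y) (aeZ (eta%:C * lam) x) => z -> -> ->//.
have mod_y := positive_modulus Tb Tpos y.
apply: filterS3 (filterI (filterI uE Tu0) (filterI g0 h0))
  (filterI (filterI aeTg aeTy) (filterI mod_y (excessE x t0 h0)))
  (filterI Tvu (filterI (aeB (T (Labs y)) (t%:C *: T g)) (aeZ t%:C (T g)))) => z.
move=> [[uz Tuz] [gz hz]] [[Tgz Tyz] [mz ez]] [Tvz [E1 E2]].
rewrite E1 E2 Tgz in Tvz; rewrite uz ez.
have {}Tuz := (ge0cP _).1 Tuz; have {}gz := (ge0cP _).1 gz; have {}hz := (ge0cP _).1 hz.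
have gR : complex.Re (g z) = normc (g z) by rewrite {1}gz.
have hR : complex.Re (h z) = normc (h z) by rewrite {1}hz.
rewrite gR hR !normcR_ge0 ?le_max ?lexx ?orbT//.
have lowT : (1 + eta) * normc (y z) - eta * normc (x z) <= normc (T y z).
  rewrite lerBlDr.
  have -> : (1 + eta) * normc (y z) = normc ((1 + eta)%:C * lam * y z).
    by rewrite !normcM lam1 normcR_ge0 ?mulr1// addr_ge0// ltW.
  have -> : eta * normc (x z) = normc (eta%:C * lam * x z).
    by rewrite !normcM lam1 normcR_ge0 ?mulr1// ltW.
  rewrite -[(1 + eta)%:C * lam * y z](subrK (eta%:C * lam * x z)) -Tyz.
  exact: le_normcD.
have main : normc (T y z) - t * ((1 + eta) * normc (g z) - eta * normc (h z)) <= normc (T u z).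
  have hh : (normc (T y z))%:C - t%:C * ((1 + eta)%:C * g z - eta%:C * h z) <= T u z.
    by apply: le_trans Tvz; rewrite lerD2r.
  by rewrite gz hz Tuz -!rmorphM -rmorphB -rmorphM -rmorphB lecR in hh.
have Tn0 := Defs.normc_ge0 (T u z).
have e_ge0 : 0 <= Num.max (normc (x z) - t * normc (h z)) 0 by rewrite le_max lexx orbT.
have e_ge : normc (x z) - t * normc (h z) <= Num.max (normc (x z) - t * normc (h z)) 0.
  by rewrite le_max lexx.
set e := Num.max (normc (x z) - t * normc (h z)) 0 in e_ge0 e_ge *.
have [a0|a0] := leP (normc (y z) - t * normc (g z)) 0.
  by rewrite mulr0 addr_ge0// mulr_ge0// ltW.
have : eta * (normc (x z) - t * normc (h z)) <= eta * e by rewrite ler_wpM2l// ltW.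
nra.
Qed.

(** At level [1] the excess of [x] over [h] vanishes, so the excess [u] of [y]
    satisfies [(1 + eta)^k u <= T^k u], which is bounded in [k]. *)
Lemma dominated_by_superharmonic (eta : R) (lam : R[i]) x y g h : 0 < eta ->
  normc lam = 1 -> {ae mu, forall z, 0 <= g z} -> {ae mu, forall z, 0 <= h z} ->
  (1 + eta)%:C *: g - T g = eta%:C *: h ->
  ((1 + eta)%:C * lam) *: y - T y = (eta%:C * lam) *: x ->
  {ae mu, forall z, normc (x z) <= complex.Re (h z)} ->
  {ae mu, forall z, normc (y z) <= complex.Re (g z)}.
Proof.
move=> eta0 lam1 g0 h0 gE yE xh.
have sub := excess_subharmonic eta0 ler01 lam1 g0 h0 gE yE.
set u := excess 1 y g in sub.
have u0 : {ae mu, forall z, 0 <= u z} by apply: excess_ge0.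
have uTu : {ae mu, forall z, ((1 + eta)%:C *: u : X) z <= T u z}.
  apply: filterS3 (filterI sub (excessE x ler01 h0)) (filterI u0 (aeZ (1 + eta)%:C u))
    (filterI xh (Tpos u0)) => z [sz ez] [/ge0cP uz ->] [xz /ge0cP Tz].
  move: sz; rewrite ez normcR_ge0 ?le_max ?lexx ?orbT// mul1r max_r ?subr_le0// mulr0 addr0.
  by move=> sz; rewrite uz Tz -rmorphM lecR.
have uTk k : {ae mu, forall z, ((1 + eta)%:C ^+ k *: u : X) z <= iter k T u z}.
  elim: k => [|k IH]; first by apply: filterS (aeZ 1 u) => z E; rewrite expr0 E mul1r.
  have h1 := positive_le Tb Tpos IH; rewrite (blinZ _ _ Tb) in h1.
  apply: filterS3 h1 (filterI (aeZ ((1 + eta)%:C ^+ k) (T u)) uTu)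
    (filterI (aeZ ((1 + eta)%:C ^+ k.+1) u) (aeZ (1 + eta)%:C u)) => z + [E1 uz] [E2 E3].
  rewrite E1 E2; apply: le_trans; rewrite exprS -mulrA mulrCA ler_wpM2l//.
    by rewrite exprn_ge0// lecR addr_ge0// ltW.
  by move: uz; rewrite E3.
have nX k : normc ((1 + eta)%:C ^+ k) = (1 + eta) ^+ k.
  by rewrite -rmorphXn normcR_ge0// exprn_ge0// addr_ge0// ltW.
have u_zero : u = 0.
  apply: (@rnorm_le0 R X).
  have th01 : 0 <= (1 + eta)^-1 < 1.
    rewrite invr_ge0 addr_ge0 ?(ltW eta0)//= invf_lt1 ?ltrDl//.
    by rewrite addr_gt0.
  apply: (geometric_le0 (C := M * N u) th01) => k.
  rewrite exprVn ler_pdivlMr ?exprn_gt0 ?addr_gt0//.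
  apply: le_trans (TM k u); rewrite mulrC -nX -rnormZ; apply: le_rnorm.
  apply: filterS3 (uTk k) u0 (filterI (aeZ ((1 + eta)%:C ^+ k) u) (positive_iter k u0)).
  move=> z + /ge0cP uz [E /ge0cP iz]; rewrite E uz iz -rmorphXn -rmorphM lecR => h1.
  by rewrite !normcR_ge0 ?Defs.normc_ge0// mulr_ge0 ?Defs.normc_ge0 ?exprn_ge0// addr_ge0// ltW.
apply: filterS3 (excessE y ler01 g0) (ae0 mu p1) u0 => z uz zz _.
move: uz; rewrite -/u u_zero zz => /(congr1 (@complex.Re R)) /= /esym/eqP.
rewrite mul1r => /eqP mx; rewrite -subr_le0 -[leRHS]mx.
by rewrite le_max lexx.
Qed.

End excess.

Section excess_estimates.
Context d (Om : measurableType d) (R : realType).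
Variable mu : {finite_measure set Om -> \bar R}.
Variables (p : R) (p1 : 1 <= p).
Local Notation X := (cLspace mu p1).
Local Notation N := (@rnorm R X).
Implicit Types (x y g h : X).
Let p0 : 0 < p := p_gt0 p1.

Definition Lone : X := Lclass mu p1 (cst 1).

Lemma LoneE : {ae mu, forall z, Lone z = 1}.
Proof.
apply: LclassE; apply/cLfunP; split; first by split => /=; exact: measurable_cst.
rewrite /cLnorm (@eq_Lnorm _ _ _ _ _ _ (cst 1%E)); last by move=> z; congr EFin; exact: normc1.
rewrite Lnorm_cst1; apply: poweR_lty.
exact: fin_num_fun_lty.
Qed.

Variable T : X -> X.
Hypotheses (Tb : @blin R X T) (Tpos : positive_op T).
Variable c : R.
Hypothesis ui : forall A, measurable A -> (mu A < c%:E)%E ->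
  forall F, N (Lrestr A (T F)) <= 2^-1 * N F.

(** Off [S] the excess [u] vanishes or is at most [A kap]. On [S] it is at
    most [T u] plus an error, and restricting [T u] to a set of measure less than
    [c] halves it: [N u <= N u / 2 + error]. Hence an excess that is not small
    lives on a set of measure at least [c]. *)
Lemma small_excess (eta t kap A : R) (lam : R[i]) x y g h (S : set Om) :
  0 < eta -> 0 <= t -> 0 <= A -> 0 <= kap -> normc lam = 1 ->
  {ae mu, forall z, 0 <= g z} -> {ae mu, forall z, 0 <= h z} ->
  (1 + eta)%:C *: g - T g = eta%:C *: h ->
  ((1 + eta)%:C * lam) *: y - T y = (eta%:C * lam) *: x ->
  {ae mu, forall z, normc (x z) <= A * complex.Re (h z)} ->
  {ae mu, forall z, normc (y z) <= A * complex.Re (g z)} ->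
  measurable S ->
  {ae mu, forall z, t * complex.Re (g z) < normc (y z) -> kap < complex.Re (g z) -> S z} ->
  (mu S < c%:E)%E -> N (excess t y g) <= 2 * (eta * A * N h + A * kap * N Lone).
Proof.
move=> eta0 t0 A0 kap0 lam1 g0 h0 gE yE xh yg mS hS muS.
set u := excess t y g.
have sub := excess_subharmonic Tb Tpos eta0 t0 lam1 g0 h0 gE yE.
pose W1 : X := Labs (Lrestr S (T u)).
pose W2 : X := (eta * A)%:C *: Labs h.
pose W3 : X := (A * kap)%:C *: Lone.
have eA0 : 0 <= eta * A by rewrite mulr_ge0// ltW.
have Ak0 : 0 <= A * kap by rewrite mulr_ge0.
have uW : N u <= N (W1 + (W2 + W3)).
  apply: le_rnorm.
  apply: filterS3 (filterI (filterI (excessE y t0 g0) sub) (filterI (excessE x t0 h0) xh))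
    (filterI (filterI (aeD W1 (W2 + W3)) (aeD W2 W3)) (filterI (LabsE (Lrestr S (T u)))
      (filterI (LrestrE (T u) mS) (aeZ (eta * A)%:C (Labs h)))))
    (filterI (filterI (LabsE h) (aeZ (A * kap)%:C Lone))
      (filterI (filterI LoneE g0) (filterI h0 (filterI hS yg)))) => z.
  move=> [[uz sz] [ez xz]] [[-> ->] [W1z [Rz W2z]]] [[hz W3z] [[onez gz] [h0z [Sz yz]]]].
  rewrite /W1 W1z /W2 W2z hz /W3 W3z onez Rz mulr1 -!rmorphM -!rmorphD.
  have hR : complex.Re (h z) = normc (h z) by rewrite {1}((ge0cP _).1 h0z).
  have gR : complex.Re (g z) = normc (g z) by rewrite {1}((ge0cP _).1 gz).
  have n0 := Defs.normc_ge0.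
  rewrite [leRHS]normcR_ge0; last first.
    exact: addr_ge0 (n0 _ _) (addr_ge0 (mulr_ge0 eA0 (n0 _ _)) Ak0).
  have -> : normc ((\1_S z)%:C * T u z) = `|\1_S z| * normc (T u z) by rewrite normcM normcR.
  have b3 : normc (u z) <= normc (y z).
    by rewrite uz normcR_ge0 ?le_max ?lexx ?orbT// ge_max n0 andbT gerBl mulr_ge0// gR n0.
  have [Sin|Sout] := pselect (S z).
    rewrite indicE mem_set// normr1 mul1r.
    have e_le : normc (excess t x h z) <= A * normc (h z).
      rewrite ez normcR_ge0 ?le_max ?lexx ?orbT// ge_max [X in _ && X]mulr_ge0 ?n0// andbT.
      by apply: (@le_trans _ _ (normc (x z))); rewrite -?hR// gerBl mulr_ge0// hR n0.
    apply: (@le_trans _ _ ((1 + eta) * normc (u z))).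
      by rewrite mulrDl mul1r lerDl mulr_ge0 ?n0// ltW.
    apply: (le_trans sz); rewrite lerD2l -mulrA.
    apply: (@le_trans _ _ (eta * (A * normc (h z)))); last by rewrite lerDl.
    by rewrite ler_wpM2l// ltW.
  rewrite indicE memNset// normr0 mul0r add0r.
  have [ty|yt] := ltP (t * complex.Re (g z)) (normc (y z)).
    have gk : complex.Re (g z) <= kap by rewrite leNgt; apply/negP => /(Sz ty).
    apply: (le_trans b3); apply: (le_trans yz); apply: (@le_trans _ _ (A * kap)).
      by rewrite ler_wpM2l.
    by rewrite lerDr mulr_ge0 ?n0.
  by rewrite uz max_r ?subr_le0// normc0 addr_ge0// mulr_ge0 ?n0.
have N1 : N W1 <= 2^-1 * N u by rewrite rnorm_Labs; exact: ui.
have N2 : N W2 = eta * A * N h by rewrite rnormZ normcR_ge0// rnorm_Labs.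
have N3 : N W3 = A * kap * N Lone by rewrite rnormZ normcR_ge0.
have : N u <= 2^-1 * N u + (eta * A * N h + A * kap * N Lone).
  apply: (le_trans uW); apply: le_trans (rnormD _ _) _; apply: lerD => //.
  by apply: le_trans (rnormD _ _) _; rewrite N2 N3.
by move: (N u) (eta * A * N h) (A * kap * N Lone) => a b e; lra.
Qed.

(** Chebyshev: where [|y| > t' g] and [g > kap], the excess over [t g] is at
    least [(t' - t) kap]. *)
Lemma excess_chebyshev (t t' kap : R) y g (S : set Om) :
  0 <= t -> t <= t' -> 0 <= kap -> {ae mu, forall z, 0 <= g z} -> measurable S ->
  {ae mu, forall z, S z -> t' * complex.Re (g z) < normc (y z) /\ kap < complex.Re (g z)} ->
  ((((t' - t) * kap) `^ p)%:E * mu S <= ((N (excess t y g)) `^ p)%:E)%E.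
Proof.
move=> t0 tt' kap0 g0 mS hS; rewrite rnorm_powR.
rewrite -[X in (_ * mu X)%E](setIT S) -integral_indic//.
rewrite -ge0_integralZl_EFin ?powR_ge0//; last first.
  by apply/measurable_EFinP; exact: measurable_indic.
apply: ae_ge0_le_integral => //.
- by move=> z _; rewrite mule_ge0 ?lee_fin ?powR_ge0 ?indicE.
- by apply: measurable_funeM; apply/measurable_EFinP; exact: measurable_indic.
- by move=> z _; rewrite lee_fin powR_ge0.
- by apply: measurable_normc_powR; exact: cLspace_meas.
apply: filterS2 (excessE y t0 g0) hS => z -> hz _; rewrite -EFinM lee_fin indicE.
have [zS|zS] := boolP (z \in S); last by rewrite mulr0 powR_ge0.
have [yz gz] := hz (set_mem zS).
rewrite mulr1 ge0_ler_powR ?nnegrE ?(ltW p0) ?Defs.normc_ge0 ?mulr_ge0 ?subr_ge0//.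
rewrite normcR_ge0 ?le_max ?lexx ?orbT//; apply/orP; left.
apply: (@le_trans _ _ ((t' - t) * complex.Re (g z))).
  by rewrite ler_wpM2l ?subr_ge0// ltW.
by rewrite mulrBl lerD2r ltW.
Qed.
End excess_estimates.


(** * Approximate eigenvectors at a unimodular number *)

Section approximate_eigenvectors.
Context d (Om : measurableType d) (R : realType).
Variable mu : {finite_measure set Om -> \bar R}.
Variables (p : R) (p1 : 1 <= p).
Local Notation X := (cLspace mu p1).
Local Notation N := (@rnorm R X).
Let p0 : 0 < p := p_gt0 p1.

Variable T : X -> X.
Hypotheses (Tb : @blin R X T) (Tpos : positive_op T).
Variable M : R.
Hypotheses (M0 : 0 <= M) (TM : forall k F, N (iter k T F) <= M * N F).
Variable c : R.
Hypotheses (c0 : 0 < c) (ui : forall A, measurable A -> (mu A < c%:E)%E ->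
  forall F, N (Lrestr A (T F)) <= 2^-1 * N F).

(** The functions [y j / g], cut off where [g <= 1 / (m + 1)], are bounded by
    [1], and [dimension_bound] applies to them. Its dichotomy for the level
    [|f| > t g] of a combination [f] is the one for the excess of [f] over [t g]:
    if that excess does not tend to [0] in norm, then [small_excess] makes the
    level set large, and if it does, then [excess_chebyshev] makes the higher level
    sets small. Independence of the [y j] keeps the norm of [f] away from [0], so
    that small levels [t] are large. *)
Lemma approximate_eigenvectors_bound (lam : R[i]) D C (x y : nat -> 'I_D -> X) :
  normc lam = 1 -> (forall n i, N (x n i) <= C) ->
  (forall n i, ((1 + n.+1%:R^-1)%:C * lam) *: y n i - T (y n i) =
     ((n.+1%:R^-1 : R)%:C * lam) *: x n i) ->
  (forall n (a : 'I_D -> R[i]) i, normc (a i) <= 2 ^+ i * N (\sum_j a j *: y n j)) ->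
  D%:R * c <= 32 * fine (mu setT).
Proof.
move=> lam1 xC yE ind.
have n0 := Defs.normc_ge0.
pose e n : R := n.+1%:R^-1.
have e0 n : 0 < e n by rewrite invr_gt0 ltr0n.
pose h n : X := \sum_j Labs (x n j).
have hE n : {ae mu, forall z, h n z = (\sum_j normc (x n j z))%:C}.
  apply: filterS2 (ae_sum (fun j => Labs (x n j))) (ae_all_ord (fun j => LabsE (x n j))) => z -> Hz.
  by rewrite rmorph_sum /=; apply: eq_bigr => j _; rewrite Hz.
have h0 n : {ae mu, forall z, 0 <= h n z}.
  by apply: filterS (hE n) => z ->; rewrite lecR sumr_ge0.
have xh n j : {ae mu, forall z, normc (x n j z) <= complex.Re (h n z)}.
  by apply: filterS (hE n) => z -> /=; rewrite (bigD1 j)//= lerDl sumr_ge0.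
have hN n : N (h n) <= D%:R * C.
  apply: le_trans (rnorm_sum _) _.
  apply: (@le_trans _ _ (\sum_(j < D) C)).
    by apply: ler_sum => j _; rewrite rnorm_Labs.
  by rewrite sumr_const card_ord mulr_natl.
have [g gP] := choice (fun n => superharmonic Tb Tpos M0 TM (e0 n) (h0 n)).
have gE n := let: And3 H _ _ := gP n in H.
have g0 n := let: And3 _ H _ := gP n in H.
pose B := M * (D%:R * C).
have gN n : N (g n) <= B.
  by have [_ _ H] := gP n; apply: le_trans H _; rewrite ler_wpM2l.
have yg n j : {ae mu, forall z, normc (y n j z) <= complex.Re (g n z)}.
  have K := dominated_by_superharmonic Tb Tpos TM (e0 n) lam1 (g0 n) (h0 n) (gE n) (yE n j).
  exact: K (xh n j).
have yga n : {ae mu, forall z, forall j, normc (y n j z) <= complex.Re (g n z)}.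
  by apply: ae_all_ord => j; exact: yg.
have xha n : {ae mu, forall z, forall j, normc (x n j z) <= complex.Re (h n z)}.
  by apply: ae_all_ord => j; exact: xh.
pose A (al : 'rV[R]_D) : R := \sum_j `|al 0 j|.
have A0 al : 0 <= A al by rewrite sumr_ge0.
pose lc (v : 'I_D -> X) (al : 'rV[R]_D) : X := \sum_j (al 0 j)%:C *: v j.
have lcE v al : {ae mu, forall z, lc v al z = \sum_j (al 0 j)%:C * v j z}.
  have H := ae_all_ord (fun j => aeZ (al 0 j)%:C (v j)).
  apply: filterS2 (ae_sum (fun j => (al 0 j)%:C *: v j : X)) H => z -> Hz.
  exact: eq_bigr.
have lc_le (v : 'I_D -> X) al (b : Om -> R) : {ae mu, forall z, forall j, normc (v j z) <= b z} ->
    {ae mu, forall z, normc (lc v al z) <= A al * b z}.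
  move=> vb; apply: filterS2 (lcE v al) vb => z -> vz.
  rewrite mulr_suml; apply: le_trans (normc_sum _) _.
  by apply: ler_sum => j _; rewrite normcM normcR ler_wpM2l.
pose f al n := lc (y n) al.
have fE al n : ((1 + e n)%:C * lam) *: f al n - T (f al n) = ((e n)%:C * lam) *: lc (x n) al.
  rewrite /f /lc (blin_sum _ Tb) !scaler_sumr -sumrB; apply: eq_bigr => j _.
  rewrite (blinZ _ _ Tb); have := yE n j; rewrite -/(e n).
  move: ((1 + e n)%:C * lam) ((e n)%:C * lam) (al 0 j)%:C => v w r yEj.
  by rewrite [RHS]scalerA mulrC -scalerA -yEj; lmod R[i].
pose G n z := complex.Re (g n z).
pose kap m : R := m.+1%:R^-1.
have kap0 m : 0 < kap m by rewrite invr_gt0 ltr0n.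
(* requiring [|y j| <= g] at every point of [Z] bounds the quotients everywhere, as
   opposed to almost everywhere *)
pose Z m n : set Om := [set z | kap m < G n z /\ forall j, normc (y n j z) <= G n z].
have mG n : measurable_fun setT (G n) by exact: (cLspace_meas (g n)).1.
have my n j : measurable_fun setT (fun z => normc (y n j z)).
  by apply: measurable_normc; exact: cLspace_meas.
have mZ m n : measurable (Z m n).
  have -> : Z m n = [set z | kap m < G n z] `&`
      \bigcap_(j in [set: 'I_D]) ~` [set z | 0 < normc (y n j z) - G n z].
    apply/seteqP; split => z /= [z1 z2]; split => // j.
      by move=> _ /=; apply/negP; rewrite -leNgt subr_le0.
    by have := z2 j I => /= /negP; rewrite -leNgt subr_le0.
  apply: measurableI; first exact: measurable_superlevel.
  apply: fin_bigcap_measurable => // j _; apply: measurableC.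
  by apply: measurable_superlevel; exact: measurable_funB.
(* the power [-1] is a measurable function, and agrees with the inverse on [Z] *)
pose coef (P : R[i] -> R) (j : 'I_D) m n z := \1_(Z m n) z * (P (y n j z) * G n z `^ (-1)).
have coef_meas P j m n : measurable_fun setT (fun z => P (y n j z)) ->
    measurable_fun setT (coef P j m n).
  move=> mP; apply: measurable_funM; first exact: measurable_indic.
  by apply: measurable_funM => //; apply: (measurableT_comp (measurable_powR _)).
have coef_le P j m n z : (forall w, `|P w| <= normc w) -> `|coef P j m n z| <= 1.
  move=> Ple; rewrite /coef indicE; have [/set_mem[Gz yz]|_] := boolP (z \in Z m n); last first.
    by rewrite mul0r normr0.
  have G0 : 0 < G n z := lt_trans (kap0 m) Gz.
  rewrite mul1r powR_inv1 ?(ltW G0)// normrM normfV (gtr0_norm G0) ler_pdivrMr// mul1r.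
  exact: le_trans (Ple _) (yz j).
pose a := coef (@complex.Re R); pose b := coef (@complex.Im R).
pose H (al : 'rV[R]_D) m n z :=
  (\sum_j al 0 j * a j m n z) ^+ 2 + (\sum_j al 0 j * b j m n z) ^+ 2.
have level al m n s z : 0 <= s -> s < H al m n z <->
    Z m n z /\ Num.sqrt s * G n z < normc (\sum_j (al 0 j)%:C * y n j z).
  move=> s0; rewrite /H /a /b /coef indicE.
  have [/set_mem zZ|/negP nZ] := boolP (z \in Z m n); last first.
    have off (P : R[i] -> R) :
        \sum_j al 0 j * (false%:R * (P (y n j z) * G n z `^ (-1))) = 0.
      by rewrite big1// => j _; rewrite mul0r mulr0.
    rewrite (off (@complex.Re R)) (off (@complex.Im R)) expr0n addr0.
    split => [|[zZ _]]; first by rewrite ltNge s0.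
    by case: nZ; exact: mem_set.
  have G0 : 0 < G n z := lt_trans (kap0 m) zZ.1.
  set F := \sum_j _ * y n j z.
  have sumE (P : R[i] -> R) : P F = \sum_j al 0 j * P (y n j z) ->
      \sum_j al 0 j * (true%:R * (P (y n j z) * G n z `^ (-1))) = P F / G n z.
    move=> ->; rewrite mulr_suml; apply: eq_bigr => j _.
    by rewrite mul1r mulrA powR_inv1// ltW.
  rewrite (sumE (@complex.Re R)); last first.
    by rewrite Re_sum; apply: eq_bigr => j _; case: (y n j z) => u v; simpc.
  rewrite (sumE (@complex.Im R)); last first.
    by rewrite Im_sum; apply: eq_bigr => j _; case: (y n j z) => u v; simpc.
  have -> : (complex.Re F / G n z) ^+ 2 + (complex.Im F / G n z) ^+ 2 = (normc F / G n z) ^+ 2.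
    rewrite !expr_div_n -mulrDl; congr (_ / _).
    by case: (F) => u v; rewrite sqr_sqrtr// addr_ge0 ?sqr_ge0.
  rewrite -[in X in X < _](sqr_sqrtr s0) ltr_sqr ?nnegrE ?sqrtr_ge0 ?divr_ge0 ?n0 ?(ltW G0)//.
  by rewrite ltr_pdivlMr//; split => [|[]].
have mH al m n s : 0 <= s -> measurable [set z | s < H al m n z].
  move=> s0; apply: measurable_superlevel; apply: measurable_funD.
    apply: measurable_funX; apply: measurable_sum => j.
    apply: measurable_funM => //; apply: coef_meas; exact: (cLspace_meas (y n j)).1.
  apply: measurable_funX; apply: measurable_sum => j.
  apply: measurable_funM => //; apply: coef_meas; exact: (cLspace_meas (y n j)).2.
have [U [UU Uoo]] := free_ultrafilter.
pose u al s n := excess (Num.sqrt s) (f al n) (g n).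
pose big al s := exists m0, forall m, (m0 <= m)%N ->
  U [set n | (c%:E <= mu [set z | (s < H al m n z)%R])%E].
have Uge k : U [set n | (k <= n)%N] by apply: Uoo; exact: nbhs_infty_ge.
have e_small K r : 0 < r -> exists k, forall n, (k <= n)%N -> K * e n < r.
  move=> r0; have [K0|K0] := leP K 0.
    exists 0%N => n _; apply: le_lt_trans r0.
    by rewrite pmulr_lle0.
  exists (Num.bound (K / r)) => n kn; rewrite ltr_pdivrMr ?ltr0n// mulrC -ltr_pdivrMr//.
  have Kr : 0 <= K / r by rewrite divr_ge0// ltW.
  by apply: (lt_le_trans (archi_boundP Kr)); rewrite ler_nat (leq_trans kn).
have excess_big al s dl : 0 <= s -> 0 < dl -> U [set n | dl <= N (u al s n)] -> big al s.
  move=> s0 dl0 Udl.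
  have [m0 m0P] := e_small (2 * (A al * N (Lone mu p1))) (dl / 2) (divr_gt0 dl0 (ltr0Sn _ 1)).
  have [k kP] := e_small (2 * (A al * (D%:R * C))) (dl / 2) (divr_gt0 dl0 (ltr0Sn _ 1)).
  exists m0 => m mm; apply: filterS2 Udl (Uge k) => n /= dlu kn.
  rewrite leNgt; apply/negP => muS.
  have E : {ae mu, forall z, Num.sqrt s * complex.Re (g n z) < normc (f al n z) ->
      kap m < complex.Re (g n z) -> [set z | s < H al m n z] z}.
    by apply: filterS2 (lcE (y n) al) (yga n) => z -> yz fz kz /=; apply/level.
  have := small_excess Tb Tpos ui (e0 n) (sqrtr_ge0 s) (A0 al) (ltW (kap0 m)) lam1 (g0 n) (h0 n)
    (gE n) (fE al n) (lc_le _ al _ (xha n)) (lc_le _ al _ (yga n)) (mH al m n s s0) E muS.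
  have b3 : A al * (e n * N (h n)) <= A al * (e n * (D%:R * C)).
    by rewrite ler_wpM2l// ler_wpM2l// ltW.
  have b1 : 2 * (A al * N (Lone mu p1)) * kap m < dl / 2 by exact: m0P.
  have b2 := kP n kn.
  rewrite -/(u al s n) => b4; move: dlu; apply/negP; rewrite -ltNge.
  move: b1 b2 b3 b4; move: (N (u al s n)) (N (h n)) (N (Lone mu p1)) (A al) (kap m) (e n) (D%:R * C).
  move=> r1 r2 r3 r4 r5 r6 r7; lra.
apply: (@dimension_bound _ _ _ mu U UU D a b 1 c Uoo c0).
- move=> j m n; split; apply: coef_meas; first exact: (cLspace_meas (y n j)).1.
  exact: (cLspace_meas (y n j)).2.
- move=> j m n z; split; apply: coef_le; [exact: Re_le_normc|exact: Im_le_normc].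
- move=> al s s0.
  have [[dl [dl0 Udl]]|nU] := pselect (exists dl, 0 < dl /\ U [set n | dl <= N (u al s n)]).
    by left; exact: excess_big Udl.
  right => s' ss' m r r0.
  have s'0 : 0 <= s' := le_trans s0 (ltW ss').
  have sq : Num.sqrt s < Num.sqrt s' by rewrite ltr_sqrt// (le_lt_trans s0).
  pose K := ((Num.sqrt s' - Num.sqrt s) * kap m) `^ p.
  have K0 : 0 < K by rewrite powR_gt0// mulr_gt0// subr_gt0.
  pose dl := (K * r) `^ p^-1.
  have dl0 : 0 < dl by rewrite powR_gt0// mulr_gt0.
  have Uc : U (~` [set n | dl <= N (u al s n)]).
    have [UA|//] := in_ultra_setVsetC [set n | dl <= N (u al s n)] UU.
    by case: nU; exists dl.
  apply: filterS Uc => n /= /negP; rewrite -ltNge => udl.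
  have E : {ae mu, forall z, [set z | s' < H al m n z] z ->
      Num.sqrt s' * complex.Re (g n z) < normc (f al n z) /\ kap m < complex.Re (g n z)}.
    by apply: filterS (lcE (y n) al) => z -> /= /level[]// [].
  have := excess_chebyshev (sqrtr_ge0 s) (ltW sq) (ltW (kap0 m)) (g0 n) (mH al m n s' s'0) E.
  rewrite -/(u al s n) -/K => cheb.
  have le1 : (K%:E * mu [set z | (s' < H al m n z)%R] <= (K * r)%:E)%E.
    apply: le_trans cheb _; rewrite lee_fin.
    have -> : K * r = dl `^ p by rewrite /dl -powRrM mulVf ?gt_eqF// powRr1// mulr_ge0 ?ltW.
    by apply: ge0_ler_powR; rewrite ?nnegrE ?(ltW p0) ?(ltW dl0) ?rnorm_ge0 ?(ltW udl).
  by move: le1; rewrite EFinM lee_pmul2l.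
- move=> al al0; have [j alj] : exists j, al 0 j != 0.
    apply: contrapT => nj; move/eqP: al0; apply; apply/rowP => j; rewrite mxE.
    by apply: contrapT => /eqP aj; apply: nj; exists j.
  pose beta := `|al 0 j| / 2 ^+ j.
  have beta0 : 0 < beta by rewrite divr_gt0 ?normr_gt0// exprn_gt0.
  have fN n : beta <= N (f al n).
    by rewrite ler_pdivrMr ?exprn_gt0// mulrC -normcR; exact: (ind n (fun j => (al 0 j)%:C) j).
  have B0 : 0 <= B by exact: le_trans (rnorm_ge0 _) (gN 0%N).
  (* at level [t] the part of [f] below [t g] has norm at most [beta / 2] *)
  pose t := beta / (2 * (B + 1)).
  have t0 : 0 < t by rewrite divr_gt0// mulr_gt0// ltr_wpDl.
  exists (t ^+ 2); first by rewrite exprn_gt0.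
  apply: (excess_big al (t ^+ 2) (beta / 2)); first by rewrite exprn_ge0// ltW.
    by rewrite divr_gt0.
  apply: filterS (Uge 0%N) => n _ /=.
  have sqt : Num.sqrt (t ^+ 2) = t by rewrite sqrtr_sqr gtr0_norm.
  have fu : N (f al n) <= N (u al (t ^+ 2) n) + t * N (g n).
    rewrite -{2}(normcR_ge0 (ltW t0)) -rnormZ -(rnorm_Labs (u _ _ _)).
    apply: le_trans (rnormD _ _); apply: le_rnorm.
    have := excessE (f al n) (sqrtr_ge0 (t ^+ 2)) (g0 n); rewrite -/(u al (t ^+ 2) n) => uE.
    apply: filterS3 uE (g0 n) (filterI (aeD (Labs (u al (t ^+ 2) n)) (t%:C *: g n))
      (filterI (LabsE (u al (t ^+ 2) n)) (aeZ t%:C (g n)))) => z uz /ge0cP gz [-> [-> ->]].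
    have gR : complex.Re (g n z) = normc (g n z) by rewrite {1}gz.
    rewrite uz sqt gR {2}gz -rmorphM -rmorphD normcR; apply: le_trans (ler_norm _).
    by rewrite -lerBlDr normcR; apply: le_trans (ler_norm _); rewrite le_max lexx.
  have tB : t * N (g n) <= beta / 2.
    apply: (@le_trans _ _ (t * (B + 1))).
      by rewrite ler_wpM2l ?(ltW t0)//; apply: le_trans (gN n) _; rewrite lerDl.
    by rewrite /t invfM mulrA mulfVK// gt_eqF// ltr_wpDl.
  have := fN n; lra.
Qed.

End approximate_eigenvectors.

(** * The essential spectral radius of T *)

Theorem theorem1p1 (R : realType) (d : measure_display)
    (Omega : measurableType d) (mu : {finite_measure set Omega -> \bar R})
    (p q : R) (lt1p : 1 < p) (ltpq : p < q)
    (T : {linear cLspace mu (ltW lt1p) -> cLspace mu (ltW lt1p)})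
    (T_positive : positive_op T)
    (T_power_bounded : power_bounded T)
    (T_Lq : forall f : cLspace mu (ltW lt1p),
      ((T f : cLspace mu (ltW lt1p)) : Omega -> R[i]) \in cLfun mu q) :
  (ess_spectral_radius T < 1)%E.

Proof.
set p1 := ltW lt1p.
pose X := cLspace mu p1; pose T0 : X -> X := T.
pose N := @rnorm R X.
have [M M0 TM] : exists2 M : R, 0 <= M & forall k x, N (iter k T0 x) <= M * N x.
  have [M MP] : exists M : R, forall n, (opnorm (iter n T) <= M%:E)%E.
    move: T_power_bounded; rewrite /power_bounded.
    case E : (ereal_sup _) => [M| |] // _.
      exists M => n; rewrite -E; apply: ereal_sup_ubound; by exists n.
    exists 0 => n; apply: le_trans (leNye _); rewrite -E.
    by apply: ereal_sup_ubound; exists n.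
  exists (Num.max M 0) => [|k x]; first by rewrite le_max lexx orbT.
  apply: (@opnorm_bound R X (iter k T0)).
    by move=> a z; elim: k => //= k IH; rewrite IH /T0 linearZ.
  by apply: le_trans (MP k) _; rewrite lee_fin le_max lexx.
have Tb : @blin R X T0.
  by split => [a x y|]; [exact: linearP|exists M => // x; exact: (TM 1%N x)].
have [c c0 ui] := positive_uniformly_integrable ltpq Tb T_positive T_Lq.
apply: (@ess_spectral_radius_lt1 R X T M) => //.
- exact: Lp_abs_complete.
- exact: Lp_norming.
move=> lam lam1.
have Vc0 : 0 <= 32 * fine (mu setT) / c.
  by rewrite divr_ge0 ?mulr_ge0 ?fine_ge0// ltW.
exists (Num.bound (32 * fine (mu setT) / c)); set D := Num.bound _ => C.
have DV : 32 * fine (mu setT) < D%:R * c.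
  by rewrite -ltr_pdivrMr//; exact: archi_boundP.
apply: contrapT => no_eta.
(* if no [eta] works, take the failing families for [eta = 1 / (n + 1)] *)
have fam n : exists xy : (nat -> X) * (nat -> X),
    [/\ forall i, (i < D)%N -> N (xy.1 i) <= C,
     forall i, (i < D)%N -> ((1 + n.+1%:R^-1)%:C * lam) *: xy.2 i - T0 (xy.2 i) =
       ((n.+1%:R^-1 : R)%:C * lam) *: xy.1 i
    & forall (a : nat -> R[i]) i, (i < D)%N ->
       normc (a i) <= 2 ^+ i * N (\sum_(j < D) a j *: xy.2 j)].
  apply: contrapT => no_xy; apply: no_eta.
  exists (n.+1%:R^-1); first by rewrite invr_gt0 ltr0n.
  by move=> x y xC yE ind; apply: no_xy; exists (x, y).
have [xy xyP] := choice fam.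
move: DV; apply/negP; rewrite -leNgt.
apply: (@approximate_eigenvectors_bound _ _ _ mu p p1 T0 Tb T_positive M M0 TM c c0 ui lam D C
  (fun n i => (xy n).1 i) (fun n i => (xy n).2 i)) => //.
- by move=> n i; have [+ _ _] := xyP n; apply.
- by move=> n i; have [_ + _] := xyP n; apply.
move=> n a i; have [_ _ ind] := xyP n.
pose a' k := if insub k is Some j then a j else 0.
have aE (j : 'I_D) : a' j = a j by rewrite /a' valK.
by rewrite -aE; under eq_bigr => j _ do rewrite -aE; exact: ind.
Qed.
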